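(* For each positive integer $k$ there exists an effectively computable constant $B_k$ such that, if $N$ is an odd superperfect number with either $\omega(N)\leq k$ or $\omega(\sigma(N))\leq k$, then $N\leq B_k$.
   Context: $\sigma(n)$ denotes the sum of the positive divisors of a positive integer $n$, and $\omega(n)$ denotes the number of distinct prime factors of $n$. A positive integer $N$ is called superperfect if $\sigma(\sigma(N))=2N$. ''Effectively computable constant'' means that $B_k$ can be given by a computable function of $k$. *)

(* Defs.v *)
From mathcomp Require Import all_boot.

Set Implicit Arguments.
Unset Strict Implicit.
Unset Printing Implicit Defensive.

Definition sigma (n : nat) : nat := \sum_(d <- divisors n) d.

Definition omega (n : nat) : nat := size (primes n).

Definition superperfect (N : nat) : Prop := 0 < N /\ sigma (sigma N) = 2 * N.

(* Codes of mu-recursive (partial) functions nat^n -> nat. *)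
Inductive rec_code : nat -> Type :=
| RZero n : rec_code n
| RSucc : rec_code 1
| RProj n (i : 'I_n) : rec_code n
| RComp m n (f : rec_code m) (g : 'I_m -> rec_code n) : rec_code n
| RPrim n (f : rec_code n) (g : rec_code n.+2) : rec_code n.+1
| RMu n (f : rec_code n.+1) : rec_code n.

(* [rec_eval c v y]: the partial function coded by [c] is defined at [v], with
   value [y].  The recursion variable of [RPrim] and the variable minimised by
   [RMu] come first in the argument tuple.  In the [RPrim] case only the values
   [s 0, ..., s (thead v)] matter: they are the successive stages of the
   recursion. *)
Fixpoint rec_eval n (c : rec_code n) : n.-tuple nat -> nat -> Prop :=
  match c in rec_code n return n.-tuple nat -> nat -> Prop with
  | RZero _ => fun _ y => y = 0
  | RSucc => fun v y => y = (thead v).+1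
  | RProj _ i => fun v y => y = tnth v i
  | RComp m _ f g => fun v y =>
      exists w : m.-tuple nat,
        (forall i, rec_eval (g i) v (tnth w i)) /\ rec_eval f w y
  | RPrim n f g => fun v y =>
      let x : n.-tuple nat := [tuple of behead v] in
      exists s : nat -> nat,
        [/\ rec_eval f x (s 0),
            forall i, i < thead v ->
              rec_eval g [tuple of i :: s i :: x] (s i.+1)
          & y = s (thead v)]
  | RMu _ f => fun v y =>
      rec_eval f [tuple of y :: v] 0 /\
      forall z, z < y -> exists r, rec_eval f [tuple of z :: v] r.+1
  end.

Definition computable (B : nat -> nat) : Prop :=
  exists c : rec_code 1, forall k, rec_eval c [tuple k] (B k).

(* Main.v *)
(** If N is an odd superperfect number then M = sigma(N) is odd as well, and sigma maps each of N, M to the other up to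
    a factor 1 or 2. Let a be the one of them with at most k prime factors and b the other one. For a prime power l^e
    exactly dividing b, the number sigma(l^e) is a unit for the at most k + 1 primes dividing 2a.

    Linear forms in logarithms, in a weak form for integers obtained from Siegel's lemma and Hermite interpolation, show
    that only boundedly many l <= P have an exponent e larger than a power of log P; counting units bounds the other l.
    So b has at most P^(1/4) primes up to P, and the sum of 1/l over the primes l > Y of b is tiny.

    This yields a gap principle: as the product of sigma(p^e)/p^e over both sides is 2, there cannot be primes or
    exponents above X if there are none between X and some Y much larger than X. Build a rapidly increasing
    sequence of levels X_0 < X_1 < ... On a long stretch of it free of primes of a, a nonempty interval ]X_i, X_(i+1)] contains
    an exponent of a, or the prime or the exponent of one of the few l^e of large exponent, or the single l with e odd,
    or a prime l with e even and sigma(l^e) without prime factor above X_0. Thue's method, applied to two such l that are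
    far apart, congruent modulo (e + 1) X_0! and with a similar factorization of sigma(l^e), bounds the number
    of intervals of the last kind. Hence some interval is empty and the gap principle bounds N. *)

Require Import Defs.
From mathcomp Require Import all_boot all_order all_algebra fingroup perm cyclic.
From mathcomp Require Import classical_sets boolp functions reals topology normedtype derive sequences realfun exp.
From mathcomp Require Import zify ring lra.

Set Implicit Arguments.
Unset Strict Implicit.
Unset Printing Implicit Defensive.

Import Order.TTheory GRing.Theory Num.Theory.
Import numFieldNormedType.Exports.

Local Open Scope ring_scope.

(** * Siegel's lemma *)

(** The side [b] may have arbitrarily many primes, so its primes cannot be pigeonholed directly: the
    number of levels must be fixed in advance, as a function of [k] and [X_0] only. Every kind of
    obstruction is therefore counted by something depending on [k] and [X_0] alone. For primes [l]
    with [sg l e] smooth over [X_0], lifting the exponent bounds [e] by [X_0], which leaves finitely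
    many patterns. If [sg l e] has a prime factor above [X_0], this factor is a prime of [a], hence
    lies beyond the whole stretch, and [e] must be huge compared with [log l]; the bound for large
    exponents leaves few such [l]. The linear forms met here have size about [2^-e], and a lower
    bound of the quality [2^-(e^(1/8))] already contradicts this once [e] exceeds a power of the
    logarithms of the numbers involved. So a weak dependence on the coefficients suffices, and this
    is why an elementary form of Baker's method with rational integer values is enough. *)

Lemma siegel (M N A t : nat) (a : 'I_M -> 'I_N -> int) :
  (forall i j, `|a i j| <= A%:Z) -> (0 < A)%N -> (M < N)%N -> (M <= t * (N - M))%N ->
  exists x : 'I_N -> int,
    [/\ exists j, x j != 0, forall j, `|x j| <= ((N * A) ^ t)%N%:Z
      & forall i, \sum_j a i j * x j = 0].
Proof.
move=> aA A0 MN Mt.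
set X := ((N * A) ^ t)%N.
have N0 : (0 < N)%N by apply: leq_ltn_trans MN.
have NA0 : (0 < N * A)%N by rewrite muln_gt0 N0.
have X0 : (0 < X)%N by rewrite expn_gt0 NA0.
(* [neg i] adds up the absolute values of the negative coefficients, so that shifting form [i] by
   [neg i * X] places all its values in [[0, N * A * X]]. *)
pose neg i := \sum_j (if a i j < 0 then `|a i j|%N else 0%N).
pose val i (x : 'I_N -> 'I_X.+1) := \sum_j a i j * (x j)%:Z.
have bnd i x : 0 <= val i x + ((neg i * X)%N)%:Z <= (N * A * X)%N%:Z.
  have -> : val i x + ((neg i * X)%N)%:Z =
     \sum_j (a i j * (x j)%:Z + (if a i j < 0 then `|a i j|%N else 0%N)%:Z * X%:Z).
    rewrite big_split /=; congr (_ + _).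
    rewrite -big_distrl /= PoszM; congr (_ * _).
    by rewrite /neg (big_morph Posz PoszD (erefl 0%:Z)).
  have xX j : (x j)%:Z <= X%:Z by rewrite lez_nat -ltnS.
  have aj j : -(A%:Z) <= a i j <= A%:Z by rewrite -ler_norml; apply: aA.
  apply/andP; split.
    apply: sumr_ge0 => j _; have := aj j; have := xX j; case: ifP => /=; nia.
  apply: (@le_trans _ _ (\sum_(j < N) A%:Z * X%:Z)).
    apply: ler_sum => j _; have := aj j; have := xX j; case: ifP => /=; nia.
  by rewrite sumr_const card_ord -mulr_natl; lia.
pose F (x : {ffun 'I_N -> 'I_X.+1}) : {ffun 'I_M -> 'I_(N * A * X).+1} :=
  [ffun i => inord (absz (val i x + ((neg i * X)%N)%:Z)%R)].
(* Pigeonhole: [(N A X + 1)^M <= (N A)^M (X + 1)^M], and [(N A)^M <= X^(N - M)] because [t] is an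
   upper bound for [M / (N - M)]. *)
have : ~~ injectiveb F.
  apply/negP => /injectiveP /leq_card; rewrite !card_ffun !card_ord leqNgt => /negP; apply.
  have h1 : ((N * A * X).+1 <= N * A * X.+1)%N by rewrite mulnS; lia.
  apply: (@leq_ltn_trans ((N * A * X.+1) ^ M)); first by have [->|M0] := posnP M; rewrite ?expn0 ?leq_exp2r.
  have -> : (X.+1 ^ N = X.+1 ^ (N - M) * X.+1 ^ M)%N by rewrite -expnD subnK // ltnW.
  rewrite expnMn ltn_pmul2r ?expn_gt0 //.
  apply: (@leq_ltn_trans (X ^ (N - M))); last by rewrite ltn_exp2r ?subn_gt0.
  by rewrite /X -(expnM _ t); apply: leq_pexp2l.
case/injectivePn => x [y] xy Fxy.
exists (fun j => (x j)%:Z - (y j)%:Z); split.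
- have [j jP] : exists j, x j != y j.
    apply/existsP; rewrite -negb_forall; apply: contra xy => /forallP e.
    by apply/eqP/ffunP => j; apply/eqP.
  exists j; rewrite subr_eq0; apply: contra jP => /eqP [] e; exact/eqP/val_inj.
- by move=> j; have := ltn_ord (x j); have := ltn_ord (y j); rewrite -/X; lia.
- move=> i; have := congr1 (fun f : {ffun _ -> _} => nat_of_ord (f i)) Fxy.
  have := bnd i x; have := bnd i y; rewrite !ffunE.
  have -> : \sum_j a i j * ((x j)%:Z - (y j)%:Z) = val i x - val i y.
    by rewrite -sumrB; apply: eq_bigr => j _; rewrite mulrBr.
  move: (val i x) (val i y) => u v hv hu.
  rewrite !inordK; lia.
Qed.

(** * Hermite interpolation over node polynomials *)

(** A run of equal nodes from [i] to [j] encodes a zero of order [j - i + 1]. Passing to the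
    derivative, two equal neighbours leave one node in place and two distinct neighbours produce a
    Rolle point, so the same pattern holds for [G 1] with one node fewer. *)
Lemma rolle_multiplicity (R : realType) (K : nat) (G : nat -> R -> R) (t : nat -> R) :
  (forall (m : nat) (x : R), is_derive x (1 : R) (G m) (G m.+1 x)) ->
  (forall i, (i < K)%N -> t i <= t i.+1) ->
  (forall i j, (i <= j)%N -> (j <= K)%N -> t i = t j -> G (j - i)%N (t i) = 0) ->
  exists2 xi, t 0%N <= xi <= t K & G K xi = 0.
Proof.
elim: K G t => [|K IH] G t dG ht zG.
  by exists (t 0%N); rewrite ?lexx //; have := zG 0%N 0%N; apply.
have /choice[t' t'P] : forall i, exists c, (i <= K)%N ->
    (t i = t i.+1 /\ c = t i) \/ (t i < c < t i.+1 /\ G 1%N c = 0).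
  move=> i; case: (leqP i K) => iK; last by exists 0.
  have [e|ne] := eqVneq (t i) (t i.+1); first by exists (t i) => _; left.
  have lt : t i < t i.+1 by rewrite lt_neqAle ne ht.
  have G0 j : (j <= K.+1)%N -> G 0%N (t j) = 0 by move=> jK; rewrite -(subnn j) zG.
  have cG : {within `[t i, t i.+1], continuous (G 0%N)}%classic.
    apply: derivable_within_continuous => x _; exact: ex_derive.
  have dvG x : derivable (G 0%N) x 1 by apply: ex_derive; exact: dG.
  have [c cI dc] := Rolle lt (fun x _ => dvG x) cG
    (etrans (G0 i (leqW iK)) (esym (G0 i.+1 iK))).
  exists c => _; right; split; first by move: cI; rewrite in_itv.
  by rewrite -(@derive_val _ _ _ _ _ _ _ dc); symmetry; apply: derive_val.
have bt i : (i <= K)%N -> t i <= t' i <= t i.+1.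
  by move=> iK; case: (t'P i iK) => [[<- ->]|[/andP[a b] _]]; rewrite ?lexx // !ltW.
have [| |xi /andP[x1 x2] zx] := IH (fun m => G m.+1) t' (fun m x => dG m.+1 x).
- move=> i iK; have /andP[_ a] := bt i (ltnW iK); have /andP[b _] := bt i.+1 iK.
  exact: le_trans a b.
- move=> i j ij jK e.
  have iK := leq_trans ij jK.
  have mono a b : (a <= b)%N -> (b <= K.+1)%N -> t a <= t b.
    move=> ab bK; elim: b ab bK => [|b IHb]; first by rewrite leqn0 => /eqP ->.
    rewrite leq_eqVlt => /orP[/eqP -> //|ab] bK.
    by apply: (le_trans (IHb ab (ltnW bK))); apply: ht.
  have [ei|nij] := eqVneq i j.
    rewrite -ei subnn; case: (t'P i iK) => [[e1 ->]|[_ ->] //].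
    by have := zG i i.+1; rewrite subSnn; apply.
  have ltij : (i < j)%N by rewrite ltn_neqAle nij.
  have bi := bt i iK; have bj := bt j jK; have m1 := mono i.+1 j ltij (leqW jK).
  (* If [t' i = t' j], the nodes [i + 1, ..., j] coincide; a strict Rolle point at either end would
     separate the two, so [i, ..., j + 1] is a single repeated node. *)
  have ej : t j = t i.+1 by apply/eqP; rewrite eq_le; move: bi bj m1; rewrite e; lra.
  case: (t'P i iK) => [[e1 e2]|[h _]]; last by move: bi bj h; rewrite e ej; lra.
  case: (t'P j jK) => [[e3 e4]|[h _]]; last by move: bi bj h; rewrite -e ej e2 -e1; lra.
  by rewrite e2 -subSn //; apply: zG; rewrite ?ltnS ?(leqW ij) // -e3 ej.
exists xi => //; have /andP[a _] := bt 0%N isT; have /andP[_ b] := bt K (leqnn K).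
by rewrite (le_trans a x1) (le_trans x2 b).
Qed.

Lemma derivn_XsubC_expM (R : comNzRingType) (a : R) (r m : nat) (Q : {poly R}) :
  (m <= r)%N ->
  ((('X - a%:P) ^+ r * Q)^`(m)).[a] = if m == r then (r`!)%:R * Q.[a] else 0.
Proof.
elim: r m Q => [|r IH] m Q.
  by rewrite leqn0 => /eqP ->; rewrite derivn0 expr0 !mul1r.
case: m => [|m] mr.
  by rewrite derivn0 hornerM horner_exp hornerXsubC subrr exprS !mul0r.
have e : (('X - a%:P) ^+ r.+1 * Q)^`() =
   ('X - a%:P) ^+ r * (Q *+ r.+1 + ('X - a%:P) * Q^`()).
  by rewrite derivM deriv_exp derivXsubC mul1r /= exprSr [RHS]mulrDr mulrnAr mulrnAl mulrA.
rewrite derivSn e IH // eqSS; case: ifP => // _.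
by rewrite hornerD hornerMn hornerM hornerXsubC subrr mul0r addr0 factS natrM; ring.
Qed.

Section HermitePoly.
Variable R : realType.
Implicit Types (p : {poly R}).

Lemma coef_bound_mulXsubC p (c a b : R) : (forall i, `|p`_i| <= c) -> `|a| <= b ->
  forall i, `|(('X - a%:P) * p)`_i| <= (1 + b) * c.
Proof.
move=> hp ha i; rewrite mulrBl coefB coefXM coefCM.
have c0 : 0 <= c by apply: le_trans (hp 0%N).
have h : `|a * p`_i| <= b * c by rewrite normrM ler_pM.
have h' : `|if i == 0%N then 0 else p`_i.-1| <= c by case: ifP; rewrite ?normr0.
by apply: (le_trans (ler_normB _ _)); rewrite mulrDl mul1r lerD.
Qed.

Lemma coef_bound_exp_XsubC p (c a b : R) r : (forall i, `|p`_i| <= c) -> `|a| <= b ->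
  forall i, `|(('X - a%:P) ^+ r * p)`_i| <= (1 + b) ^+ r * c.
Proof.
move=> hp ha; elim: r => [|r IH] i; first by rewrite !expr0 !mul1r.
by rewrite !exprS -!mulrA; apply: coef_bound_mulXsubC.
Qed.

Lemma horner_derivn_bound p (c : R) (K m s S : nat) : (size p <= K)%N ->
  (forall i, `|p`_i| <= c) -> (m < K)%N -> (s <= S)%N ->
  `|p^`(m).[s%:R]| <= c * ((K.+1 * S.+1) ^ K.+1)%N%:R.
Proof.
move=> sp hp mK sS.
have c0 : 0 <= c by apply: le_trans (hp 0%N).
have sz : (size p^`(m) <= K)%N.
  elim: m {mK} => [|m IH]; first by rewrite derivn0.
  rewrite derivnS; have [->|nz] := eqVneq p^`(m) 0; first by rewrite linear0 size_poly0.
  exact: leq_trans (ltnW (lt_size_deriv nz)) IH.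
rewrite (horner_coef_wide _ sz).
apply: (le_trans (ler_norm_sum _ _ _)).
apply: (@le_trans _ _ (\sum_(i < K) c * ((K.+1 * S.+1) ^ K)%N%:R)); last first.
  rewrite sumr_const card_ord -[_ *+ K]mulr_natl mulrCA; apply: ler_wpM2l => //.
  rewrite -natrM ler_nat expnS.
  by rewrite leq_mul2r; apply/orP; right; rewrite mulSn; nia.
apply: ler_sum => i _; rewrite coef_derivn normrM normrX normr_nat normrMn -[_ *+ (_ ^_ _)]mulr_natr.
case: (ltnP (m + i) K) => miK; last first.
  by rewrite nth_default ?normr0 ?mul0r ?mulr_ge0 // (leq_trans sp).
rewrite -mulrA; apply: ler_pM => //; first by rewrite mulr_ge0 ?exprn_ge0.
rewrite -[_ ^+ i]natrX -natrM. rewrite ler_nat expnMn leq_mul //.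
  apply: (@leq_trans (K ^ m)); last first.
    apply: (@leq_trans (K.+1 ^ m)); first by case: (m) => // m'; rewrite leq_exp2r.
    by rewrite leq_pexp2l // ltnW.
  have : (m + i <= K)%N by rewrite ltnW.
  move: (m + i)%N => u uK; elim: (m) => [|m' IH]; first by rewrite ffactn0.
  by rewrite ffactnSr expnSr leq_mul // (leq_trans (leq_subr _ _)).
apply: (@leq_trans (S.+1 ^ i)); first by case: (i : nat) => // i'; rewrite leq_exp2r // ltnW.
by rewrite leq_pexp2l // ltnW.
Qed.

Definition node_poly (M s : nat) : {poly R} := \prod_(i < s) ('X - (i%:R)%:P) ^+ M.

Lemma node_poly_monic M s : node_poly M s \is monic.
Proof. by apply: monic_prod => i _; rewrite monic_exp // monicXsubC. Qed.

Lemma size_node_poly M s : size (node_poly M s) = (s * M).+1.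
Proof.
rewrite /node_poly prodrXl.
have m0 : \prod_(i < s) ('X - (i%:R)%:P : {poly R}) \is monic by rewrite monic_prod_XsubC.
have := size_exp (\prod_(i < s) ('X - (i%:R)%:P : {poly R})) M.
have idx : size (index_enum 'I_s) = s by rewrite -sum1_size sum1_card card_ord.
rewrite size_prod_XsubC idx /= => <-.
by rewrite prednK // size_poly_gt0; apply: monic_neq0; rewrite monic_exp.
Qed.

Lemma node_poly_bound M s S : (s <= S)%N ->
  forall i, `|(node_poly M s)`_i| <= (S.+1 ^ (s * M))%N%:R.
Proof.
rewrite /node_poly; elim: s => [|s IH] sS i.
  by rewrite big_ord0 mul0n expn0 coef1; case: eqP; rewrite ?normr1 ?normr0.
rewrite big_ord_recr /= mulrC.
apply: (le_trans (coef_bound_exp_XsubC (b := S%:R) M (IH (ltnW sS)) _ _)).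
  by rewrite normr_nat ler_nat ltnW.
have -> : 1 + S%:R = S.+1%:R :> R by rewrite -natr1 addrC.
by rewrite -natrX -natrM -expnD mulSn.
Qed.

Lemma node_poly_deriv M s m (s' m' : nat) : (m < M)%N -> (m' < M)%N ->
  (s' * M + m' < s * M + m)%N ->
  ((('X - (s%:R)%:P) ^+ m * node_poly M s)^`(m')).[s'%:R] = 0.
Proof.
move=> mM mM' lt.
have [es|ns] := eqVneq s' s.
  by rewrite es in lt *; rewrite derivn_XsubC_expM; [case: eqP lt => // ->; rewrite ltnn|move: lt; lia].
have ss : (s' < s)%N by move: lt ns; nia.
rewrite /node_poly (bigD1 (Ordinal ss)) //= mulrCA derivn_XsubC_expM; last exact: ltnW.
by rewrite ltn_eqF.
Qed.

(** Newton interpolation: the conditions are met one by one in the order of [s * M + m], each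
    correction being a multiple of a polynomial [W] that vanishes on all earlier conditions
    ([node_poly_deriv]). *)
Lemma hermite_poly (S M : nat) (d : nat -> nat -> R) (eps : R) : (0 < M)%N -> 0 <= eps ->
  (forall s m, (s < S)%N -> (m < M)%N -> `|d s m| <= eps) ->
  exists H : {poly R}, [/\ (size H <= S * M)%N,
    forall s m, (s < S)%N -> (m < M)%N -> (H^`(m)).[s%:R] = d s m
    & forall i, `|H`_i| <= eps * (((S * M).+1 * S.+1) ^ (4 * (S * M).+1 * (S * M)))%N%:R].
Proof.
move=> M0 e0 hd; set K := (S * M)%N; set V := ((K.+1 * S.+1) ^ K.+1)%N.
have V1 : (1 <= V)%N by rewrite expn_gt0.
(* The extra [eps] on the left makes the estimate reproduce itself. [V] bounds both the coefficients
   of [W] and the loss in evaluating a derivative at a node, hence the factor [2 V^2] per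
   condition. *)
suff : forall j, (j <= K)%N -> exists H : {poly R}, [/\ (size H <= j)%N,
    forall s m, (m < M)%N -> (s * M + m < j)%N -> (H^`(m)).[s%:R] = d s m
    & forall i, `|H`_i| + eps <= eps * ((2 * V ^ 2) ^ j)%N%:R].
  case/(_ K (leqnn K)) => H [h1 h2 h3]; exists H; split => //.
    move=> s m sS mM; apply: h2 => //; rewrite /K.
    by apply: (@leq_trans (s.+1 * M)); [rewrite mulSn; lia|rewrite leq_mul2r sS orbT].
  move=> i; have := h3 i; have [K0|K0] := posnP K.
    rewrite K0 expn0 mulr1 => h; apply: (@le_trans _ _ 0); first by move: h; lra.
    by rewrite ?mulr_ge0.
  move=> h; apply: (@le_trans _ _ (eps * ((2 * V ^ 2) ^ K)%N%:R)); first by move: h; lra.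
  apply: ler_wpM2l => //; rewrite ler_nat [in leqRHS]expnM leq_exp2r // (mulnC 4%N) expnM -/V.
  rewrite (_ : 4 = 2 + 2)%N // expnD leq_mul2r; apply/orP; right.
  have : (2 <= V)%N; last by nia.
  rewrite /V; apply: (@leq_trans (K.+1 * S.+1)); last by rewrite -{1}(expn1 (K.+1 * _)) leq_pexp2l.
  by nia.
elim=> [|j IH] jK.
  exists 0; split; rewrite ?size_poly0 // => i.
  by rewrite coef0 normr0 add0r expn0 mulr1.
have [H [sH dH cH]] := IH (ltnW jK).
set s := (j %/ M)%N; set m := (j %% M)%N.
have ej : j = (s * M + m)%N := divn_eq j M.
have mM : (m < M)%N by rewrite ltn_mod.
have sS : (s < S)%N by rewrite ltn_divLR.
set W := ('X - (s%:R)%:P) ^+ m * node_poly M s.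
have sW : size W = j.+1.
  rewrite /W size_monicM ?monic_exp ?monicXsubC ?monic_neq0 ?node_poly_monic //.
  by rewrite size_exp_XsubC size_node_poly addnS /= addSn addnC -ej.
have Wb i : `|W`_i| <= V%:R.
  apply: (le_trans (coef_bound_exp_XsubC (b := S%:R) m (node_poly_bound M (ltnW sS)) _ _)).
    by rewrite normr_nat ler_nat ltnW.
  have -> : 1 + S%:R = S.+1%:R :> R by rewrite -natr1 addrC.
  rewrite -natrX -natrM -expnD addnC -ej ler_nat /V expnMn.
  rewrite -[leqLHS]mul1n leq_mul ?expn_gt0 //.
  by rewrite leq_pexp2l // ltnW // ltnS ltnW.
set w := (W^`(m)).[s%:R].
(* The nodes are integers, so [w] is a nonzero integer and dividing by it costs nothing. *)
have w1 : 1 <= `|w|.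
  rewrite /w derivn_XsubC_expM // eqxx normrM normr_nat /node_poly horner_prod normr_prod.
  rewrite -[leLHS]mul1r ler_pM ?ler1n ?fact_gt0 //.
  apply: (big_ind (fun x => 1 <= x)) => //; first by move=> x y; apply: mulr_ege1.
  move=> i _; rewrite horner_exp normrX exprn_ege1 // hornerXsubC.
  by rewrite -natrB ?normr_nat ?ler1n ?subn_gt0 // ltnW.
set c := (d s m - (H^`(m)).[s%:R]) / w.
exists (H + c *: W); split.
- apply: leq_trans (size_polyD _ _) _; rewrite geq_max (leq_trans sH (leqnSn _)) /=.
  by apply: leq_trans (size_scale_leq _ _) _; rewrite sW.
- move=> s' m' mM' lt; rewrite derivnD derivnZ hornerD hornerZ.
  move: lt; rewrite ltnS leq_eqVlt => /orP[/eqP e|lt].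
    have es : s' = s by rewrite /s -e divnMDl // divn_small // addn0.
    have em : m' = m by rewrite /m -e modnMDl modn_small.
    rewrite es em -/w /c divfK; first by ring.
    by rewrite -normr_gt0 (lt_le_trans _ w1).
  rewrite dH // node_poly_deriv ?mulr0 ?addr0 // -ej //.
- move=> i; rewrite coefD coefZ.
  have cb : `|c| <= eps + (eps * ((2 * V ^ 2) ^ j)%N%:R - eps) * V%:R.
    have h1 : `|d s m - H^`(m).[s%:R]| <= eps + (eps * ((2 * V ^ 2) ^ j)%N%:R - eps) * V%:R.
      apply: (le_trans (ler_normB _ _)); apply: lerD; first exact: hd.
      apply: (@horner_derivn_bound _ _ K) => //.
      + by rewrite (leq_trans sH) // ltnW.
      + by move=> i'; have := cH i'; lra.
      + by apply: leq_ltn_trans jK; rewrite ej leq_addl.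
      + exact: ltnW.
    apply: le_trans h1; rewrite /c normrM normfV ler_pdivrMr ?(lt_le_trans _ w1) //.
    by rewrite -[leLHS]mulr1; apply: ler_wpM2l.
  set E := eps * ((2 * V ^ 2) ^ j)%N%:R in cb cH *.
  have EE : eps <= E by apply: le_trans (cH 0%N); rewrite lerDr.
  have h2 : `|c * W`_i| <= E * V%:R * V%:R.
    rewrite normrM; apply: ler_pM => //; apply: (le_trans cb).
    have : 1 <= V%:R :> R by rewrite ler1n.
    nra.
  have -> : eps * ((2 * V ^ 2) ^ j.+1)%N%:R = E * (2 * (V%:R * V%:R)).
    by rewrite /E expnSr !natrM !mulrA; lra.
  have h3 := ler_normD H`_i (c * W`_i).
  have h4 := cH i.
  have V1' : 1 <= V%:R * V%:R :> R by rewrite -natrM ler1n muln_gt0 andbb.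
  have : E * 1 <= E * (V%:R * V%:R) by apply: ler_wpM2l V1'; apply: le_trans EE.
  rewrite mulr1 mulrA; move: h3 h4 h2; lra.
Qed.

Lemma derivn_monic_size (p : {poly R}) (K : nat) : p \is monic -> size p = K.+1 ->
  p^`(K) = (K`!%:R)%:P.
Proof.
move=> mp sp; have e : p = 'X^K + (p - 'X^K) by rewrite addrC subrK.
rewrite e derivnD derivnXn subnn ffactnn expr0 derivn_poly0 ?addr0 ?polyC_natr //.
apply/leq_sizeP => j; rewrite leq_eqVlt coefB coefXn => /orP[/eqP <-|Kj].
  by rewrite eqxx; move/monicP: mp; rewrite /lead_coef sp /= => ->; rewrite subrr.
by rewrite gtn_eqF // subr0 nth_default // sp.
Qed.

(* The Hermite interpolation polynomial of the data is small; the remainder is controlled by Rolle's theorem with multiplicities. *)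
Lemma hermite_bound (G : nat -> R -> R) (S M x : nat) (eps B : R) :
  (forall (m : nat) (z : R), is_derive z (1 : R) (G m) (G m.+1 z)) ->
  (0 < M)%N -> 0 <= eps -> (S <= x)%N ->
  (forall s m, (s < S)%N -> (m < M)%N -> `|G m s%:R| <= eps) ->
  (forall z, 0 <= z <= x%:R -> `|G (S * M)%N z| <= B) ->
  `|G 0%N x%:R| <= eps * (((S * M).+1 * S.+1) ^ (4 * (S * M).+1 * (S * M)) * (S * M * x.+1 ^ (S * M)))%N%:R
     + x%:R ^+ (S * M) * B / ((S * M)`!)%:R.
Proof.
move=> dG M0 e0 Sx hG hB.
have [H [sH dH cH]] := hermite_poly (d := fun s m => G m s%:R) M0 e0 hG.
move: cH; set U := ((_ * S.+1) ^ _)%N; set K := (S * M)%N => cH.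
set W := node_poly M S; set w := W.[x%:R].
have wE : w = \prod_(i < S) (x%:R - i%:R) ^+ M.
  by rewrite /w horner_prod; apply: eq_bigr => i _; rewrite horner_exp hornerXsubC.
have iS (i : 'I_S) : 0 < x%:R - i%:R :> R by rewrite subr_gt0 ltr_nat (leq_trans (ltn_ord i)).
have w0 : 0 < w by rewrite wE; apply: prodr_gt0 => i _; rewrite exprn_gt0.
have wx : w <= x%:R ^+ K.
  have -> : x%:R ^+ K = \prod_(i < S) x%:R ^+ M :> R.
    by rewrite prodr_const card_ord -exprM mulnC.
  rewrite wE; apply: ler_prod => i _; rewrite exprn_ge0 /=; last exact: ltW.
  by rewrite lerXn2r ?nnegrE ?ler0n ?(ltW (iS i)) // lerBlDr lerDl ler0n.
(* This [c] makes [F 0] vanish at [x] too, which gives [K + 1] zeros with multiplicity. As [W] is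
   monic of degree [K], the resulting zero [xi] of [F K] reads [G K xi = c * K!]. *)
set c := (G 0%N x%:R - H.[x%:R]) / w.
pose F m : R -> R := (G m - horner H^`(m)) - c *: horner W^`(m).
have FE m z : F m z = G m z - H^`(m).[z] - c * W^`(m).[z] by [].
have dF (m : nat) (z : R) : is_derive z (1 : R) (F m) (F m.+1 z).
  by rewrite FE; apply: is_deriveB.
pose t i : R := if (i < K)%N then (i %/ M)%:R else x%:R.
have divK i : (i < K)%N -> (i %/ M < S)%N by move=> iK; rewrite ltn_divLR.
have [| |xi xiP zF] := rolle_multiplicity (K := K) (t := t) dF.
- move=> i iK; rewrite /t iK; case: ifP => _; rewrite ler_nat ?leq_div2r //.
  by apply: leq_trans Sx; rewrite ltnW // divK.
- move=> i j ij jK; rewrite /t.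
  case: (ltnP j K) => jK'; last first.
    have {jK jK'} -> : j = K by apply/eqP; rewrite eqn_leq jK.
    case: ltnP => iK.
      move/eqP; rewrite eqr_nat => /eqP e.
      by have := divK i iK; rewrite e ltnNge Sx.
    move=> _; have -> : (K - i = 0)%N by apply/eqP; rewrite subn_eq0.
    by rewrite FE !derivn0 -/w /c divfK ?gt_eqF // subrr.
  rewrite (leq_ltn_trans ij jK') => /eqP; rewrite eqr_nat => /eqP e.
  have mM : (j - i < M)%N.
    by rewrite (divn_eq i M) (divn_eq j M) e subnDl (leq_ltn_trans (leq_subr _ _)) // ltn_mod.
  have sS := divK i (leq_ltn_trans ij jK').
  rewrite FE dH // subrr sub0r.
  have := @node_poly_deriv M S 0%N (i %/ M)%N (j - i)%N M0 mM.
  rewrite expr0 mul1r => ->; first by rewrite mulr0 oppr0.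
  by rewrite addn0; move: sS mM; nia.
have t0 : t 0%N = 0 \/ K = 0%N.
  by rewrite /t; case: (posnP K) => K0; [right|left; rewrite ?K0 ?div0n].
have tK : t K = x%:R by rewrite /t ltnn.
have xi0 : 0 <= xi <= x%:R.
  case/andP: xiP; rewrite tK => a ->; rewrite andbT.
  by case: t0 => [<- //|K0]; apply: le_trans a; rewrite /t K0 /= ler0n.
move: zF; rewrite FE (derivn_poly0 sH) horner0 subr0.
rewrite (@derivn_monic_size W K) ?node_poly_monic ?size_node_poly // hornerC => zF.
have K0 : 0 < (K`!)%:R :> R by rewrite ltr0n fact_gt0.
have cB : `|c| <= B / (K`!)%:R.
  rewrite ler_pdivlMr // -[X in `|c| * X](gtr0_norm K0) -normrM.
  have -> : c * (K`!)%:R = G K xi by move: zF; lra.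
  exact: hB.
have -> : G 0%N x%:R = H.[x%:R] + c * w by rewrite /c divfK ?gt_eqF //; lra.
apply: (le_trans (ler_normD _ _)); apply: lerD.
  rewrite (horner_coef_wide _ sH); apply: (le_trans (ler_norm_sum _ _ _)).
  apply: (@le_trans _ _ (\sum_(i < K) eps * U%:R * (x.+1 ^ K)%N%:R)).
    apply: ler_sum => i _; rewrite normrM; apply: ler_pM => //.
    rewrite normrX normr_nat -natrX ler_nat.
    apply: (@leq_trans (x.+1 ^ i)); first by case: (i : nat) => // i'; rewrite leq_exp2r.
    by rewrite leq_pexp2l // ltnW.
  by rewrite sumr_const card_ord -[_ *+ K]mulr_natr !natrM; lra.
by rewrite normrM (gtr0_norm w0) mulrC -mulrA; apply: ler_pM => //; exact: ltW.
Qed.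
End HermitePoly.

(** * Linear forms in logarithms of integers *)

Lemma is_derive_sum_fin (R : realType) (I : finType) (h : I -> R -> R) (dh : I -> R) (x : R) :
  (forall i, is_derive x (1 : R) (h i) (dh i)) ->
  is_derive x (1 : R) (fun z => \sum_i h i z) (\sum_i dh i).
Proof.
move=> hd; elim: (index_enum I) => [|i s IH].
  rewrite big_nil (_ : (fun z => _) = cst 0); first exact: is_derive_cst.
  by apply/funext => z; rewrite big_nil.
rewrite big_cons (_ : (fun z => _) = h i + (fun z => \sum_(j <- s) h j z)).
  exact: is_deriveD.
by apply/funext => z; rewrite big_cons.
Qed.

(** Multiply out one affine factor at a time: its constant term keeps the word [u], its linear terms
    lengthen [u] by one letter. It serves both for derivatives of the auxiliary function and for
    isolating a single coefficient. *)
Lemma affine_closure (R : comNzRingType) (I : finType) (n T : nat) (c : I -> R) (g : 'I_n -> I -> R) :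
  (forall u : seq 'I_n, (size u < T)%N -> \sum_l c l * \prod_(i <- u) g i l = 0) ->
  forall (F : seq (R * ('I_n -> R))) (u : seq 'I_n), (size F + size u < T)%N ->
  \sum_l c l * \prod_(f <- F) (f.1 + \sum_i f.2 i * g i l) * \prod_(i <- u) g i l = 0.
Proof.
move=> hc; elim=> [|f F IH] u hs.
  by rewrite -[RHS](hc u) //; apply: eq_bigr => l _; rewrite big_nil mulr1.
have e : forall l, c l * \prod_(f <- f :: F) (f.1 + \sum_i f.2 i * g i l) * \prod_(i <- u) g i l =
   f.1 * (c l * \prod_(f <- F) (f.1 + \sum_i f.2 i * g i l) * \prod_(i <- u) g i l)
   + \sum_j f.2 j * (c l * \prod_(f <- F) (f.1 + \sum_i f.2 i * g i l) * \prod_(i <- j :: u) g i l).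
  move=> l; rewrite big_cons; set P := \prod_(f <- F) _; set Q := \prod_(i <- u) _.
  rewrite -!mulrA mulrCA mulrDl mulr_suml; congr (_ + _).
  by apply: eq_bigr => j _; rewrite big_cons -/Q -!mulrA; congr (_ * _); rewrite mulrCA; congr (_ * _); rewrite mulrCA.
rewrite (eq_bigr _ (fun l _ => e l)) big_split /= -mulr_sumr IH; last by rewrite /= in hs; lia.
rewrite mulr0 add0r exchange_big /= big1 // => j _.
by rewrite -mulr_sumr IH ?mulr0 //= addnS.
Qed.

Lemma prod_count (R : comNzRingType) (I : finType) (g : I -> R) (u : seq I) :
  \prod_(i <- u) g i = \prod_i g i ^+ count_mem i u.
Proof.
elim: u => [|j u IH]; first by rewrite big_nil big1.
rewrite big_cons IH [RHS](bigD1 j) //= [X in _ * X = _](bigD1 j) //= eqxx add1n exprS -mulrA.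
congr (_ * (_ * _)); apply: eq_bigr => i ij.
by rewrite eq_sym (negbTE ij).
Qed.

Lemma expR_sub1_bound (R : realType) (x : R) : `|x| <= 1 / 2 -> `|expR x - 1| <= 2 * `|x|.
Proof.
rewrite ler_norml => /andP[h1 h2].
have a := expR_ge1Dx x; have b := expR_ge1Dx (- x).
have e0 := expR_gt0 x; have e1 : expR x * expR (- x) = 1 := expRxMexpNx_1 x.
case: (leP 0 x) => x0.
  rewrite ger0_norm ?(ger0_norm x0); last by lra.
  have := ler_wpM2l (ltW e0) b; rewrite e1 => h.
  have : expR x * (1 - x) >= expR x * (1 / 2) by rewrite ler_pM2l //; lra.
  nra.
have : expR x < 1 by rewrite expR_lt1.
by move=> h; rewrite (ler0_norm (ltW x0)) ler0_norm; lra.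
Qed.

Lemma expR1_le4 (R : realType) : expR (1 : R) <= 4.
Proof.
have a := expR_ge1Dx (- (1/2) : R).
have e1 : expR (1/2 : R) * expR (- (1/2)) = 1 := expRxMexpNx_1 _.
have e0 := expR_gt0 (1/2 : R).
have h : expR (1/2 : R) <= 2.
  have := ler_wpM2l (ltW e0) a; rewrite e1; lra.
have -> : (1 : R) = 1/2 + 1/2 by lra.
by rewrite expRD; nra.
Qed.

Lemma expn_le_fact (R : realType) (K : nat) : K%:R ^+ K <= 4 ^+ K * (K`!)%:R :> R.
Proof.
case: K => [|K]; first by rewrite !expr0 mul1r.
have h := @expR_ge1Dxn R K.+1%:R K (ler0n _ _).
have f0 : 0 < (K.+1`!)%:R :> R by rewrite ltr0n fact_gt0.
rewrite -ler_pdivrMr //; apply: (@le_trans _ _ (expR (K.+1%:R * 1))).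
  by rewrite mulr1; apply: le_trans h; rewrite lerDr.
rewrite expRM_natl; apply: lerXn2r; rewrite ?nnegrE ?expR_ge0 //.
exact: expR1_le4.
Qed.

Section LinearForm.
Variables (R : realType) (n L : nat) (alpha : 'I_n.+1 -> nat) (b : 'I_n.+1 -> int).
Hypothesis alpha0 : forall i, (0 < alpha i)%N.
Hypothesis b0 : b ord0 != 0.

Definition logform : R := \sum_i (b i)%:~R * ln (alpha i)%:R.

Let Lam := {ffun 'I_n.+1 -> 'I_L}.
Implicit Types (l : Lam) (u : seq 'I_n).

(* [b_0 * sum_i l_i ln alpha_i] minus [l_0] times the linear form only involves the [ln alpha_i] with [i > 0], with
   the integral coefficients [gam]. Hence [omg l] is the logarithm of [aval l] up to a multiple of the small form. *)
Definition gam (i : 'I_n) l : int :=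
  b ord0 * (l (lift ord0 i) : nat)%:Z - b (lift ord0 i) * (l ord0 : nat)%:Z.
Definition aval l : nat := (\prod_i alpha i ^ l i)%N.
Definition gmon u l : int := \prod_(i <- u) gam i l.
(** The words [u] stand for mixed partial derivatives of Baker's auxiliary function of several
    variables: each differentiation multiplies the term of [l] by some [gam i l], up to a common
    factor that is dropped to keep the value an integer. *)
Definition auxval (p : Lam -> int) u (s : nat) : int :=
  \sum_l p l * gmon u l * (aval l)%:Z ^+ s.
Definition vanish p S T := forall s u, (s < S)%N -> (size u < T)%N -> auxval p u s = 0.

Definition omg l : R := \sum_i (ln (alpha (lift ord0 i))%:R / (b ord0)%:~R) * (gam i l)%:~R.

Lemma aval_gt0 l : (0 < aval l)%N.
Proof. by rewrite prodn_cond_gt0 // => i _; rewrite expn_gt0 alpha0. Qed.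

Lemma ln_aval l : ln (aval l)%:R = \sum_i (l i)%:R * ln (alpha i)%:R :> R.
Proof.
rewrite /aval natr_prod.
suff : forall s : seq 'I_n.+1, 0 < \prod_(i <- s) (alpha i ^ l i)%:R :> R /\
    ln (\prod_(i <- s) (alpha i ^ l i)%:R : R) = \sum_(i <- s) (l i)%:R * ln (alpha i)%:R.
  by move=> /(_ (index_enum _)) [].
elim=> [|i s [p0 IH]]; first by rewrite !big_nil ln1.
have a0 : 0 < (alpha i ^ l i)%:R :> R by rewrite ltr0n expn_gt0 alpha0.
rewrite !big_cons; split; first exact: mulr_gt0.
by rewrite lnM ?posrE // IH natrX lnXn ?ltr0n ?alpha0 // mulr_natl.
Qed.

Let b0R : (b ord0)%:~R != 0 :> R.
Proof. by rewrite intr_eq0. Qed.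

Lemma omgE l : omg l = \sum_i (l i)%:R * ln (alpha i)%:R - (l ord0)%:R * logform / (b ord0)%:~R.
Proof.
transitivity (\sum_i ((l i)%:R - (l ord0)%:R * (b i)%:~R / (b ord0)%:~R) * ln (alpha i)%:R : R).
  rewrite big_ord_recl mulfK // subrr mul0r add0r; apply: eq_bigr => i _.
  by rewrite /gam rmorphB !rmorphM /=; field.
rewrite /logform mulr_sumr mulr_suml -sumrB; apply: eq_bigr => i _.
by field.
Qed.

Lemma expR_omg l s :
  expR (omg l * s%:R) = (aval l)%:R ^+ s * expR (- ((l ord0)%:R * logform / (b ord0)%:~R * s%:R)).
Proof.
rewrite omgE -ln_aval mulrBl expRD; congr (_ * _).
by rewrite mulrC expRM_natl lnK // posrE ltr0n aval_gt0.
Qed.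

(** [omg] is linear in the [gam], so its powers are products of linear forms: derivatives along the
    diagonal are combinations of the mixed ones. *)
Lemma vanish_real p S T : vanish p S T -> forall s u (m : nat), (s < S)%N -> (size u + m < T)%N ->
  \sum_l (p l)%:~R * (gmon u l)%:~R * omg l ^+ m * (aval l)%:R ^+ s = 0 :> R.
Proof.
move=> pST s u m sS um.
have H : forall u' : seq 'I_n, (size u' < T)%N ->
    \sum_l ((p l)%:~R * (aval l)%:R ^+ s) * \prod_(i <- u') (gam i l)%:~R = 0 :> R.
  move=> u' hu'; have := congr1 (fun z : int => z%:~R : R) (pST s u' sS hu').
  rewrite /= rmorph_sum /= => e; rewrite -[RHS]e; apply: eq_bigr => l _.
  rewrite mulrAC !intrM; congr (_ * _ * _); first by rewrite /gmon rmorph_prod.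
  by rewrite rmorphXn.
pose F : seq (R * ('I_n -> R)) := nseq m (0, fun i => ln (alpha (lift ord0 i))%:R / (b ord0)%:~R).
have := affine_closure H (F := F) (u := u).
rewrite size_nseq addnC => /(_ um) e; rewrite -[RHS]e; apply: eq_bigr => l _.
have -> : \prod_(f <- F) (f.1 + \sum_i f.2 i * (gam i l)%:~R) = omg l ^+ m.
  by rewrite big_nseq iter_mulr_1 add0r.
have -> : (gmon u l)%:~R = \prod_(i <- u) (gam i l)%:~R :> R by rewrite /gmon rmorph_prod.
by move: (\prod_(i <- u) _) (_ ^+ m) (_ ^+ s) ((p l)%:~R) => x y z t; ring.
Qed.

Definition auxfun p u (m : nat) (z : R) : R :=
  \sum_l (p l)%:~R * (gmon u l)%:~R * omg l ^+ m * expR (omg l * z).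

Lemma is_derive_auxfun p u m z : is_derive z (1 : R) (auxfun p u m) (auxfun p u m.+1 z).
Proof.
apply: is_derive_sum_fin => l.
set k := _ * _ * _.
have -> : (p l)%:~R * (gmon u l)%:~R * omg l ^+ m.+1 * expR (omg l * z) = k *: (expR (omg l * z) * omg l).
  by rewrite /k /GRing.scale /= exprSr; ring.
have -> : (fun z0 => k * expR (omg l * z0)) = k *: (@expR R \o (fun z0 => omg l * z0)) by apply/funext.
apply: is_deriveZ; apply: is_derive1_comp.
have -> : (fun z0 => omg l * z0) = omg l *: id by apply/funext.
by apply: is_derive_eq; rewrite /GRing.scale /= mulr1.
Qed.

(* A vanishing value is detected by integrality: the three summands bound the interpolation polynomial, the
   interpolation remainder and the error made in replacing [aval l] by [expR (omg l)], and an integer below 1 is 0. *)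
Lemma extrapolate p (S S' M : nat) (Gam Om eta : R) :
  vanish p S (M + M) -> (0 < M)%N ->
  (forall u, (size u < M)%N -> \sum_l `|(p l)%:~R * (gmon u l)%:~R| <= Gam) ->
  1 <= Om -> (forall l, `|omg l| <= Om) -> 0 <= eta -> 0 <= Gam ->
  (forall l s, (s < S')%N ->
     (aval l)%:R ^+ s * `|expR (- ((l ord0)%:R * logform / (b ord0)%:~R * s%:R)) - 1| <= eta) ->
  Gam * Om ^+ (S * M) * eta *
     (((S * M).+1 * S.+1) ^ (4 * (S * M).+1 * (S * M)) * (S * M * S' ^ (S * M)))%N%:R
   + S'%:R ^+ (S * M) * (Gam * Om ^+ (S * M) * expR (Om * S'%:R)) / ((S * M)`!)%:R
   + Gam * eta < 1 ->
  (S <= S')%N ->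
  vanish p S' M.
Proof.
move=> pS M0 hG Om1 hO eta0 G0 hE hnum SS' s u sS' uM.
case: (ltnP s S) => sS; first by apply: pS => //; rewrite ltn_addr.
have Om0 : 0 <= Om by apply: le_trans Om1.
set K := (S * M)%N in hnum *.
have diff m s1 : (s1 < S')%N ->
    `|auxfun p u m s1%:R - \sum_l (p l)%:~R * (gmon u l)%:~R * omg l ^+ m * (aval l)%:R ^+ s1|
      <= Gam * Om ^+ m * eta.
  move=> s1S; rewrite /auxfun -sumrB; apply: (le_trans (ler_norm_sum _ _ _)).
  apply: (@le_trans _ _ (\sum_l `|(p l)%:~R * (gmon u l)%:~R| * (Om ^+ m * eta))).
    apply: ler_sum => l _; rewrite expR_omg -mulrBr normrM normrM -!mulrA ler_wpM2l //.
    rewrite normrX ler_pM ?exprn_ge0 //; first by rewrite lerXn2r ?nnegrE ?normr_ge0.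
    rewrite -[X in _ - X]mulr1 -mulrBr normrM ger0_norm ?exprn_ge0 //.
    by have := hE l s1 s1S; rewrite -!mulrA.
  by rewrite -mulr_suml -mulrA ler_wpM2r ?hG // mulr_ge0 ?exprn_ge0.
(* The order [M + M] is shared: fewer than [M] letters for [u], and [M] derivatives at each node for
   the interpolation. This is why every extrapolation halves the order. *)
have small m s1 : (s1 < S)%N -> (m < M)%N -> `|auxfun p u m s1%:R| <= Gam * Om ^+ K * eta.
  move=> s1S mM; have := diff m s1 (leq_trans s1S SS').
  rewrite (vanish_real pS) //; last by lia.
  rewrite subr0 => h; apply: (le_trans h); rewrite ler_wpM2r // ler_wpM2l // ler_weXn2l //.
  by rewrite /K; apply: leq_trans (ltnW mM) _; rewrite leq_pmull //; case: (S) s1S.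
have big z : 0 <= z <= s%:R -> `|auxfun p u K z| <= Gam * Om ^+ K * expR (Om * S'%:R).
  case/andP=> z0 zs; apply: (le_trans (ler_norm_sum _ _ _)).
  apply: (@le_trans _ _ (\sum_l `|(p l)%:~R * (gmon u l)%:~R| * (Om ^+ K * expR (Om * S'%:R)))).
    apply: ler_sum => l _; rewrite normrM normrM -!mulrA ler_wpM2l //.
    rewrite normrX ler_pM ?exprn_ge0 //; first by rewrite lerXn2r ?nnegrE ?normr_ge0.
    rewrite ger0_norm ?expR_ge0 // ler_expR.
    apply: (@le_trans _ _ (Om * z)).
      by rewrite ler_wpM2r //; apply: le_trans (ler_norm _) (hO l).
    by rewrite ler_wpM2l //; apply: le_trans zs _; rewrite ler_nat ltnW.
  by rewrite -mulr_suml -mulrA ler_wpM2r ?hG // mulr_ge0 ?exprn_ge0 ?expR_ge0.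
have eps0 : 0 <= Gam * Om ^+ K * eta by rewrite !mulr_ge0 ?exprn_ge0.
have := @hermite_bound R (auxfun p u) S M s _ _ (is_derive_auxfun p u) M0 eps0 sS (fun s1 m => small m s1) big.
have := diff 0%N s sS'; rewrite expr0 mulr1.
set V := \sum_l _; set U := ((_ * S.+1) ^ _)%N in hnum *; rewrite -/K => d1 d2.
have VE : V = (auxval p u s)%:~R.
  rewrite /V /auxval rmorph_sum /=; apply: eq_bigr => l _.
  by rewrite expr0 mulr1 !rmorphM rmorphXn.
have d3 : `|auxfun p u 0%N s%:R| <= Gam * Om ^+ K * eta * (U * (K * S' ^ K))%N%:R +
   S'%:R ^+ K * (Gam * Om ^+ K * expR (Om * S'%:R)) / (K`!)%:R.
  apply: (le_trans d2); apply: lerD.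
    rewrite ler_wpM2l // ler_nat leq_mul // leq_mul //.
    by case: (K) => // K'; rewrite leq_exp2r.
  rewrite ler_wpM2r ?invr_ge0 ?ler0n // ler_wpM2r //.
    by rewrite !mulr_ge0 ?exprn_ge0 ?expR_ge0.
  by rewrite lerXn2r ?nnegrE ?ler0n // ler_nat ltnW.
have : `|V| < 1.
  have : `|V| <= `|auxfun p u 0%N s%:R| + `|auxfun p u 0%N s%:R - V|.
    by rewrite -[X in `|X| <= _](subKr (auxfun p u 0%N s%:R)) ler_normB.
  move: d1 d3 hnum; lra.
rewrite VE -intr_norm -[1]/(1%:~R) ltr_int => h.
by apply/eqP; rewrite -normr_eq0; move: h (normr_ge0 (auxval p u s)); lia.
Qed.
End LinearForm.

Section LinearForm2.
Variables (R : realType) (n L : nat) (alpha : 'I_n.+1 -> nat) (b : 'I_n.+1 -> int).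
Hypothesis alpha0 : forall i, (0 < alpha i)%N.
Hypothesis b0 : b ord0 != 0.
Let Lam := {ffun 'I_n.+1 -> 'I_L}.

(** Instead of inverting a Vandermonde matrix, the values for [s < S] are combined with the
    coefficients of a polynomial [Q] that vanishes at every value of [aval] except that of [l0].
    There are at most [L ^ n.+1] values, so [Q] has at most [S] coefficients. *)
Lemma vanish_group (p : Lam -> int) S T (l0 : Lam) : vanish alpha b p S T -> (L ^ n.+1 <= S)%N ->
  exists c : Lam -> int, [/\ forall l, c l != 0 -> aval alpha l = aval alpha l0,
    p l0 != 0 -> c l0 != 0 &
    forall u, (size u < T)%N -> \sum_l c l * gmon b u l = 0].
Proof.
move=> pST LS; set a := aval alpha l0.
pose vals := undup [seq aval alpha l | l <- enum {: Lam}].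
have av : a \in vals by rewrite mem_undup map_f // mem_enum.
pose Q : {poly int} := \prod_(v <- [seq v <- vals | v != a]) ('X - (v%:Z)%:P).
have sQ : (size Q <= S)%N.
  rewrite /Q size_prod_XsubC; apply: leq_trans LS.
  have : (size vals <= L ^ n.+1)%N.
    by apply: leq_trans (size_undup _) _; rewrite size_map -cardT card_ffun !card_ord.
  apply: leq_trans; rewrite size_filter -(count_predC (pred1 a) vals) count_uniq_mem ?undup_uniq //.
  by rewrite av add1n.
have Q0 (l : Lam) : aval alpha l != a -> Q.[(aval alpha l)%:Z] = 0.
  move=> la; apply/eqP; rewrite /Q horner_prod prodf_seq_eq0; apply/hasP.
  exists (aval alpha l); last by rewrite hornerXsubC subrr.
  by rewrite mem_filter la mem_undup map_f // mem_enum.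
have Qa : Q.[a%:Z] != 0.
  rewrite /Q horner_prod prodf_seq_neq0; apply/allP => v; rewrite mem_filter => /andP[va _] /=.
  by rewrite hornerXsubC subr_eq0 eqz_nat eq_sym.
exists (fun l => p l * Q.[(aval alpha l)%:Z]); split.
- by move=> l; apply: contraNeq => /Q0 ->; rewrite mulr0.
- by move=> p0; rewrite mulf_neq0.
- move=> u uT; transitivity (\sum_(i < S) Q`_i * auxval alpha b p u i); last first.
    by rewrite big1 // => i _; rewrite pST ?mulr0.
  under [RHS]eq_bigr => i _ do rewrite /auxval mulr_sumr.
  rewrite exchange_big /=; apply: eq_bigr => l _.
  rewrite (horner_coef_wide _ sQ) mulrAC mulr_sumr; apply: eq_bigr => i _.
  by rewrite mulrCA.
Qed.

(* Vandermonde in [s] separates the values of [aval]; inside one value, a product of affine forms in the [gam]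
   vanishing at every other index isolates a single coefficient. *)
Lemma vanish_eq0 (p : Lam -> int) S T : vanish alpha b p S T -> (L ^ n.+1 <= S)%N ->
  (n.+1 * L < T)%N -> logform R alpha b != 0 -> forall l, p l = 0.
Proof.
move=> pST LS LT Lam0 l0; apply/eqP; apply: contraT => pl0.
have [c [cav cl0 cT]] := vanish_group l0 pST LS.
have {cl0}cl0 := cl0 pl0.
have bR : (b ord0)%:~R != 0 :> R by rewrite intr_eq0.
set Lf := logform R alpha b in Lam0.
(* For equal [aval], the difference of two [omg] is [(l0_0 - l_0) * Lf / b_0]. As [Lf] is not zero,
   [l_0] can be recovered as an affine form in the [gam]; the other [l_i] follow from
   [gam_i = b_0 l_i - b_i l_0]. *)
have A0 : exists f : R * ('I_n -> R), forall l, c l != 0 ->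
    (l ord0)%:R = f.1 + \sum_j f.2 j * (gam b j l)%:~R.
  exists ((l0 ord0)%:R + omg R alpha b l0 * (b ord0)%:~R / Lf,
    fun j => - (ln (alpha (lift ord0 j))%:R / (b ord0)%:~R) * ((b ord0)%:~R / Lf)) => l cl /=.
  have e : omg R alpha b l - omg R alpha b l0 = ((l0 ord0)%:R - (l ord0)%:R) * Lf / (b ord0)%:~R.
    rewrite !omgE // -!ln_aval // (cav l cl) -/Lf.
    by move: (ln _) => w; field.
  have -> : \sum_(j < n) - (ln (alpha (lift ord0 j))%:R / (b ord0)%:~R) * ((b ord0)%:~R / Lf) * (gam b j l)%:~R
      = - omg R alpha b l * ((b ord0)%:~R / Lf).
    rewrite /omg -sumrN mulr_suml; apply: eq_bigr => j _; by rewrite mulrAC !mulNr.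
  have -> : (l ord0)%:R = (l0 ord0)%:R - (omg R alpha b l - omg R alpha b l0) * (b ord0)%:~R / Lf :> R.
    by rewrite e; field; rewrite Lam0.
  by move: (omg _ _ _ l) (omg _ _ _ l0) => w w0; field.
have [f0 f0P] := A0.
have /choice[f fP] : forall i, exists f : R * ('I_n -> R), forall l, c l != 0 ->
    (l i)%:R = f.1 + \sum_j f.2 j * (gam b j l)%:~R.
  move=> i; case: (unliftP ord0 i) => [k|] ->; last exact: A0.
  set bk := (b (lift ord0 k))%:~R : R.
  exists (bk * f0.1 / (b ord0)%:~R, fun j => (j == k)%:R / (b ord0)%:~R + bk * f0.2 j / (b ord0)%:~R) => l cl /=.
  have -> : \sum_(j < n) ((j == k)%:R / (b ord0)%:~R + bk * f0.2 j / (b ord0)%:~R) * (gam b j l)%:~R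
    = (gam b k l)%:~R / (b ord0)%:~R + bk * (\sum_j f0.2 j * (gam b j l)%:~R) / (b ord0)%:~R.
    under eq_bigr => j _ do rewrite mulrDl.
    rewrite big_split /= (bigD1 k) //= eqxx big1 ?addr0; last first.
      by move=> j /negbTE ->; rewrite !mul0r.
    congr (_ + _); first by rewrite mul1r mulrC.
    by rewrite mulr_sumr mulr_suml; apply: eq_bigr => j _; rewrite mulrAC -!mulrA.
  have := f0P l cl; move: (\sum_j _) => w ew.
  rewrite /gam rmorphB !rmorphM /= -/bk.
  have -> : ((l ord0 : nat)%:Z)%:~R = f0.1 + w :> R by rewrite -ew.
  have -> : ((l (lift ord0 k) : nat)%:Z)%:~R = (l (lift ord0 k))%:R :> R by [].
  by field.
pose cR l : R := (c l)%:~R.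
have cRT (u : seq 'I_n) : (size u < T)%N -> \sum_l cR l * \prod_(i <- u) (gam b i l)%:~R = 0.
  move=> /cT e; have := congr1 (fun z : int => z%:~R : R) e; rewrite /= rmorph_sum /= => {}e.
  rewrite -[RHS]e; apply: eq_bigr => l _; rewrite intrM /cR; congr (_ * _).
  by rewrite /gmon rmorph_prod.
(* The factors are [l_i - v] for all [i] and all [v] different from the [i]-th entry of [l0]: their
   product kills every index but [l0], and there are at most [n.+1 * L] of them. *)
pose F := [seq ((f i).1 - (nat_of_ord v)%:R, (f i).2) | i <- enum 'I_n.+1, v <- [seq v <- enum 'I_L | v != l0 i]].
have sF : (size F <= n.+1 * L)%N.
  rewrite /F size_allpairs_dep sumnE big_map.
  apply: (@leq_trans (\sum_(j <- enum 'I_n.+1) L)).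
    by apply: leq_sum => i _; rewrite size_filter (leq_trans (count_size _ _)) // size_enum_ord.
  by rewrite big_const_seq count_predT size_enum_ord iter_addn_0 mulnC.
have := affine_closure cRT (F := F) (u := [::]).
rewrite addn0 => /(_ (leq_ltn_trans sF LT)).
under eq_bigr => l _ do rewrite big_nil mulr1.
rewrite (bigD1 l0) //= [X in _ + X]big1 ?addr0.
  move/eqP; rewrite mulf_eq0 /cR intr_eq0 (negbTE cl0) /= prodf_seq_eq0 => /hasP [g].
  case/allpairsPdep => i [v [_ vv ->]] /=.
  move: vv; rewrite mem_filter => /andP [vl _].
  rewrite addrAC -(fP i l0 cl0) subr_eq0 eqr_nat => /eqP e.
  by move: vl; rewrite -val_eqE /= e eqxx.
move=> l ll0; have [c0|c0] := eqVneq (c l) 0; first by rewrite /cR c0 mul0r.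
have [i il] : exists i, l i != l0 i.
  apply/existsP; rewrite -negb_forall; apply: contra ll0 => /forallP e.
  by apply/eqP/ffunP => j; apply/eqP.
apply/eqP; rewrite mulf_eq0 prodf_seq_eq0; apply/orP; right; apply/hasP.
exists ((f i).1 - (l i : nat)%:R, (f i).2).
  apply/allpairsPdep; exists i, (l i); split => //; first by rewrite mem_enum.
  by rewrite mem_filter il mem_enum.
by rewrite /= addrAC -(fP i l c0) subrr.
Qed.

Lemma auxiliary_exists (S T G AV : nat) :
  (2 * (S * T ^ n) <= L ^ n.+1)%N -> (0 < L)%N -> (0 < T)%N -> (0 < G)%N -> (0 < AV)%N ->
  (forall i l, `|gam (L := L) b i l| <= G%:Z) ->
  (forall (l : Lam) s, (s < S)%N -> (aval alpha l ^ s <= AV)%N) ->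
  exists p : Lam -> int, [/\ exists l, p l != 0,
    forall l, `|p l| <= (L ^ n.+1 * (G ^ (n * T) * AV))%N%:Z & vanish alpha b p S T].
Proof.
move=> hc L0 T0 G0 AV0 hG hAV.
(* A word matters only through the multiplicities of its letters, and those of a word shorter than
   [T] lie in this box. Twice as many unknowns as equations allow exponent 1 in [siegel]. *)
pose EQ : finType := ('I_S * {ffun 'I_n -> 'I_T})%type.
have cN : #|{: Lam}| = (L ^ n.+1)%N by rewrite card_ffun !card_ord.
have cM : #|{: EQ}| = (S * T ^ n)%N by rewrite card_prod card_ffun !card_ord.
pose ent (e : EQ) (l : Lam) : int := (\prod_i gam b i l ^+ e.2 i) * (aval alpha l)%:Z ^+ e.1.
have Posz_exp (m k : nat) : m%:Z ^+ k = (m ^ k)%N%:Z by rewrite -!natz natrX.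
have entb e l : `|ent e l| <= (G ^ (n * T) * AV)%N%:Z.
  rewrite /ent normrM PoszM; apply: ler_pM => //; last first.
    by rewrite Posz_exp ger0_norm // lez_nat hAV.
  rewrite normr_prod mulnC expnM -Posz_exp.
  have -> : (G ^ T)%N%:Z ^+ n = \prod_(i < n) (G ^ T)%N%:Z by rewrite prodr_const card_ord.
  apply: ler_prod => i _; rewrite normr_ge0 /= normrX.
  apply: (@le_trans _ _ (G%:Z ^+ e.2 i)); first by rewrite lerXn2r ?nnegrE.
  by rewrite Posz_exp lez_nat leq_pexp2l // ltnW.
have hMN : (#|{: EQ}| < #|{: Lam}|)%N.
  rewrite cN cM; have : (0 < L ^ n.+1)%N by rewrite expn_gt0 L0.
  by move: hc; lia.
have hMN1 : (#|{: EQ}| <= 1 * (#|{: Lam}| - #|{: EQ}|))%N by rewrite cN cM; lia.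
have A1 : (0 < G ^ (n * T) * AV)%N by rewrite muln_gt0 expn_gt0 G0 AV0.
have [x [[j xj] xb xs]] := siegel (a := fun i j => ent (enum_val i) (enum_val j))
   (fun i j => entb (enum_val i) (enum_val j)) A1 hMN hMN1.
exists (fun l => x (enum_rank l)); split.
- by exists (enum_val j); rewrite enum_valK.
- by move=> l; have := xb (enum_rank l); rewrite expn1 cN.
move=> s u sS uT.
have cu i : (count_mem i u < T)%N by apply: leq_ltn_trans (count_size _ _) uT.
have := xs (enum_rank (Ordinal sS, [ffun i => Ordinal (cu i)])).
rewrite enum_rankK => e; rewrite /auxval -[RHS]e.
rewrite (reindex (@enum_val Lam predT)) /=; last exact/onW_bij/enum_val_bij.
apply: eq_bigr => k _; rewrite enum_valK -mulrA mulrC; congr (_ * _).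
rewrite /ent /= /gmon prod_count; congr (_ * _).
by apply: eq_bigr => i _; rewrite ffunE.
Qed.
End LinearForm2.

Lemma ln_le_nat (R : realType) (m a : nat) : (0 < m)%N -> (m <= 2 ^ a)%N -> ln (m%:R : R) <= a%:R.
Proof.
move=> m0 ma; rewrite -ler_expR lnK ?posrE ?ltr0n //.
apply: (@le_trans _ _ ((2 ^ a)%N%:R)); first by rewrite ler_nat.
rewrite -[a%:R]mulr1 expRM_natl natrX; apply: lerXn2r; rewrite ?nnegrE ?expR_ge0 ?ler0n //.
by have := expR_ge1Dx (1 : R).
Qed.

(** [64 = 4 * 16]: the 4 is lost in passing from [K^K] to [K!], and [16^K] beats [Gam] and the
    exponential, together at most [8^K], by the factor [2^K >= 4]. *)
Lemma extrapolation_main_term (R : realType) (K Om S' : nat) (Gam : R) :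
  (64 * (Om * S') <= K)%N -> (2 <= K)%N -> Gam <= 2 ^+ (2 * K) ->
  S'%:R ^+ K * (Gam * Om%:R ^+ K * expR (Om%:R * S'%:R)) / (K`!)%:R <= 1 / 4 :> R.
Proof.
move=> hK K2 hG.
have f0 : 0 < (K`!)%:R :> R by rewrite ltr0n fact_gt0.
have hE : expR (Om%:R * S'%:R) <= 2 ^+ K :> R.
  rewrite -natrM -[_%:R]mulr1 expRM_natl.
  apply: (@le_trans _ _ (4 ^+ (Om * S'))).
    by apply: lerXn2r; rewrite ?nnegrE ?expR_ge0 //; exact: expR1_le4.
  rewrite (_ : 4 = 2 ^+ 2) -?exprM ?ler_weXn2l ?ler1n //; last by rewrite -natrX.
  by apply: leq_trans hK; rewrite leq_mul2r orbT.
have h1 : (Om * S')%N%:R ^+ K * 16 ^+ K <= (K`!)%:R :> R.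
  have a := expn_le_fact R K.
  have b : (64 * (Om * S'))%N%:R ^+ K <= K%:R ^+ K :> R by rewrite lerXn2r ?nnegrE ?ler0n // ler_nat.
  have c := le_trans b a; move: c; rewrite natrM exprMn (_ : 64 = 4 * 16 :> R); last by rewrite -natrM.
  by rewrite exprMn -mulrA ler_pM2l ?exprn_gt0 // mulrC.
have h2 : S'%:R ^+ K * (Gam * Om%:R ^+ K * expR (Om%:R * S'%:R)) <=
   (Om * S')%N%:R ^+ K * 2 ^+ (3 * K).
  have -> : S'%:R ^+ K * (Gam * Om%:R ^+ K * expR (Om%:R * S'%:R)) =
     (Om * S')%N%:R ^+ K * (Gam * expR (Om%:R * S'%:R)) :> R by rewrite natrM exprMn; ring.
  rewrite ler_wpM2l ?exprn_ge0 // (_ : 3 * K = 2 * K + K)%N; last by lia.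
  rewrite exprD; apply: (@le_trans _ _ (2 ^+ (2 * K) * expR (Om%:R * S'%:R))).
    by rewrite ler_wpM2r ?expR_ge0.
  by rewrite ler_wpM2l ?exprn_ge0.
rewrite ler_pdivrMr //; apply: (le_trans h2).
have -> : 2 ^+ (3 * K) = 8 ^+ K :> R by rewrite exprM -natrX.
have h3 : 4 * 8 ^+ K <= 16 ^+ K :> R.
  rewrite (_ : 16 = 2 * 8 :> R) ?exprMn; last by rewrite -natrM.
  rewrite ler_wpM2r ?exprn_ge0 // (_ : 4 = 2 ^+ 2 :> R); last by rewrite -natrX.
  by rewrite ler_weXn2l ?ler1n.
have : (Om * S')%N%:R ^+ K * (4 * 8 ^+ K) <= (Om * S')%N%:R ^+ K * 16 ^+ K :> R.
  by rewrite ler_wpM2l ?exprn_ge0.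
by move: h1; lra.
Qed.

Lemma leq_pow2 (x : nat) : (x <= 2 ^ x)%N.
Proof. by apply: ltnW; apply: ltn_expl. Qed.

(** All factors besides [lam] amount to at most [2^tot] with [tot] cubic in [X]; the power [X^5]
    swallows this without care for constants. *)
Lemma extrapolation_error_term (R : realType) (X K S S' Om : nat) (Gam lam : R) :
  (5 <= X)%N -> (K <= X)%N -> (S <= X)%N -> (S' <= X)%N -> (Om <= X)%N ->
  0 <= Gam -> Gam <= 2 ^+ (2 * X) -> 0 <= lam -> lam * 2 ^+ (X ^ 5) <= 1 ->
  Gam * Om%:R ^+ K * (2 ^+ (Om * S') * (2 * X%:R ^+ 2 * lam)) *
    (((K.+1 * S.+1) ^ (4 * K.+1 * K) * (K * S' ^ K))%N)%:R <= 1 / 4.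
Proof.
move=> X5 KX SX S'X OX G0 GX lam0 lamX.
have b1 : (Om ^ K <= 2 ^ (X * X))%N.
  rewrite expnM; apply: (@leq_trans ((2 ^ X) ^ K)).
    by case: (K) => // K'; rewrite leq_exp2r // (leq_trans OX) // leq_pow2.
  by rewrite leq_pexp2l ?expn_gt0.
have b2 : (2 ^ (Om * S') <= 2 ^ (X * X))%N by rewrite leq_exp2l // leq_mul.
have b3 : (2 * X ^ 2 <= 2 ^ (1 + 2 * X))%N.
  by rewrite expnD leq_mul2l /= mulnC expnM leq_exp2r // leq_pow2.
have b4 : ((K.+1 * S.+1) ^ (4 * K.+1 * K) <= 2 ^ (16 * X ^ 3))%N.
  have e : (K.+1 * S.+1 <= 2 ^ (2 * X))%N.
    rewrite mul2n -addnn expnD leq_mul //; apply: (@leq_trans X.+1) => //; exact: ltn_expl.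
  apply: (@leq_trans ((2 ^ (2 * X)) ^ (4 * K.+1 * K))).
    by case: (4 * K.+1 * K)%N => // K'; rewrite leq_exp2r.
  rewrite -expnM leq_exp2l //.
  apply: (@leq_trans (2 * X * (4 * (2 * X) * X))); last by rewrite !expnS expn0; nia.
  by rewrite leq_mul // leq_mul // leq_mul //; lia.
have b5 : (K * S' ^ K <= 2 ^ (X + X * X))%N.
  rewrite expnD leq_mul ?(leq_trans KX) ?leq_pow2 // expnM.
  apply: (@leq_trans ((2 ^ X) ^ K)).
    by case: (K) => // K'; rewrite leq_exp2r // (leq_trans S'X) // leq_pow2.
  by rewrite leq_pexp2l ?expn_gt0.
set tot := (2 * X + X * X + (X * X + (1 + 2 * X)) + (16 * X ^ 3 + (X + X * X)))%N.
have htot : (tot + 2 <= X ^ 5)%N.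
  rewrite /tot.
  have : (25 * X ^ 3 <= X ^ 5)%N.
    by rewrite (_ : 5 = 2 + 3)%N // expnD leq_mul2r (_ : 25 = 5 ^ 2)%N // leq_exp2r // X5 orbT.
  have : (25 * X <= X ^ 3)%N by rewrite expnS mulnC leq_mul2l (_ : 25 = 5 ^ 2)%N // leq_exp2r // X5 orbT.
  have : (5 * (X * X) <= X ^ 3)%N by rewrite !expnS expn0 muln1 leq_mul2r X5 orbT.
  lia.
have h : Gam * Om%:R ^+ K * (2 ^+ (Om * S') * (2 * X%:R ^+ 2 * lam)) *
    (((K.+1 * S.+1) ^ (4 * K.+1 * K) * (K * S' ^ K))%N)%:R <= 2 ^+ tot * lam.
  have cast (u v : nat) : (u <= 2 ^ v)%N -> u%:R <= 2 ^+ v :> R by move=> w; rewrite -natrX ler_nat.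
  have -> : Gam * Om%:R ^+ K * (2 ^+ (Om * S') * (2 * X%:R ^+ 2 * lam)) *
    (((K.+1 * S.+1) ^ (4 * K.+1 * K) * (K * S' ^ K))%N)%:R =
    (Gam * (Om ^ K)%N%:R * ((2 ^ (Om * S'))%N%:R * (2 * X ^ 2)%N%:R) *
      (((K.+1 * S.+1) ^ (4 * K.+1 * K))%N%:R * (K * S' ^ K)%N%:R)) * lam.
    rewrite natrX [(2 ^ (Om * S'))%N%:R]natrX [(2 * X ^ 2)%N%:R]natrM [(X ^ 2)%N%:R]natrX [(_ * (K * S' ^ K))%N%:R]natrM.
    move: ((_ ^ (4 * _ * _))%N%:R) ((K * S' ^ K)%N%:R) (Om%:R ^+ K) (2 ^+ (Om * S')) => x1 x2 x3 x4; ring.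
  rewrite ler_wpM2r //.
  have -> : 2 ^+ tot = (2 ^+ (2 * X) * 2 ^+ (X * X)) * (2 ^+ (X * X) * 2 ^+ (1 + 2 * X))
     * (2 ^+ (16 * X ^ 3) * 2 ^+ (X + X * X)) :> R by rewrite -!exprD.
  have pm (x y z t : R) : 0 <= x -> 0 <= z -> x <= y -> z <= t -> x * z <= y * t by move=> *; apply: ler_pM.
  apply: (pm); [by rewrite !mulr_ge0|by rewrite mulr_ge0| |by apply: (pm) => //; exact: cast].
  apply: (pm); [by rewrite mulr_ge0|by rewrite mulr_ge0| |by apply: (pm) => //; exact: cast].
  by apply: (pm) => //; exact: cast.
apply: (le_trans h).
have : 2 ^+ tot * lam * 4 <= lam * 2 ^+ (X ^ 5).
  rewrite mulrC mulrA mulrC ler_wpM2l // (_ : 4 = 2 ^+ 2 :> R); last by rewrite -natrX.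
  by rewrite -exprD ler_weXn2l ?ler1n // addnC.
by move: lamX; lra.
Qed.

Section BakerBound.
Variables (R : realType) (n : nat) (alpha : 'I_n.+1 -> nat) (b : 'I_n.+1 -> int).

Lemma gam_bound L (be : nat) : (forall i, `|b i| <= (2 ^ be)%N%:Z) ->
  forall i (l : {ffun 'I_n.+1 -> 'I_L}), `|gam b i l| <= (2 ^ be.+1 * L)%N%:Z.
Proof.
move=> hb i l; rewrite /gam.
apply: (le_trans (ler_normB _ _)); rewrite !normrM.
have h (j : 'I_n.+1) (v : 'I_L) : `|b j| * `|(v : nat)%:Z| <= (2 ^ be * L)%N%:Z.
  by rewrite PoszM; apply: ler_pM => //; rewrite ger0_norm // lez_nat ltnW.
by have := h ord0 (l (lift ord0 i)); have := h (lift ord0 i) (l ord0); rewrite expnS; lia.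
Qed.

Lemma aval_bound L (a : nat) : (forall i, (0 < alpha i)%N) -> (forall i, (alpha i <= 2 ^ a)%N) ->
  forall l : {ffun 'I_n.+1 -> 'I_L}, (aval alpha l <= 2 ^ (a * L * n.+1))%N.
Proof.
move=> a0 ha l.
have -> : (2 ^ (a * L * n.+1) = \prod_(i < n.+1) 2 ^ (a * L))%N by rewrite prod_nat_const card_ord -expnM.
apply: leq_prod => i _; rewrite expnM; apply: (@leq_trans ((2 ^ a) ^ l i)).
  by case: (l i : nat) => // v; rewrite leq_exp2r.
by rewrite leq_pexp2l ?expn_gt0 // ltnW.
Qed.

Lemma omg_bound L (a : nat) : (forall i, (0 < alpha i)%N) -> (forall i, (alpha i <= 2 ^ a)%N) ->
  b ord0 != 0 -> (0 < a)%N -> `|logform R alpha b| <= 1 ->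
  forall l : {ffun 'I_n.+1 -> 'I_L}, `|omg R alpha b l| <= (n.+2 * (L * a))%N%:R.
Proof.
move=> a0 ha b0 ap h1 l; rewrite omgE //.
apply: (le_trans (ler_normB _ _)).
rewrite mulSn natrD addrC; apply: lerD.
  rewrite !normrM normfV normr_nat -mulrA -[leRHS]mulr1.
  apply: ler_pM => //; first by rewrite mulr_ge0 ?invr_ge0.
    by rewrite ler_nat (leq_trans (ltnW (ltn_ord _))) // leq_pmulr.
  rewrite -[leRHS]mulr1; apply: ler_pM => //; first by rewrite invr_ge0.
  rewrite invf_le1 ?normr_gt0 ?intr_eq0 // -intr_norm -[1]/(1%:~R) ler_int.
  by move: b0; rewrite -normr_gt0; lia.
apply: (le_trans (ler_norm_sum _ _ _)).
apply: (@le_trans _ _ (\sum_(i < n.+1) (L * a)%N%:R)); last first.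
  by rewrite sumr_const card_ord [in leRHS]natrM mulr_natl.
apply: ler_sum => i _; rewrite normrM normr_nat natrM; apply: ler_pM => //.
  by rewrite ler_nat ltnW.
rewrite ger0_norm; first exact: ln_le_nat.
by rewrite ln_ge0 // ler1n.
Qed.

(** In the proof all parameters are at most [X = 2^(y (m^2 + m + 3))], and the form is compared with
    [2^-(X^5)]. *)
Definition baker_exponent (m : nat) : nat := 5 * (m ^ 2 + m + 3).
Definition baker_threshold (m a be y : nat) : nat :=
  2 * (2 * m * (be.+1 + m * y)) * (2 ^ (m ^ 2) * (64 * m.+1 * a)) ^ m.

(* [y] is of the order of [m log a + log be]. In the proof, [S_j = S0 * 2^(j y)] grows while the order of vanishing
   [T / 2^j] only halves, so after [J = m^2] steps there are more zeros than the auxiliary function can have. *)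
Theorem baker (a be y : nat) :
  (forall i, (0 < alpha i)%N) -> (forall i, (alpha i <= 2 ^ a)%N) ->
  (forall i, `|b i| <= (2 ^ be)%N%:Z) -> b ord0 != 0 -> (0 < a)%N ->
  (baker_threshold n.+1 a be y <= 2 ^ y)%N -> logform R alpha b != 0 ->
  1 <= `|logform R alpha b| * 2 ^+ (2 ^ (baker_exponent n.+1 * y)).
Proof.
set D := n.+1; move=> a0 ha hb b0 ap thr L0; rewrite leNgt; apply/negP => small.
set lam := `|logform R alpha b| in small.
have lam0 : 0 < lam by rewrite normr_gt0.
have lamge0 : 0 <= lam by exact: ltW.
(* [L] is the side of the box of exponents. It forces [J = D^2]: up to [L^D = Z^(D^2)] values of
   [aval] have to be separated at the end, and each step multiplies the number of zeros by [Z]. *)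
pose Z := (2 ^ y)%N; pose L := (Z ^ D)%N; pose J := (D ^ 2)%N; pose W := (64 * D.+1 * a)%N.
pose delta := (be.+1 + D * y)%N; pose S0 := (2 * D * delta)%N; pose TJ := (W * Z * L)%N.
pose T := (2 ^ J * TJ)%N; pose X := (Z ^ (J + D + 3))%N.
have Z0 : (0 < Z)%N by rewrite expn_gt0.
have L1 : (0 < L)%N by rewrite expn_gt0 Z0.
have W0 : (0 < W)%N by rewrite !muln_gt0 ap.
have D0 : (0 < D)%N by [].
have del0 : (0 < delta)%N by rewrite addn_gt0.
have S00 : (0 < S0)%N by rewrite !muln_gt0 D0 del0.
have thr' : (2 * S0 * (2 ^ J * W) ^ D <= Z)%N by [].
have JW0 : (0 < 2 ^ J * W)%N by rewrite muln_gt0 expn_gt0 W0.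
have S0Z : (2 * S0 <= Z)%N by apply: leq_trans thr'; rewrite leq_pmulr // expn_gt0 JW0.
have JWZ : (2 ^ J * W <= Z)%N.
  apply: leq_trans thr'; apply: (@leq_trans ((2 ^ J * W) ^ D)).
    by rewrite -[leqLHS]expn1 leq_pexp2l.
  by rewrite leq_pmull // muln_gt0 S00.
have Z64 : (64 <= Z)%N.
  apply: leq_trans JWZ; apply: (@leq_trans W); last by rewrite leq_pmull // expn_gt0.
  by rewrite /W -mulnA leq_pmulr // muln_gt0 ap.
have Zm u v : (u <= v)%N -> (Z ^ u <= Z ^ v)%N by move=> h; rewrite leq_pexp2l.
have X5 : (5 <= X)%N.
  by apply: (@leq_trans (Z ^ 1)); [rewrite expn1; lia|apply: Zm; lia].
have TJ0 : (0 < TJ)%N by rewrite /TJ muln_gt0 L1 muln_gt0 W0 Z0.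
have T0 : (0 < T)%N by rewrite /T muln_gt0 expn_gt0 TJ0.
(* Since [L^D = Z * Z^n * L^n] and [T = 2^J W * Z L], one factor [Z] is left over to pay for
   [2 S0 (2^J W)^n]; this is what the threshold demands. *)
have siegel_cond : (2 * (S0 * T ^ n) <= L ^ D)%N.
  have -> : T = ((2 ^ J * W) * (Z * L))%N by rewrite /T /TJ !mulnA.
  rewrite [(L ^ D)%N]expnS.
  have -> : (2 * (S0 * (2 ^ J * W * (Z * L)) ^ n) = (2 * S0 * (2 ^ J * W) ^ n) * Z ^ n * L ^ n)%N.
    by rewrite !expnMn; ring.
  rewrite leq_mul2r; apply/orP; right; rewrite /L [(Z ^ D)%N]expnS leq_mul2r; apply/orP; right.
  by apply: leq_trans thr'; rewrite leq_mul2l leq_pexp2l ?orbT.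
have hgam : forall i (l : {ffun 'I_n.+1 -> 'I_L}), `|gam b i l| <= (2 ^ delta)%N%:Z.
  have e : (2 ^ be.+1 * L = 2 ^ delta)%N by rewrite /L /Z -expnM -expnD /delta (mulnC y).
  by move=> i l; rewrite -e; exact: gam_bound.
have hav : forall l : {ffun 'I_n.+1 -> 'I_L}, (aval alpha l <= 2 ^ (a * L * D))%N.
  exact: aval_bound.
have havS S1 : forall (l : {ffun 'I_n.+1 -> 'I_L}) s, (s < S1)%N -> (aval alpha l ^ s <= 2 ^ (a * L * D * S1))%N.
  move=> l s sS; rewrite [in leqRHS]expnM; apply: (@leq_trans ((2 ^ (a * L * D)) ^ s)).
    by case: (s) => // v; rewrite leq_exp2r.
  by rewrite leq_pexp2l ?expn_gt0 // ltnW.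
have G0 : (0 < 2 ^ delta)%N by rewrite expn_gt0.
have AV0 : (0 < 2 ^ (a * L * D * S0))%N by rewrite expn_gt0.
have [p [[l0 pl0] pb pvan]] := auxiliary_exists b0 siegel_cond L1 T0 G0 AV0 hgam (havS S0).
have Gamb u : (size u < T)%N -> \sum_l `|(p l)%:~R * (gmon b u l)%:~R| <= 2 ^+ (S0 * T) :> R.
  move=> uT.
  apply: (@le_trans _ _ (\sum_(l : {ffun 'I_n.+1 -> 'I_L})
     ((L ^ D * ((2 ^ delta) ^ (n * T) * 2 ^ (a * L * D * S0))) * (2 ^ delta) ^ T)%N%:R)).
    apply: ler_sum => l _; rewrite -intrM -intr_norm normrM.
    rewrite -[X in _ <= X]/((_%:Z)%:~R) ler_int PoszM; apply: ler_pM => //.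
    rewrite /gmon normr_prod; apply: (@le_trans _ _ ((2 ^ delta) ^ size u)%N%:Z); last first.
      by rewrite lez_nat leq_pexp2l // ltnW.
    elim: (u) => [|i v IH]; first by rewrite big_nil.
    by rewrite big_cons /= expnS PoszM; apply: ler_pM => //; apply: prodr_ge0.
  rewrite sumr_const card_ffun !card_ord -[_ *+ _]mulr_natl -natrM -natrX ler_nat.
  have LD : (L ^ D = 2 ^ (y * D * D))%N by rewrite /L /Z -!expnM mulnA.
  rewrite LD -!expnM -!expnD leq_exp2l //.
  have W64 : (64 * D * a <= W)%N by rewrite /W leq_mul2r leq_mul2l leqnSn !orbT.
  have WT : (W * L <= T)%N.
    have mE (x w z l : nat) : (x * (w * z * l) = (x * z) * (w * l))%N by ring.
    have -> : T = ((2 ^ J * Z) * (W * L))%N := mE _ _ _ _.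
    by rewrite leq_pmull // muln_gt0 expn_gt0 Z0.
  have h1 : (8 * (y * D * D) <= S0 * T)%N.
    rewrite (_ : 8 * (y * D * D) = (2 * D * (D * y)) * 4)%N; last by ring.
    apply: leq_mul; first by rewrite /S0 leq_mul2l /delta leq_addl orbT.
    apply: leq_trans WT; apply: (@leq_trans (64 * D * a)); last by apply: leq_trans W64 _; rewrite leq_pmulr.
    by rewrite (_ : 64 = 4 * 16)%N // -!mulnA leq_pmulr // !muln_gt0 ap.
  have h2 : (2 * (delta * (n * T) + delta * T) = S0 * T)%N by rewrite /S0 /D; ring.
  have h3 : (4 * (a * L * D * S0) <= S0 * T)%N.
    rewrite mulnA [leqRHS]mulnC leq_mul2r; apply/orP; right; apply: leq_trans WT.
    rewrite (_ : 4 * (a * L * D) = (4 * D * a) * L)%N; last by ring.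
    by rewrite leq_mul2r; apply/orP; right; apply: leq_trans W64; rewrite !leq_mul2r !orbT.
  move: h1 h2 h3; lia.
pose Om := (D.+1 * (L * a))%N.
have X1 : (1 <= X)%N by lia.
have lamX : lam * 2 ^+ (X ^ 5) < 1.
  apply: le_lt_trans small; rewrite ler_wpM2l // ler_weXn2l ?ler1n //.
  by rewrite /X /Z -!expnM /baker_exponent leq_exp2l // -/J; nia.
have lam1 : lam * X%:R ^+ 2 <= 1 / 2.
  have : lam * (2 * X%:R ^+ 2) <= lam * 2 ^+ (X ^ 5).
    rewrite ler_wpM2l // -!natrX -natrM ler_nat.
    apply: (@leq_trans (X ^ 3)); first by rewrite (_ : 3 = 1 + 2)%N // expnD leq_mul2r; apply/orP; right; lia.
    apply: leq_trans (leq_pow2 _) _; rewrite leq_exp2l // leq_pexp2l //.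
  by move: lamX; lra.
have lamle1 : lam <= 1.
  have : lam * 1 <= lam * X%:R ^+ 2 by rewrite ler_wpM2l // exprn_ege1 // ler1n.
  by move: lam1; lra.
have Om1 : (1 <= Om)%N by rewrite !muln_gt0 L1 ap.
have OmWL : (64 * Om = W * L)%N by rewrite /Om /W; ring.
have OmX : (Om <= X)%N.
  apply: (@leq_trans (W * L)); first by rewrite -OmWL leq_pmull.
  apply: (@leq_trans (Z * L)).
    by rewrite leq_mul2r; apply/orP; right; apply: leq_trans JWZ; rewrite leq_pmull // expn_gt0.
  by rewrite -expnS; apply: Zm; rewrite /J; lia.
have main j : (j <= J)%N -> vanish alpha b p (S0 * Z ^ j) (2 ^ (J - j) * TJ).
  elim: j => [|j IH] jJ; first by rewrite expn0 muln1 subn0.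
  have {IH}IH := IH (ltnW jJ).
  set S := (S0 * Z ^ j)%N in IH; set S' := (S0 * Z ^ j.+1)%N; set M := (2 ^ (J - j.+1) * TJ)%N.
  have MM : (2 ^ (J - j) * TJ = M + M)%N by rewrite /M addnn -mul2n mulnA -expnS -subSn // subSS.
  rewrite MM in IH.
  have M0 : (0 < M)%N by rewrite muln_gt0 expn_gt0 TJ0.
  have S'E : (S' = Z * S)%N by rewrite /S' /S expnS; ring.
  have SS' : (S <= S')%N by rewrite S'E leq_pmull.
  have S'X : (S' <= X)%N.
    apply: (@leq_trans (Z * Z ^ J)); last by rewrite -expnS; apply: Zm; lia.
    by apply: leq_mul; [lia|apply: Zm].
  (* [W] is chosen with [64 Om = W L], and the factor [Z] in [TJ] pays for [S' = Z S], so that even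
     the last order [TJ] is large enough. *)
  have K64 : (64 * (Om * S') <= S * M)%N.
    rewrite mulnA OmWL S'E /M (_ : W * L * (Z * S) = S * TJ)%N; last by rewrite /TJ; ring.
    by rewrite leq_mul2l leq_pmull ?expn_gt0 ?orbT.
  have S0' : (0 < S)%N by rewrite muln_gt0 S00 expn_gt0 Z0.
  have K2 : (2 <= S * M)%N.
    by apply: leq_trans K64; apply: (@leq_trans 64) => //; rewrite leq_pmulr // muln_gt0 Om1 (leq_trans S0').
  have KX : (S * M <= X)%N.
    apply: (@leq_trans (Z * Z ^ J * (Z * (Z * L)))).
      apply: leq_mul; first by apply: leq_mul; [lia|apply: Zm; exact: ltnW].
      have mE2 (x w z l : nat) : (x * (w * z * l) = (x * w) * (z * l))%N by ring.
      have -> : M = (2 ^ (J - j.+1) * W * (Z * L))%N := mE2 _ _ _ _.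
      apply: leq_mul => //.
      by apply: leq_trans JWZ; rewrite leq_mul2r leq_exp2l // leq_subr orbT.
    by rewrite /L /X -!expnS -expnD; apply: Zm; lia.
  have STK : (S0 * T <= 2 * (S * M))%N.
    rewrite (_ : 2 * (S * M) = S * (M + M))%N; last by ring.
    rewrite -MM /S /T; have -> : (2 ^ J = 2 ^ j * 2 ^ (J - j))%N by rewrite -expnD subnKC // ltnW.
    have mE3 (s x w t : nat) : (s * (x * w * t) = s * x * (w * t))%N by ring.
    rewrite mE3 leq_mul2r; apply/orP; right; rewrite leq_mul2l; apply/orP; right.
    by case: (j) => // j'; rewrite leq_exp2r //; lia.
  have GX : 2 ^+ (S0 * T) <= 2 ^+ (2 * (S * M)) :> R by rewrite ler_weXn2l ?ler1n.
  have uM (u : seq 'I_n) : (size u < M)%N -> (size u < T)%N.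
    move/leq_trans; apply; rewrite /M /T leq_mul2r leq_exp2l // leq_subr orbT //.
  apply: (@extrapolate R n L alpha b a0 b0 p S S' M (2 ^+ (S0 * T)) Om%:R
     (2 ^+ (Om * S') * (2 * X%:R ^+ 2 * lam)) IH M0) => //.
  - by move=> u /uM; exact: Gamb.
  - by rewrite ler1n.
  - by move=> l; apply: omg_bound.
  - by rewrite !mulr_ge0 ?exprn_ge0.
  - by rewrite exprn_ge0.
  - move=> l s sS.
    set x := - _.
    have xb : `|x| <= X%:R ^+ 2 * lam.
      rewrite /x normrN !normrM !normr_nat normfV -/lam.
      have i1 : `|(b ord0)%:~R : R|^-1 <= 1.
        rewrite invf_le1 ?normr_gt0 ?intr_eq0 // -intr_norm -[1]/(1%:~R) ler_int.
        by move: b0; rewrite -normr_gt0; lia.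
      have i0 : 0 <= `|(b ord0)%:~R : R|^-1 by rewrite invr_ge0.
      have lX : (l ord0 : nat)%:R <= X%:R :> R.
        rewrite ler_nat; apply: leq_trans (ltnW (ltn_ord _)) _.
        by apply: leq_trans OmX; rewrite /Om mulnCA leq_pmulr // muln_gt0 ap.
      have sX : s%:R <= X%:R :> R by rewrite ler_nat (leq_trans (ltnW sS)).
      rewrite (_ : X%:R ^+ 2 * lam = X%:R * lam * 1 * X%:R); last by ring.
      apply: ler_pM => //; first by rewrite !mulr_ge0.
      by apply: ler_pM => //; [rewrite mulr_ge0|apply: ler_pM].
    have xh : `|x| <= 1 / 2 by apply: (le_trans xb); rewrite mulrC.
    have := expR_sub1_bound xh => xe.
    apply: ler_pM => //; first by rewrite exprn_ge0.
      rewrite -!natrX ler_nat; apply: leq_trans (havS S' l s sS) _.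
      rewrite leq_exp2l // leq_mul2r /Om; apply/orP; right; rewrite mulnC (mulnC a) leq_mul2r leqnSn orbT //.
    by apply: (le_trans xe); move: xb; lra.
  - have t1 := @extrapolation_main_term R (S * M) Om S' (2 ^+ (S0 * T)) K64 K2 GX.
    have GXX : 2 ^+ (S0 * T) <= 2 ^+ (2 * X) :> R.
      by apply: (le_trans GX); rewrite ler_weXn2l ?ler1n // leq_mul2l KX orbT.
    have t2 := @extrapolation_error_term R X (S * M) S S' Om (2 ^+ (S0 * T)) lam X5 KX
       (leq_trans SS' S'X) S'X OmX (exprn_ge0 _ (ler0n _ 2)) GXX (ltW lam0) (ltW lamX).
    have t3 : 2 ^+ (S0 * T) * (2 ^+ (Om * S') * (2 * X%:R ^+ 2 * lam)) <= 1 / 4 :> R.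
      apply: le_trans t2; set G := 2 ^+ (S0 * T); set eta := _ * (_ * lam).
      have Ge : 0 <= G * eta by rewrite !mulr_ge0 ?exprn_ge0.
      rewrite -[leLHS]mulr1 (_ : G * Om%:R ^+ (S * M) * eta = (G * eta) * Om%:R ^+ (S * M)); last by ring.
      rewrite -[leRHS]mulrA; apply: ler_wpM2l => //; apply: mulr_ege1.
        by rewrite exprn_ege1 // ler1n.
      have S'0 : (0 < S')%N := leq_trans S0' SS'.
      have SM0 : (0 < S * M)%N := ltnW K2.
      have pn (x v k l : nat) : (0 < k)%N -> (0 < v)%N -> (1 <= (x.+1 * l.+1) ^ (4 * x.+1 * x) * (k * v ^ k))%N.
        by move=> k0 v0; rewrite !muln_gt0 !expn_gt0 k0 v0.
      by rewrite ler1n; apply: pn.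
    by move: t1 t2 t3; lra.
have := main J (leqnn J); rewrite subnn mul1n => vJ.
move/eqP: pl0; apply; apply: (vanish_eq0 a0 b0 vJ _ _ L0).
  by rewrite /L -expnM /J -mulnn leq_pmull.
rewrite /TJ ltn_mul2r L1 /=; apply: (@leq_trans W); last by rewrite leq_pmulr.
by rewrite /W -/D -mulnA; apply: (@leq_trans (64 * D.+1)); [lia|rewrite leq_mul2l leq_pmulr].
Qed.
End BakerBound.

(** * Thue's method for sums of geometric progressions *)

Lemma nderivn_nderivn (R : comNzRingType) (p : {poly R}) (c i : nat) :
  (p^`N(c))^`N(i) = p^`N(i + c) *+ 'C(i + c, c).
Proof.
apply/polyP => k; rewrite coefMn !coef_nderivn -!mulrnA; congr (_ *+ _).
  by congr (p`_ _); lia.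
have bf a b : ('C(a + b, a) * (a`! * b`!) = (a + b)`!)%N.
  by have := @bin_fact (a + b) a (leq_addr _ _); rewrite addKn.
have h1 := bf c (i + k)%N; have h2 := bf i k.
have h3 := bf (i + c)%N k; have h4 := bf c i.
apply/eqP; rewrite -(@eqn_pmul2r (c`! * (i`! * k`!))) ?muln_gt0 ?fact_gt0 //; apply/eqP.
transitivity ((i + c + k)`!)%N.
  rewrite (_ : i + c + k = c + (i + k))%N; last by lia.
  by rewrite -h1 -h2; ring.
by rewrite -h3 (addnC i c) -h4; ring.
Qed.

Section Cyclotomic.
Variable e : nat.
Definition geom (R : nzSemiRingType) (x : R) : R := \sum_(i < e.+1) x ^+ i.
Let Fp : {poly int} := geom 'X.

Lemma geom_mul (R : comNzRingType) (x : R) : (x - 1) * geom x = x ^+ e.+1 - 1.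
Proof. by rewrite subrX1. Qed.

(** Modulo [X^(e+1) - 1] an exponent counts only modulo [e + 1], and a remainder with all
    coefficients equal is a multiple of [Fp]. Thus divisibility by [Fp] becomes [e] linear
    equations, as [siegel] requires. *)
Lemma class_sum_dvd (I : finType) (ep : I -> int) (k : I -> nat) :
  (forall c : 'I_e.+1, \sum_(i | (k i %% e.+1 == c)%N) ep i = \sum_(i | (k i %% e.+1 == 0)%N) ep i) ->
  exists q : {poly int}, \sum_i ep i *: 'X^(k i) = Fp * q.
Proof.
move=> hc.
have hX (m : nat) : exists q : {poly int}, 'X^m == 'X^(m %% e.+1) + Fp * q.
  exists (('X - 1) * ('X^(m %% e.+1) * \sum_(i < m %/ e.+1) ('X^(e.+1)) ^+ i)).
  have -> : forall u v : {poly int}, Fp * (('X - 1) * (u * v)) = u * (('X^(e.+1) - 1) * v).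
    by move=> u v; rewrite -geom_mul -/Fp; ring.
  by apply/eqP; rewrite -subrX1 mulrBr mulr1 addrC subrK -exprM mulnC -exprD addnC -divn_eq.
have {}hX : exists q : I -> {poly int}, forall i, 'X^(k i) = 'X^(k i %% e.+1) + Fp * q i.
  exists (fun i => xchoose (hX (k i))) => i; apply/eqP; exact: (xchooseP (hX (k i))).
case: hX => q hq.
exists (\sum_i ep i *: q i + (\sum_(i | (k i %% e.+1 == 0)%N) ep i)%:P).
rewrite mulrDr mulr_sumr addrC.
transitivity (\sum_i (ep i *: 'X^(k i %% e.+1) + Fp * (ep i *: q i))).
  by apply: eq_bigr => i _; rewrite {1}hq scalerDr scalerAr.
rewrite big_split /=; congr (_ + _).
rewrite (partition_big (fun i => Ordinal (ltn_pmod (k i) (ltn0Sn e))) xpredT) //=.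
rewrite /Fp /geom mulr_suml; apply: eq_bigr => c _.
rewrite mulrC mul_polyC -(hc c) scaler_suml; apply: eq_big => i; first by rewrite -val_eqE.
by move=> /eqP <-.
Qed.

Lemma even_geom_neq0 (R : realDomainType) (x : R) : ~~ odd e -> geom x != 0.
Proof.
move=> oe; have [->|x1] := eqVneq x 1.
  rewrite /geom (eq_bigr (fun _ => 1)) => [|i _]; last by rewrite expr1n.
  by rewrite sumr_const card_ord pnatr_eq0.
apply/negP => /eqP g0; have := geom_mul x; rewrite g0 mulr0 => /esym/eqP.
rewrite subr_eq0 => /eqP xe.
have nx : `|x| = 1.
  by apply/eqP; rewrite -(@pexpr_eq1 _ `|x| e.+1) // -normrX xe normr1.
move: x1; rewrite -subr_eq0; case: (lerP 0 x) => x0.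
  by rewrite -nx ger0_norm // subrr eqxx.
have ex : x = -1 by rewrite -nx ltr0_norm // opprK.
move: xe; rewrite ex -signr_odd /= oe expr1 => /eqP.
by rewrite -subr_eq0 -opprD oppr_eq0 (_ : 1 + 1 = 2%:R) // pnatr_eq0.
Qed.
End Cyclotomic.

Section RatCyclotomic.
Variable e : nat.
Let F : {poly rat} := geom e 'X.

Lemma geom_poly_horner (x : rat) : F.[x] = geom e x.
Proof. by rewrite /F /geom horner_sum; apply: eq_bigr => i _; rewrite hornerXn. Qed.

Lemma geom_polyE : F = \poly_(i < e.+1) 1.
Proof. by rewrite poly_def; apply: eq_bigr => i _; rewrite scale1r. Qed.

Lemma size_geom_poly : size F = e.+1.
Proof. by rewrite geom_polyE size_poly_eq // oner_eq0. Qed.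

(** Differentiating [(X - 1) F = X^(e+1) - 1] gives [F' (X - 1) = (e+1) X^e - F], and [F] is prime
    to [X]. *)
Lemma geom_coprime_deriv : coprimep F F^`().
Proof.
have Fx : coprimep F 'X.
  rewrite coprimepX /root geom_poly_horner /geom big_ord_recl expr0 big1 ?addr0 ?oner_eq0 //.
  by move=> i _; rewrite exprS mul0r.
have e1 : F^`() * ('X - 1) = 'X^e *+ e.+1 - F.
  have := congr1 deriv (@geom_mul e _ ('X : {poly rat})).
  rewrite derivM !derivB derivX derivXn -polyC1 !derivC !subr0 mul1r -/F /= => <-.
  by rewrite addrAC subrr add0r mulrC.
have c1 : coprimep F (F^`() * ('X - 1)).
  rewrite e1 addrC -[- F]mulN1r -mulr_natl.
  rewrite -polyC1 -polyCN coprimep_addl_mul -polyC_natr mul_polyC coprimepZr ?pnatr_eq0 //.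
  by rewrite coprimep_expr.
by move: c1; rewrite coprimepMr => /andP[].
Qed.

(** The parity of [e] enters here: for odd [e] the polynomial has the factor [X + 1]. *)
Lemma geom_coprime_linear (be ga : rat) : ~~ odd e -> (be != 0) || (ga != 0) ->
  coprimep F (be%:P + ga *: 'X).
Proof.
move=> oe; have [->|g0 _] := eqVneq ga 0.
  by rewrite orbF scale0r addr0 -alg_polyC => b0; rewrite coprimepZr // coprimep1.
have -> : be%:P + ga *: 'X = ga *: ('X - (- be / ga)%:P).
  by rewrite scalerBr -[X in _ - X]mul_polyC -polyCM [ga * _]mulrC divfK // polyCN opprK addrC.
by rewrite coprimepZr // coprimep_XsubC /root geom_poly_horner even_geom_neq0.
Qed.

(** Vanishing to order [m] at all roots of a squarefree polynomial, stated without a splitting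
    field; separability lets one more factor [F] be split off at each order. *)
Lemma dvdp_exp_of_derivs (m : nat) (G : {poly rat}) :
  (forall j, (j < m)%N -> F %| G^`(j)) -> F ^+ m %| G.
Proof.
elim: m G => [|m IH] G h; first by rewrite expr0 dvd1p.
have /dvdpP[U eU] : F ^+ m %| G by apply: IH => j jm; apply: h; exact: ltnW.
have : F ^+ m %| G^`() by apply: IH => j jm; rewrite -derivSn; apply: h.
case: m {IH} h eU => [|m] h eU.
  by move=> _; have := h 0%N isT; rewrite derivn0 expr1.
have e1 : G^`() = U^`() * F ^+ m.+1 + F ^+ m * ((m.+1)%:R *: (U * F^`())).
  rewrite eU derivM deriv_exp /= scaler_nat; congr (_ + _).
  by rewrite !mulrnAr; congr (_ *+ _); rewrite [RHS]mulrC -mulrA.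
rewrite e1 dvdp_addr; last by rewrite dvdp_mull.
rewrite [F ^+ m.+1 in X in X -> _]exprSr dvdp_mul2l; last first.
  by rewrite expf_neq0 // -size_poly_eq0 size_geom_poly.
rewrite dvdpZr ?pnatr_eq0 // Gauss_dvdpl ?geom_coprime_deriv // => dU.
by rewrite eU [F ^+ m.+2]exprS dvdp_mul.
Qed.
End RatCyclotomic.

Lemma taylor_poly (R : {poly int}) (x : int) :
  R = \sum_(i < size R) (R^`N(i).[x])%:P * ('X - x%:P) ^+ i.
Proof.
have e : x%:P + ('X - x%:P) = 'X :> {poly int} by rewrite addrC subrK.
rewrite -{1}[R]comp_polyXr /comp_poly -{1}e nderiv_taylor; last exact: mulrC.
rewrite size_map_polyC; apply: eq_bigr => i _.
by rewrite nderivn_map horner_map.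
Qed.

(** At the index of the lowest nonzero coefficient of [V], the coefficient of [W] is that integer
    times [(-x)^u]. *)
Lemma lowest_coef_bound (W V : {poly int}) (x u B : nat) :
  W = ('X - (x%:Z)%:P) ^+ u * V -> W != 0 -> (forall i, `|W`_i| <= B%:Z) -> (x ^ u <= B)%N.
Proof.
move=> eW W0 hB.
have V0 : V != 0 by apply: contra W0 => /eqP e; rewrite eW e mulr0.
have ex : exists j, V`_j != 0.
  by exists (size V).-1; rewrite -/(lead_coef V) lead_coef_eq0.
case: (ex_minnP ex) => j Vj jmin.
have := hB j; rewrite eW coefM big_ord_recl big1 ?addr0; last first.
  move=> i _; rewrite /= (_ : V`_(j - bump 0 i) = 0) ?mulr0 //.
  apply/eqP; apply: contraT => /jmin; have := ltn_ord i; rewrite /bump /=; lia.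
rewrite subn0 -horner_coef0 horner_exp hornerXsubC sub0r normrM normrX normrN.
have -> : `|x%:Z| ^+ u = (x ^ u)%N%:Z by rewrite ger0_norm // -!natz natrX.
have : 1 <= `|V`_j| by move: Vj; rewrite -normr_gt0; lia.
move: (`|V`_j|) (x ^ u)%N => a b a1 h.
by rewrite -lez_nat; apply: le_trans h; nia.
Qed.

(** Comparing leading terms in the identity shows equal degrees. The combination of [p] and [q] that
    cancels the leading terms satisfies the same identity with [q] but has smaller degree, so it is
    zero. *)
Lemma wronskian_eq0 (p q : {poly int}) : p * q^`() = p^`() * q -> p != 0 -> q != 0 ->
  lead_coef q *: p = lead_coef p *: q.
Proof.
have size_eq (r s : {poly int}) : r * s^`() = r^`() * s -> r != 0 -> s != 0 -> size r = size s.
  move=> e r0 s0.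
  have lc (f : {poly int}) : f != 0 -> f^`()`_((size f).-2) = lead_coef f *+ (size f).-1 \/ size f = 1%N.
    move=> f0; have : (0 < size f)%N by rewrite size_poly_gt0.
    case E : (size f) => [|[|k]] // _; [by right|left].
    by rewrite coef_deriv /lead_coef E.
  have szd (f : {poly int}) : (size f^`() <= (size f).-1)%N.
    have [->|f0] := eqVneq f 0; first by rewrite deriv0 size_poly0.
    by have := lt_size_deriv f0; case: (size f).
  have cM (f g : {poly int}) : f != 0 -> g != 0 ->
     (f * g^`())`_((size f).-1 + (size g).-2) = lead_coef f * lead_coef g *+ (size g).-1.
    move=> f0 g0; have [eg|eg] := lc g g0.
      rewrite -[RHS]mulrnAr -eg coefM.
      have hs : ((size f).-1 < ((size f).-1 + (size g).-2).+1)%N by lia.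
      rewrite (bigD1 (Ordinal hs)) //= addKn [X in _ + X]big1 ?addr0 // => i ni.
      have {}ni : (i : nat) != (size f).-1 by move: ni; rewrite -val_eqE.
      case: (ltnP i (size f).-1) => hi; last first.
        have fs : (0 < size f)%N by rewrite size_poly_gt0.
        have lt : ((size f).-1 < i)%N by rewrite ltn_neqAle eq_sym ni hi.
        by rewrite nth_default ?mul0r //; apply: leq_trans lt; rewrite leqSpred.
      rewrite [X in _ * X]nth_default ?mulr0 //; apply: leq_trans (szd g) _.
      have nat1 (u v k : nat) : (k < u)%N -> (v.-1 <= u + v.-2 - k)%N by case: v => [|[|v]] /=; lia.
      exact: nat1 hi.
    have -> : g^`() = 0 by apply/eqP; rewrite -size_poly_leq0; apply: leq_trans (szd g) _; rewrite eg.
    by rewrite mulr0 coef0 eg mulr0n.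
  have rs0 : (0 < size r)%N by rewrite size_poly_gt0.
  have ss0 : (0 < size s)%N by rewrite size_poly_gt0.
  have l0 : lead_coef r * lead_coef s != 0 by rewrite mulf_neq0 // lead_coef_eq0.
  have c1 := cM r s r0 s0; have c2 := cM s r s0 r0.
  rewrite mulrC -e in c2.
  have [r1|r1] := eqVneq (size r) 1%N.
    have dr : r^`() = 0 by apply/eqP; rewrite -size_poly_leq0; apply: leq_trans (szd r) _; rewrite r1.
    move: c1; rewrite e dr mul0r coef0 => /esym/eqP; rewrite mulrn_eq0 (negbTE l0) orbF r1.
    by move: ss0; lia.
  have [s1|s1] := eqVneq (size s) 1%N.
    have ds : s^`() = 0 by apply/eqP; rewrite -size_poly_leq0; apply: leq_trans (szd s) _; rewrite s1.
    move: c2; rewrite ds mulr0 coef0 => /esym/eqP; rewrite mulrn_eq0 mulrC (negbTE l0) orbF s1.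
    by move: rs0; lia.
  have ei : ((size r).-1 + (size s).-2 = (size s).-1 + (size r).-2)%N by lia.
  move: c1; rewrite ei c2 [lead_coef s * _]mulrC => /eqP.
  rewrite -subr_eq0 -[_ *+ (size r).-1]mulr_natr -[_ *+ (size s).-1]mulr_natr -mulrBr mulf_eq0 (negbTE l0) /=.
  rewrite subr_eq0 eqr_nat => /eqP h.
  by rewrite -(prednK rs0) -(prednK ss0) h.
move=> e p0 q0; apply/eqP; rewrite -subr_eq0; apply: contraT => d0.
have es := size_eq p q e p0 q0.
set d := _ - _ in d0.
have ed : d * q^`() = d^`() * q.
  rewrite /d derivB !derivZ !mulrBl -!scalerAl e.
  by congr (_ - _); rewrite mulrC.
have sd : (size d < size q)%N.
  have : (0 < size q)%N by rewrite size_poly_gt0.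
  case E : (size q) => [|k] // _; rewrite ltnS; apply/leq_sizeP => j.
  rewrite leq_eqVlt coefB !coefZ /lead_coef es E /= => /orP[/eqP <-|kj].
    by rewrite mulrC subrr.
  have -> : p`_j = 0 by rewrite nth_default // es E.
  have -> : q`_j = 0 by rewrite nth_default // E.
  by rewrite !mulr0 subrr.
by move: sd; rewrite (size_eq d q ed d0 q0) ltnn.
Qed.

Lemma bin_le_exp2 (a b : nat) : ('C(a, b) <= 2 ^ a)%N.
Proof.
elim: a b => [|a IH] [|b]; rewrite ?bin0 ?expn_gt0 // binS expnS mul2n -addnn.
by apply: leq_add.
Qed.

Section Aux.
Variables (e mu : nat).
Hypotheses (e2 : (2 <= e)%N) (eo : ~~ odd e) (mu0 : (0 < mu)%N).
(* The auxiliary polynomial [P0 + Y P1] vanishes to order [m] at [X = Y = zeta] for the nontrivial [e+1]-st roots of unity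
   [zeta]; the degrees differ by [m] because it is evaluated at [y] of size about [x ^ m]. *)
Definition thue_m := (16 * mu)%N.
(** The coefficients number [d0 + d1 = m e + 2 mu] against [m e] equations; the quotient
    [16 mu e / (2 mu)] is the exponent [8 e] in [thue_H]. *)
Definition thue_d0 := (mu * (8 * e + 9))%N.
Definition thue_d1 := (mu * (8 * e - 7))%N.
Definition thue_H := (((thue_d0 + thue_d1) * 2 ^ thue_d0) ^ (8 * e))%N.
Let m := thue_m. Let d0 := thue_d0. Let d1 := thue_d1. Let H := thue_H.

Let d0E : d0 = (mu * (8 * e + 9))%N := erefl.
Let d1E : (d1 + 16 * mu = d0)%N.
Proof. rewrite d0E /d1 /thue_d1; nia. Qed.

Lemma thue_aux_polys : exists P0 P1 : {poly int},
  [/\ (P0 != 0) || (P1 != 0), (size P0 <= d0)%N /\ (size P1 <= d1)%N,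
      (forall i, `|P0`_i| <= H%:Z) /\ (forall i, `|P1`_i| <= H%:Z)
    & forall j, (j < m)%N -> exists q, P0^`N(j) + 'X * P1^`N(j) = geom e 'X * q].
Proof.
pose I : finType := ('I_d0 + 'I_d1)%type.
pose EQ : finType := ('I_m * 'I_e)%type.
have cI : #|{: I}| = (d0 + d1)%N by rewrite card_sum !card_ord.
have cE : #|{: EQ}| = (m * e)%N by rewrite card_prod !card_ord.
pose dg (i : I) : nat := match i with inl a => a | inr b => b end.
pose sh (i : I) : nat := match i with inl _ => 0%N | inr _ => 1%N end.
(* The exponent of the monomial after the [j]-th divided derivative and, for [P1], the factor [X].
   Truncation for [dg i < j] is harmless because the binomial coefficient is 0 there. *)
pose kk (j : nat) (i : I) := (dg i - j + sh i)%N.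
pose ent (c : EQ) (i : I) : int :=
  'C(dg i, c.1)%:Z * ((kk c.1 i %% e.+1 == c.2.+1)%N%:Z - (kk c.1 i %% e.+1 == 0)%N%:Z).
have dgd (i : I) : (dg i < d0)%N.
  case: i => a /=; first exact: ltn_ord.
  by apply: leq_trans (ltn_ord a) _; rewrite -d1E leq_addr.
have entb c i : `|ent c i| <= (2 ^ d0)%N%:Z.
  rewrite /ent normrM -[leRHS]mulr1; apply: ler_pM => //.
    rewrite ger0_norm // lez_nat (leq_trans (bin_le_exp2 _ _)) // leq_pexp2l // ltnW //.
  by case: eqP => _; case: eqP => _.
have mN : (#|{: EQ}| < #|{: I}|)%N by rewrite cI cE /m /thue_m; nia.
have mN1 : (#|{: EQ}| <= (8 * e) * (#|{: I}| - #|{: EQ}|))%N.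
  have -> : (#|{: I}| - #|{: EQ}| = 2 * mu)%N by rewrite cI cE /m /thue_m; nia.
  by rewrite cE /m /thue_m; nia.
have A0 : (0 < 2 ^ d0)%N by rewrite expn_gt0.
have [x [[j0 xj0] xb xs]] := siegel (a := fun i j => ent (enum_val i) (enum_val j))
   (fun i j => entb (enum_val i) (enum_val j)) A0 mN mN1.
pose z (i : I) := x (enum_rank i).
have zb i : `|z i| <= H%:Z by have := xb (enum_rank i); rewrite cI.
have zs (c : EQ) : \sum_i ent c i * z i = 0.
  have := xs (enum_rank c); rewrite enum_rankK => e1; rewrite -[RHS]e1.
  rewrite (reindex (@enum_val I predT)) /=; last exact/onW_bij/enum_val_bij.
  by apply: eq_bigr => k _; rewrite /z enum_valK.
pose z0 (k : nat) : int := if insub k is Some a then z (inl a) else 0.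
pose z1 (k : nat) : int := if insub k is Some a then z (inr a) else 0.
have z0E (a : 'I_d0) : z0 a = z (inl a) by rewrite /z0 valK.
have z1E (a : 'I_d1) : z1 a = z (inr a) by rewrite /z1 valK.
have H0 : (0 : int) <= H%:Z by [].
exists (\poly_(k < d0) z0 k), (\poly_(k < d1) z1 k); split.
- have : z (enum_val j0) != 0 by rewrite /z enum_valK.
  case: (enum_val j0) => a za; apply/orP; [left|right].
    by apply: contra za => /eqP /(congr1 (fun p : {poly int} => p`_a)); rewrite coef0 coef_poly ltn_ord z0E => ->.
  by apply: contra za => /eqP /(congr1 (fun p : {poly int} => p`_a)); rewrite coef0 coef_poly ltn_ord z1E => ->.
- by split; apply: size_poly.
- split => i; rewrite coef_poly; case: ifP => _; rewrite ?normr0 //.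
    by rewrite /z0; case: insub => [a|]; rewrite ?normr0.
  by rewrite /z1; case: insub => [a|]; rewrite ?normr0.
move=> j jm.
have [|q hq] := @class_sum_dvd e I (fun i => z i * 'C(dg i, j)%:Z) (kk j).
  move=> c.
  case: (unliftP ord0 c) => [c' ->|->] //.
  have := zs (Ordinal jm, c'); rewrite /ent /= => h.
  apply/eqP; rewrite -subr_eq0 -[X in _ == X]h; apply/eqP.
  rewrite [X in X - _]big_mkcond [X in _ - X]big_mkcond -sumrB; apply: eq_bigr => i _.
  by rewrite /bump /= add1n; case: eqP => _; case: eqP => _ /=; ring.
exists q; rewrite -hq !poly_def !raddf_sum big_sumType /= mulr_sumr; congr (_ + _).
  apply: eq_bigr => a _; rewrite z0E nderivnZ nderivnXn /kk /= addn0.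
  by rewrite -scalerMnr scalerMnl -mulr_natr natz.
apply: eq_bigr => a _; rewrite z1E nderivnZ nderivnXn /kk /= addn1.
by rewrite -scalerAr mulrnAr -exprS -scalerMnr scalerMnl -mulr_natr natz.
Qed.

Definition wronskian (P Q : {poly int}) := P * Q^`() - P^`() * Q.

(** If it vanished, [P0] and [P1] would be multiples of a single [G], and [P0 + X P1] a linear
    polynomial times [G]. As that linear factor is prime to [geom e 'X], its [m]-th power would
    divide [G]; but its degree [16 mu e] exceeds that of [G] for [e >= 2]. *)
Lemma wronskian_neq0 (P0 P1 : {poly int}) : (P0 != 0) || (P1 != 0) ->
  (size P0 <= d0)%N -> (size P1 <= d1)%N ->
  (forall j, (j < m)%N -> exists q, P0^`N(j) + 'X * P1^`N(j) = geom e 'X * q) ->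
  wronskian P0 P1 != 0.
Proof.
move=> nz s0 s1 hq; apply/negP => /eqP W0.
suff [c [be [ga [G [c0 bg [G0 sG] hG]]]]] : exists c be ga : int, exists G : {poly int},
    [/\ c != 0, (be != 0) || (ga != 0), G != 0 /\ (size G <= d0)%N &
     forall j, c *: (P0^`N(j) + 'X * P1^`N(j)) = (be%:P + ga *: 'X) * G^`N(j)].
  pose Gq : {poly rat} := map_poly intr G.
  pose F : {poly rat} := geom e 'X.
  have Gq0 : Gq != 0 by rewrite map_poly_eq0_id0 // intr_eq0 lead_coef_eq0.
  have cop : coprimep F ((be%:~R)%:P + (ga%:~R) *: 'X).
    by apply: geom_coprime_linear => //; rewrite !intr_eq0.
  have hF j : (j < m)%N -> F %| Gq^`(j).
    move=> jm; rewrite nderivn_def -scaler_nat dvdpZr ?pnatr_eq0 -?lt0n ?fact_gt0 //.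
    rewrite -(Gauss_dvdpr _ cop) /Gq nderivn_map.
    have [q hqj] := hq j jm.
    have -> : (be%:~R)%:P + ga%:~R *: 'X = map_poly intr (be%:P + ga *: 'X) :> {poly rat}.
      by rewrite rmorphD /= map_polyC /= map_polyZ /= map_polyX.
    have := congr1 (map_poly (intr : int -> rat)) (hG j); rewrite hqj map_polyZ !rmorphM /= => e4.
    rewrite -e4 dvdpZr ?intr_eq0 //; apply: dvdp_mulr; rewrite (_ : map_poly _ _ = F) //.
    by rewrite /geom rmorph_sum /=; apply: eq_bigr => i _; rewrite map_polyXn.
  have := dvdp_leq Gq0 (dvdp_exp_of_derivs hF).
  have := size_exp F m; rewrite size_geom_poly /=.
  have : (size Gq <= size G)%N by apply: size_poly.
  move: sG; rewrite /F d0E /m /thue_m.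
  have e2m : (2 * mu <= mu * e)%N by rewrite mulnC leq_mul2l e2 orbT.
  move: (size Gq) (size G) (size (geom e ('X : {poly rat}) ^+ (16 * mu))) => x y z.
  rewrite (_ : mu * (8 * e + 9) = 8 * (mu * e) + 9 * mu)%N; last by ring.
  rewrite (_ : e * (16 * mu) = 16 * (mu * e))%N; last by ring.
  by move: e2m mu0; clear; lia.
have [P10|P10] := eqVneq P1 0.
  exists 1, 1, 0, P0; split => //.
    by split => //; move: nz; rewrite P10 eqxx orbF.
  by move=> j; rewrite P10 linear0 mulr0 addr0 scale1r scale0r addr0 mul1r.
have s1' : (size P1 <= d0)%N by apply: leq_trans s1 _; rewrite -d1E leq_addr.
have [P00|P00] := eqVneq P0 0.
  exists 1, 0, 1, P1; split => // j.
  by rewrite P00 linear0 add0r !scale1r add0r.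
exists (lead_coef P1), (lead_coef P0), (lead_coef P1), P1; split => //.
- by rewrite lead_coef_eq0.
- by rewrite lead_coef_eq0 P00.
move=> j; have e1 := wronskian_eq0 (subr0_eq W0) P00 P10.
by rewrite scalerDr -nderivnZ e1 nderivnZ mulrDl mul_polyC scalerAl.
Qed.

Lemma coefM_bound (P Q : {poly int}) (s : nat) (a b : nat) :
  (forall i, `|P`_i| <= a%:Z) -> (forall i, `|Q`_i| <= b%:Z) -> (size P <= s)%N ->
  forall i, `|(P * Q)`_i| <= (s * (a * b))%N%:Z.
Proof.
move=> hP hQ sP i.
have [s0|s0] := posnP s.
  move: sP; rewrite s0 leqn0 size_poly_eq0 => /eqP ->.
  by rewrite mul0r coef0 normr0.
rewrite coefM.
have z k : (s <= k)%N -> P`_k = 0 by move=> sk; rewrite nth_default // (leq_trans sP).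
apply: (le_trans (ler_norm_sum _ _ _)).
apply: (@le_trans _ _ (\sum_(k < i.+1 | (k < s)%N) (a * b)%N%:Z)).
  rewrite [leRHS]big_mkcond /=; apply: ler_sum => k _; rewrite normrM.
  case: ltnP => ks; last by rewrite z // normr0 mul0r.
  by rewrite PoszM; apply: ler_pM.
rewrite sumr_const -[_ *+ _]mulr_natl natz -PoszM lez_nat leq_mul2r; apply/orP; right.
rewrite -[leqRHS](card_ord s).
have hinj : {in [pred k : 'I_i.+1 | (k < s)%N] &, injective (fun k : 'I_i.+1 => inord k : 'I_s.-1.+1)}.
  move=> k k'; rewrite !inE => h h' /(congr1 val); rewrite /= !inordK ?prednK //.
  by move/val_inj.
rewrite -(card_in_imset hinj).
by apply: leq_trans (max_card _) _; rewrite !card_ord prednK.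
Qed.
End Aux.

Definition sg (x e : nat) : nat := (\sum_(i < e.+1) x ^ i)%N.
Definition smooth (X v : nat) : Prop := forall p, prime p -> (p %| v)%N -> (p <= X)%N.
(* The share of the prime [s] in [Q], on a logarithmic scale with denominators [16 * (X + 1)]. *)
Definition kappa (X Q s : nat) : nat := trunc_log Q (s ^ (16 * X.+1 * logn s Q)).

Lemma Posz_exp (m k : nat) : m%:Z ^+ k = (m ^ k)%N%:Z.
Proof. by rewrite -!natz natrX. Qed.

Lemma geom_Posz e (x : nat) : geom e x%:Z = (sg x e)%:Z.
Proof.
rewrite /geom /sg (big_morph Posz PoszD (erefl 0%:Z)).
by apply: eq_bigr => i _; rewrite Posz_exp.
Qed.

Lemma wronskian_bound (P Q : {poly int}) (d H : nat) :
  (forall i, `|P`_i| <= H%:Z) -> (forall i, `|Q`_i| <= H%:Z) -> (size P <= d)%N -> (size Q <= d)%N ->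
  forall i, `|(wronskian P Q)`_i| <= (2 * (d * (H * (d * H))))%N%:Z.
Proof.
move=> hP hQ sP sQ i.
have hd (F : {poly int}) : (forall i, `|F`_i| <= H%:Z) -> (size F <= d)%N ->
    forall i, `|F^`()`_i| <= (d * H)%N%:Z.
  move=> hF sF j; rewrite coef_deriv -mulr_natr normrM normr_nat natz.
  case: (ltnP j.+1 d) => jd; last by rewrite nth_default ?normr0 ?mul0r // (leq_trans sF).
  by rewrite mulnC PoszM; apply: ler_pM => //; rewrite lez_nat ltnW.
have sd (F : {poly int}) : (size F <= d)%N -> (size F^`() <= d)%N.
  move=> sF; have [->|F0] := eqVneq F 0; first by rewrite deriv0 size_poly0.
  by apply: leq_trans sF; apply: ltnW; apply: lt_size_deriv.
rewrite /wronskian coefB; apply: (le_trans (ler_normB _ _)).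
have h1 := coefM_bound hP (hd Q hQ sQ) sP i.
have h2 := coefM_bound (hd P hP sP) hQ (sd P sP) i.
have e : (d * (d * H * H) = d * (H * (d * H)))%N by ring.
rewrite e in h2; rewrite mulSn mul1n PoszD; exact: lerD.
Qed.

(** Adding a constant multiple of the second function to the first does not change a Wronskian, so a
    high zero of [P0 + y P1] at [x] is inherited, up to one order, by that of [P0] and [P1]. *)
Lemma wronskian_shift (R : comPzRingType) (p p' q q' y : R) :
  p * q' - p' * q = (p + y * q) * q' - (p' + y * q') * q.
Proof. ring. Qed.

Lemma wronskian_factor (R : comPzRingType) (A B v v' p p' k : R) :
  A * B * v * p' - (A * k * v + A * B * v') * p = A * (B * (v * p') - (v * k + B * v') * p).
Proof. ring. Qed.

(** Otherwise [(X - x)^mu] divides the nonzero Wronskian, whose coefficients are smaller than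
    [x^mu]. *)
Lemma nonvanishing_derivative (P0 P1 : {poly int}) (d H mu x : nat) (y : int) :
  (forall i, `|P0`_i| <= H%:Z) -> (forall i, `|P1`_i| <= H%:Z) -> (size P0 <= d)%N -> (size P1 <= d)%N ->
  wronskian P0 P1 != 0 -> (2 * (d * (H * (d * H))) < x ^ mu)%N ->
  exists2 c, (c <= mu)%N & (P0 + y%:P * P1)^`N(c).[x%:Z] != 0.
Proof.
move=> h0 h1 s0 s1 W0 hx; set R := P0 + _.
case: (boolP [forall c : 'I_mu.+1, R^`N(c).[x%:Z] == 0]) => [/forallP all0|]; last first.
  rewrite negb_forall => /existsP [c hc]; exists c => //; by rewrite -ltnS.
exfalso.
have [V eV] : exists V, R = ('X - (x%:Z)%:P) ^+ mu.+1 * V.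
  exists (\sum_(i < size R) if (i <= mu)%N then 0 else (R^`N(i).[x%:Z])%:P * ('X - (x%:Z)%:P) ^+ (i - mu.+1)).
  rewrite {1}(taylor_poly R x%:Z) mulr_sumr; apply: eq_bigr => i _.
  case: leqP => im; last by rewrite mulrCA -exprD subnKC.
  by have /eqP := all0 (Ordinal (im : (i < mu.+1)%N)); rewrite /= => ->; rewrite mulr0 mul0r.
have eW : wronskian P0 P1 = R * P1^`() - R^`() * P1.
  by rewrite /wronskian /R derivD derivM derivC mul0r add0r -wronskian_shift.
have : wronskian P0 P1 = ('X - (x%:Z)%:P) ^+ mu *
   (('X - (x%:Z)%:P) * (V * P1^`()) - (V *+ mu.+1 + ('X - (x%:Z)%:P) * V^`()) * P1).
  rewrite eW eV derivM deriv_exp derivXsubC mul1r /= exprSr.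
  by rewrite -(mulr_natr (_ ^+ mu)) -(mulr_natr V) wronskian_factor.
move=> e; have := lowest_coef_bound e W0 (wronskian_bound h0 h1 s0 s1).
by rewrite leqNgt hx.
Qed.

(** Expand at [y]: the Taylor terms of total order below [m] are divisible by [geom e y], by
    construction of the polynomials, and the others contain [(x - y)^(m - c)], whose denominators
    [e + 1] are cleared by the power in front. *)
Lemma thue_divisible (e m c w u s : nat) (P0 P1 : {poly int}) (x y : int) :
  (forall j, (j < m)%N -> exists q, P0^`N(j) + 'X * P1^`N(j) = geom e 'X * q) ->
  (c <= m)%N -> ((s ^ w)%N%:Z %| geom e y)%Z -> ((s ^ u)%N%:Z %| e.+1%:Z * (x - y))%Z ->
  ((s ^ minn w ((m - c) * u))%N%:Z %| e.+1%:Z ^+ m * (P0 + y%:P * P1)^`N(c).[x])%Z.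
Proof.
move=> hq cm hw hu; set R := P0 + _.
have RE j : R^`N(j).[y] = (P0^`N(j) + 'X * P1^`N(j)).[y].
  by rewrite /R nderivnD mul_polyC nderivnZ !hornerE.
have dw : ((s ^ minn w ((m - c) * u))%N%:Z %| (s ^ w)%N%:Z)%Z.
  by rewrite dvdzE /= dvdn_exp2l // geq_minl.
have du : ((s ^ minn w ((m - c) * u))%N%:Z %| (s ^ u)%N%:Z ^+ (m - c))%Z.
  by rewrite Posz_exp dvdzE /= -expnM dvdn_exp2l // mulnC geq_minr.
have xE : x = y + (x - y) by rewrite addrC subrK.
have -> : R^`N(c).[x] = R^`N(c).[y + (x - y)] by rewrite -xE.
rewrite nderiv_taylor; last exact: mulrC.
rewrite mulr_sumr; apply: rpred_sum => i _.
rewrite nderivn_nderivn hornerMn RE.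
case: (ltnP (i + c) m) => icm.
  have [q ->] := hq _ icm.
  rewrite hornerM (_ : (geom e 'X).[y] = geom e y); last first.
    by rewrite /geom horner_sum; apply: eq_bigr => k _; rewrite hornerXn.
  apply: dvdz_mull; apply: dvdz_mulr; rewrite -mulr_natr; apply: dvdz_mulr; apply: dvdz_mulr.
  exact: dvdz_trans dw hw.
have mc : (m - c <= i)%N by rewrite leq_subLR addnC.
have hD : ((s ^ minn w ((m - c) * u))%N%:Z %| e.+1%:Z ^+ (m - c) * (x - y) ^+ (m - c))%Z.
  by rewrite -exprMn; apply: dvdz_trans du _; apply: dvdz_exp2r.
have -> : (x - y) ^+ i = (x - y) ^+ (m - c) * (x - y) ^+ (i - (m - c)) by rewrite -exprD subnKC.
have -> : e.+1%:Z ^+ m = e.+1%:Z ^+ (m - c) * e.+1%:Z ^+ c by rewrite -exprD subnK.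
rewrite mulrCA; apply: dvdz_mull; rewrite mulrAC mulrA.
by apply: dvdz_mulr; apply: dvdz_mulr.
Qed.

Lemma coprime_prod_prime_powers (n : nat) (t : nat -> nat) : prime n ->
  coprime (\prod_(s < n | prime s) s ^ t s) (n ^ t n).
Proof.
move=> pn; apply: (big_ind (fun v => coprime v (n ^ t n))).
- exact: coprime1n.
- by move=> a b ha hb; rewrite coprimeMl ha hb.
move=> i pi; apply: coprimeXl; apply: coprimeXr.
by rewrite prime_coprime // dvdn_prime2 // ltn_eqF.
Qed.

Lemma prod_prime_powers_dvd (n V : nat) (t : nat -> nat) :
  (forall s, prime s -> (s ^ t s %| V)%N) -> (\prod_(s < n | prime s) s ^ t s %| V)%N.
Proof.
move=> h; elim: n => [|n IH]; first by rewrite big_ord0 dvd1n.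
rewrite big_mkcond big_ord_recr /= -big_mkcond /=; case: ifP => pn; last by rewrite muln1.
by rewrite Gauss_dvd ?IH ?h // coprime_prod_prime_powers.
Qed.

(** Write [y^n - x^n = (y - x) Q]. The congruence modulo [n * X!] gives [Q = n x^(n-1)] modulo
    [n s], so [Q] is [n] times a number prime to [s]: the roots of unity [x] and [y] modulo [s^k]
    agree up to [n]. *)
Lemma congruence_of_roots (s X n x y k : nat) : prime s -> (s <= X)%N -> (0 < n)%N -> (x <= y)%N ->
  x = y %[mod n * X`!] -> (0 < x)%N ->
  (s ^ k %| x ^ n - 1)%N -> (s ^ k %| y ^ n - 1)%N -> (s ^ k %| n * (y - x))%N.
Proof.
move=> ps sX n0 xy exy x0 hx hy.
have [->|k0] := posnP k; first by rewrite expn0 dvd1n.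
have xn0 : (0 < x ^ n)%N by rewrite expn_gt0 x0.
have sx : ~~ (s %| x)%N.
  apply/negP => d; have d1 : (s %| x ^ n - 1)%N by apply: dvdn_trans hx; rewrite dvdn_exp.
  have d2 : (s %| x ^ n)%N by rewrite dvdn_exp.
  have := dvdn_sub d2 d1; rewrite subKn // dvdn1 => /eqP s1.
  by move: ps; rewrite s1.
have hs : (s ^ k %| y ^ n - x ^ n)%N.
  have -> : (y ^ n - x ^ n = (y ^ n - 1) - (x ^ n - 1))%N.
    by rewrite subnBA // subnK // expn_gt0 (leq_trans x0).
  exact: dvdn_sub.
move: hs; rewrite subn_exp; set Q := (\sum_(i < n) _)%N => hs.
have eQ : Q = n * x ^ n.-1 %[mod n * s].
  have e1 : y = x %[mod n * s].
    have d : (n * s %| n * X`!)%N by rewrite dvdn_pmul2l // dvdn_fact // prime_gt0.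
    by rewrite -(modn_dvdm y d) -exy modn_dvdm.
  have -> : (n * x ^ n.-1 = \sum_(i < n) x ^ n.-1)%N by rewrite sum_nat_const card_ord.
  rewrite /Q.
  rewrite -[LHS]modn_summ -[RHS]modn_summ; congr (_ %% _)%N.
  apply: eq_bigr => i _; rewrite -modnMml -modnXm e1 modnXm modnMml -expnD.
  by congr ((x ^ _) %% _)%N; rewrite subnK // -ltnS (leq_trans (ltn_ord i)) // leqSpred.
have nQ : (n %| Q)%N.
  have : Q = 0 %[mod n].
    have d : (n %| n * s)%N by rewrite dvdn_mulr.
    by rewrite -(modn_dvdm Q d) eQ modn_dvdm // mod0n -modnMml modnn mul0n mod0n.
  by rewrite mod0n => /eqP.
case/dvdnP: nQ => Q' eQ'.
have e2 : Q' = x ^ n.-1 %[mod s].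
  move: eQ; rewrite eQ' mulnC -!muln_modr => /eqP; rewrite eqn_pmul2l // => /eqP //.
have cQ : coprime (s ^ k) Q'.
  rewrite coprimeXl // prime_coprime // /dvdn e2 -/(dvdn s _) Euclid_dvdX //.
  by rewrite negb_and sx.
by move: hs; rewrite eQ' mulnCA Gauss_dvdr // mulnC.
Qed.

Local Open Scope nat_scope.

Lemma leq_expl a b k : a <= b -> a ^ k <= b ^ k.
Proof. by case: k => // k; rewrite leq_exp2r. Qed.

Lemma expn_prod (I : finType) (P : pred I) (F : I -> nat) k :
  (\prod_(i | P i) F i) ^ k = \prod_(i | P i) F i ^ k.
Proof. by apply: (big_morph (fun v => v ^ k)) => [a b|]; rewrite ?expnMn ?exp1n. Qed.

Lemma absz_add_le (a b : int) : `|(a + b)%R| <= `|a| + `|b|.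
Proof. lia. Qed.

Lemma sgS x e : sg x e.+1 = sg x e + x ^ e.+1.
Proof. by rewrite /sg big_ord_recr. Qed.

Lemma sg0 x : sg x 0 = 1.
Proof. by rewrite /sg big_ord1. Qed.

Lemma leq_sg x e : x ^ e <= sg x e.
Proof. by case: e => [|e]; rewrite ?sg0 ?expn0 // sgS leq_addl. Qed.

Lemma sg_lt x e : 1 < x -> sg x e < 2 * x ^ e.
Proof.
move=> x2; elim: e => [|e IH]; first by rewrite sg0.
rewrite sgS expnS; have : 2 * x ^ e <= x * x ^ e by rewrite leq_mul2r x2 orbT.
lia.
Qed.

Lemma sg_mul x e : 0 < x -> x.-1 * sg x e = x ^ e.+1 - 1.
Proof.
move=> x0; rewrite -[in RHS](exp1n e.+1) subn_exp subn1; congr (_ * _).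
rewrite /sg (reindex_inj rev_ord_inj) /=; apply: eq_bigr => i _.
by rewrite exp1n muln1 subSS.
Qed.

Lemma sg_gt0 x e : 0 < sg x e.
Proof. by rewrite /sg big_ord_recl expn0 add1n. Qed.

Lemma smooth_dvd_prod X v : 0 < v -> smooth X v -> v %| \prod_(s < X.+1 | prime s) s ^ logn s v.
Proof.
move=> v0 sv; apply/dvdn_partP => // p; rewrite mem_primes v0 /= => /andP [pp dp].
have hp : p < X.+1 by rewrite ltnS sv.
by rewrite p_part (bigD1 (Ordinal hp)) //= dvdn_mulr.
Qed.

Lemma nderivn_value_bound (P : {poly int}) (d H c x : nat) : 0 < x ->
  (forall i, `|P`_i| <= H%:Z)%R -> size P <= d ->
  (`|(P^`N(c)).[x%:Z]| <= (d * (2 ^ d * H * x ^ d))%N%:Z)%R.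
Proof.
move=> x0 hP sP; rewrite (@horner_coef_wide _ d); last first.
  apply/leq_sizeP => j dj; rewrite coef_nderivn nth_default ?mul0rn //.
  by apply: leq_trans (leq_trans sP dj) _; rewrite leq_addl.
apply: le_trans (ler_norm_sum _ _ _) _.
rewrite -[X in (X * _)%N](card_ord d) -sum_nat_const (big_morph Posz PoszD (erefl 0%R)).
apply: ler_sum => i _; rewrite coef_nderivn normrM PoszM Posz_exp.
apply: ler_pM => //; last by rewrite lez_nat leq_pexp2l // ltnW.
case: (ltnP (c + i) d) => cd; last by rewrite nth_default ?mul0rn ?normr0 // (leq_trans sP).
rewrite -mulr_natr normrM normr_nat natz mulnC PoszM; apply: ler_pM => //.
by rewrite lez_nat (leq_trans (bin_le_exp2 _ _)) // leq_exp2l // ltnW.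
Qed.

Section Pair.
Variables (X e x y : nat).
Hypotheses (e2 : 2 <= e) (eo : ~~ odd e) (hx : 2 ^ (1000 * e ^ 2) <= x) (xy : x <= y).
Hypothesis exy : x = y %[mod e.+1 * X`!].
Hypotheses (smx : smooth X (sg x e)) (smy : smooth X (sg y e)).
Hypothesis kap : forall s, s <= X -> kappa X (sg x e) s = kappa X (sg y e) s.
Hypothesis far : sg x e ^ 256 <= sg y e.
Let Qx := sg x e.
Let Qy := sg y e.
Let mu := trunc_log Qx Qy %/ 16.
Let m := thue_m mu.
Let n := e.+1.

Lemma pair_x2 : 2 <= x.
Proof.
have e0 : 0 < 1000 * e ^ 2 by rewrite muln_gt0 expn_gt0 (ltnW e2).
exact: leq_trans (leq_pexp2l (isT : 0 < 2) e0) hx.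
Qed.

Lemma pair_Qx2 : 2 <= Qx.
Proof.
apply: leq_trans pair_x2 _; apply: leq_trans (leq_sg x e).
by rewrite -[X in X <= _]expn1 leq_pexp2l // ltnW // ?pair_x2.
Qed.

(** [m] is the logarithm of [Qy] to base [Qx], rounded down to a multiple of 16; [far] makes the
    rounding error small compared with it. *)
Lemma pair_mu : [/\ 16 <= mu, Qx ^ m <= Qy & Qy < Qx ^ (m + 16)].
Proof.
have Q2 := pair_Qx2.
have Qy0 : 0 < Qy by rewrite sg_gt0.
have /andP [l1 l2] := trunc_log_bounds Q2 Qy0.
have l3 : 256 <= trunc_log Qx Qy by apply: trunc_log_max.
rewrite /m /thue_m /mu; split; first by rewrite leq_divRL.
- by apply: leq_trans l1; rewrite leq_exp2l // mulnC leq_trunc_div.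
apply: leq_trans l2 _; rewrite leq_exp2l //; lia.
Qed.

Lemma pair_y : y < (2 * x) ^ (m + 16).
Proof.
have [_ _ h] := pair_mu; have x2 := pair_x2.
have e0 : 0 < e by lia.
rewrite -(ltn_exp2r _ _ e0).
apply: leq_ltn_trans (leq_sg y e) _; apply: leq_trans h _.
rewrite -expnM (mulnC (m + 16)) expnM; apply: leq_expl.
apply: leq_trans (ltnW (sg_lt e x2)) _; rewrite expnMn leq_mul2r; apply/orP; right.
by rewrite -[X in X <= _]expn1 leq_exp2l.
Qed.

(** Whichever term is the minimum, [s] contributes its share: through [Qy >= Qx^m] if it is
    [logn s Qy], and through [m - c] copies of its share of [Qx] otherwise. Equality of the [kappa]
    makes both shares the same. *)
Lemma pair_valuation c s : c < m -> prime s -> s <= X ->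
  exists t, Qx ^ ((m - c) * kappa X Qx s) <= s ^ (16 * X.+1 * t) /\
    t = minn (logn s Qy) ((m - c) * minn (logn s Qx) (logn s Qy)).
Proof.
move=> cm ps sX; set u := logn s Qx; set w := logn s Qy.
have Q2 := pair_Qx2; have [mu16 Qm _] := pair_mu.
have Qy2 : 1 < Qy.
  have m0 : 0 < m by rewrite /m /thue_m muln_gt0 /= (leq_trans _ mu16).
  apply: leq_trans (Q2) (leq_trans _ Qm).
  by have := leq_pexp2l (ltnW Q2) m0; rewrite expn1.
eexists; split; last reflexivity.
have s0 k : 0 < s ^ k by rewrite expn_gt0 prime_gt0.
have -> : minn w ((m - c) * minn u w) = minn w ((m - c) * u).
  move: (subn_gt0 c m); rewrite cm; case: (leqP u w) => // /ltnW uw mc.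
  have h1 : w <= (m - c) * w by rewrite leq_pmull.
  have h2 : w <= (m - c) * u by apply: leq_trans h1 _; rewrite leq_mul2l uw orbT.
  by rewrite (minn_idPl h1) (minn_idPl h2).
case: (leqP w ((m - c) * u)) => _.
  rewrite [X in Qx ^ (_ * X)](kap sX) expnM.
  have /andP [h _] := trunc_log_bounds Qy2 (s0 (16 * X.+1 * w)).
  apply: leq_trans h; rewrite -/(kappa X Qy s); apply: leq_expl.
  by apply: leq_trans Qm; rewrite leq_exp2l // leq_subr.
have /andP [h _] := trunc_log_bounds Q2 (s0 (16 * X.+1 * u)).
have -> : 16 * X.+1 * ((m - c) * u) = 16 * X.+1 * u * (m - c) by rewrite mulnA mulnAC.
by rewrite mulnC expnM [X in _ <= X]expnM; apply: leq_expl.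
Qed.

(** Since [Qx] is smooth, the exact shares of its primes sum to 1, that is to [16 (X + 1)] units.
    Rounding loses at most one unit for each of at most [X + 1] primes, so at least the fraction
    15/16 survives. *)
Lemma pair_lower c (P0 P1 : {poly int}) : c <= mu ->
  (forall j, j < m -> exists q, (P0^`N(j) + 'X * P1^`N(j) = geom e 'X * q)%R) ->
  ((P0 + (y%:Z)%:P * P1)^`N(c).[x%:Z] != 0)%R ->
  Qx ^ (15 * (m - c)) <= (n ^ m * `|((P0 + (y%:Z)%:P * P1)^`N(c).[x%:Z])%R|%N) ^ 16.
Proof.
move=> cmu hq nz; set v := (_.[_])%R in nz *.
have [mu16 Qm _] := pair_mu; have Q2 := pair_Qx2; have x2 := pair_x2.
have x0 : 0 < x := ltnW x2.
have y0 : 0 < y := leq_trans x0 xy.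
have cm : c < m by apply: leq_ltn_trans cmu _; rewrite /m /thue_m; move: mu16; clear; move: mu => k; lia.
pose t s := minn (logn s Qy) ((m - c) * minn (logn s Qx) (logn s Qy)).
have V0 : 0 < n ^ m * `|v|%N by rewrite muln_gt0 expn_gt0 absz_gt0.
have dv : \prod_(s < X.+1 | prime s) s ^ t s %| n ^ m * `|v|%N.
  apply: prod_prime_powers_dvd => s ps.
  have [sX|sX] := leqP s X; last first.
    rewrite /t (_ : logn s Qy = 0) ?min0n ?dvd1n //.
    by apply/eqP; rewrite -leqn0 leqNgt logn_gt0 mem_primes ps sg_gt0 /=; apply/negP => /(smy ps); rewrite leqNgt sX.
  have := @thue_divisible e m c (logn s Qy) (minn (logn s Qx) (logn s Qy)) s P0 P1 x y hq (ltnW cm).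
  rewrite -/v geom_Posz !dvdzE !abszM abszX /= distnC (distnEl xy); apply; first exact: pfactor_dvdnn.
  have hg z k : 0 < z -> k <= logn s (sg z e) -> s ^ k %| z ^ n - 1.
    move=> z0 hk; rewrite -sg_mul // dvdn_mull // pfactor_dvdn ?sg_gt0 //.
  by apply: (@congruence_of_roots _ X) => //; apply: hg => //; rewrite ?geq_minl ?geq_minr.
pose K := 16 * X.+1.
have hV : Qx ^ ((m - c) * \sum_(s < X.+1 | prime s) kappa X Qx s) <= (n ^ m * `|v|) ^ K.
  apply: leq_trans (leq_expl K (dvdn_leq V0 dv)).
  rewrite expn_prod big_distrr /= expn_sum; apply: leq_prod => s ps.
  have [t' [h et]] := pair_valuation cm ps (ltn_ord s).
  by rewrite -expnM (mulnC (t s)) (_ : t s = t').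
have hQ : Qx ^ K <= Qx ^ (\sum_(s < X.+1 | prime s) (kappa X Qx s).+1).
  apply: leq_trans (leq_expl K (dvdn_leq _ (smooth_dvd_prod (sg_gt0 x e) smx))) _.
    by apply: prodn_cond_gt0 => s ps; rewrite expn_gt0 prime_gt0.
  rewrite expn_prod expn_sum; apply: leq_prod => s ps.
  have s0 : 0 < s ^ (K * logn s Qx) by rewrite expn_gt0 prime_gt0.
  have /andP [_ /ltnW h] := trunc_log_bounds Q2 s0.
  by rewrite -expnM mulnC.
have hk : 15 * X.+1 <= \sum_(s < X.+1 | prime s) kappa X Qx s.
  move: hQ; rewrite leq_exp2l //.
  have -> : \sum_(s < X.+1 | prime s) (kappa X Qx s).+1 = \sum_(s < X.+1 | prime s) kappa X Qx s + \sum_(s < X.+1 | prime s) 1.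
    by rewrite -big_split; apply: eq_bigr => s _ /=; rewrite addn1.
  have : \sum_(s < X.+1 | prime s) 1 <= X.+1.
    by rewrite sum1_card (leq_trans (max_card _)) // card_ord.
  rewrite /K; move: (\sum_(s < X.+1 | prime s) kappa X Qx s) (\sum_(s < X.+1 | prime s) 1); clear; lia.
rewrite -(leq_exp2r _ _ (ltn0Sn X)) -!expnM; apply: leq_trans hV.
by rewrite leq_exp2l // mulnAC mulnC leq_mul2l hk orbT.
Qed.

Let d0 := thue_d0 e mu.
Let H := thue_H e mu.
Let E := e ^ 2 * mu.

Lemma pair_sizes : [/\ thue_d1 e mu + m = d0, d0 <= 13 * (e * mu) & m + 16 <= 9 * (e * mu)].
Proof.
have [mu16 _ _] := pair_mu; rewrite /d0 /m /thue_d1 /thue_d0 /thue_m.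
move: mu mu16 e2; clear; move=> k h1 h2; split; nia.
Qed.

Lemma leq_double_exp2 k : 2 * k <= 2 ^ k.
Proof. case: k => // k; rewrite expnS leq_mul2l /=; exact: ltn_expl. Qed.

Lemma pair_H : H <= 2 ^ (208 * E).
Proof.
have [h1 h2 _] := pair_sizes.
have h3 : (thue_d0 e mu + thue_d1 e mu) * 2 ^ d0 <= 2 ^ (2 * d0).
  rewrite mul2n -addnn expnD leq_mul2r; apply/orP; right.
  apply: leq_trans (leq_double_exp2 d0); rewrite mul2n -addnn leq_add2l -h1 leq_addr //.
apply: leq_trans (leq_expl (8 * e) h3) _; rewrite -expnM leq_exp2l //.
move: h2; rewrite /E; move: d0 mu e; clear => a b c; nia.
Qed.

Lemma pair_upper c (P0 P1 : {poly int}) :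
  (forall i, `|P0`_i| <= H%:Z)%R -> (forall i, `|P1`_i| <= H%:Z)%R ->
  size P0 <= d0 -> size P1 <= thue_d1 e mu ->
  n ^ m * `|((P0 + (y%:Z)%:P * P1)^`N(c).[x%:Z])%R|%N <= 2 ^ (240 * E) * x ^ (d0 + 16).
Proof.
move=> h0 h1 s0 s1; have [hd1 hd0 hm] := pair_sizes.
have x0 : 0 < x := ltnW pair_x2.
have b0 := nderivn_value_bound c x0 h0 s0; have b1 := nderivn_value_bound c x0 h1 s1.
rewrite nderivnD mul_polyC nderivnZ hornerD hornerZ.
move: b0 b1; set a := (P0^`N(c)).[_]%R; set b := (P1^`N(c)).[_]%R => b0 b1.
have {}b0 : `|a| <= d0 * (2 ^ d0 * H * x ^ d0) by lia.
have {}b1 : `|b| <= thue_d1 e mu * (2 ^ thue_d1 e mu * H * x ^ thue_d1 e mu) by lia.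
have bv : `|(a + y%:Z * b)%R|%N <= `|a| + y * `|b| by rewrite (leq_trans (absz_add_le _ _)) // abszM.
set Z := 2 ^ (m + 16) * x ^ (d0 + 16).
have c0 : `|a| <= d0 * (2 ^ d0 * H) * Z.
  apply: leq_trans b0 _; rewrite mulnA leq_mul2l; apply/orP; right; rewrite /Z.
  apply: leq_trans (_ : x ^ (d0 + 16) <= _); first by rewrite leq_pexp2l // leq_addr.
  by rewrite leq_pmull // expn_gt0.
(* The difference [m] of the degrees compensates for [y < (2 x)^(m + 16)], up to [x^16] and a power
   of 2. *)
have c1 : y * `|b| <= d0 * (2 ^ d0 * H) * Z.
  apply: leq_trans (leq_mul (ltnW pair_y) b1) _.
  rewrite expnMn.
  have dd : thue_d1 e mu <= d0 by rewrite -hd1 leq_addr.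
  have -> : d0 * (2 ^ d0 * H) * Z = 2 ^ (m + 16) * x ^ (m + 16) * (d0 * (2 ^ d0 * H * x ^ thue_d1 e mu)).
    have ex : x ^ (d0 + 16) = x ^ thue_d1 e mu * x ^ (m + 16) by rewrite -expnD addnA hd1.
    by rewrite /Z ex; move: (x ^ thue_d1 e mu) (x ^ (m + 16)) (2 ^ (m + 16)) (2 ^ d0); clear; move=> *; ring.
  apply: leq_mul => //; apply: leq_mul => //; apply: leq_mul => //; apply: leq_mul => //.
  by rewrite leq_exp2l.
apply: leq_trans (leq_mul (leqnn _) (leq_trans bv (leq_add c0 c1))) _.
have -> : n ^ m * (d0 * (2 ^ d0 * H) * Z + d0 * (2 ^ d0 * H) * Z) =
    (n ^ m * (2 * d0) * 2 ^ d0 * H * 2 ^ (m + 16)) * x ^ (d0 + 16).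
  rewrite /Z; move: (n ^ m) (2 ^ d0) (2 ^ (m + 16)) (x ^ _); clear; move=> *; ring.
rewrite leq_mul2r; apply/orP; right.
apply: (@leq_trans (2 ^ (e * m) * 2 ^ d0 * 2 ^ d0 * 2 ^ (208 * E) * 2 ^ (m + 16))).
  apply: leq_mul => //; apply: leq_mul; last exact: pair_H.
  apply: leq_mul => //; apply: leq_mul; last exact: leq_double_exp2.
  rewrite expnM; apply: leq_expl; exact: ltn_expl.
apply: leq_trans (_ : 2 ^ (e * m + d0 + d0 + 208 * E + (m + 16)) <= _); first by rewrite !expnD.
rewrite leq_exp2l //.
have hE : 2 * (e * mu) <= E by rewrite /E; move: mu e2; clear => *; nia.
have he : e * m = 16 * (e * mu) by rewrite /m /thue_m mulnCA.
by move: hd0 hm hE he; move: E (e * mu) (e * m) m d0; clear => *; lia.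
Qed.

Lemma pair_false : False.
Proof.
have [mu16 Qm _] := pair_mu; have Q2 := pair_Qx2; have x2 := pair_x2.
have [hd1 hd0 hm] := pair_sizes.
have mu0 : 0 < mu by apply: leq_trans mu16.
have xE : 2 ^ (1000 * E) <= x ^ mu by rewrite /E mulnA expnM; apply: leq_expl.
have [P0 [P1 [nz [s0 s1] [b0 b1] hq]]] := thue_aux_polys e2 eo mu0.
have W0 := wronskian_neq0 e2 eo mu0 nz s0 s1 hq.
have s1' : size P1 <= d0 by apply: leq_trans s1 _; rewrite -hd1 leq_addr.
have hW : 2 * (d0 * (H * (d0 * H))) < x ^ mu.
  apply: leq_trans xE.
  apply: (@leq_ltn_trans (2 ^ d0 * 2 ^ d0 * 2 ^ (208 * E) * 2 ^ (208 * E))).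
    have -> : 2 * (d0 * (H * (d0 * H))) = 2 * d0 * d0 * H * H by move: d0 H; clear => *; ring.
    do 2! (apply: leq_mul; last exact: pair_H).
    apply: leq_mul; first exact: leq_double_exp2.
    by apply: leq_trans (leq_double_exp2 d0); rewrite leq_pmull.
  rewrite -!expnD ltn_exp2l //.
  move: hd0 e2 mu0; rewrite /E; move: d0 mu e; clear => p q r *; nia.
have [c cmu nzc] := nonvanishing_derivative y%:Z b0 b1 s0 s1' W0 hW.
have hl := pair_lower cmu hq nzc.
have hu := leq_expl 16 (pair_upper c b0 b1 s0 s1).
have := leq_trans hl hu.
(* From [m - c >= 15 mu] and [Qx >= x^e]. The upper bound has exponent [16 d0 + 256 + 4 mu], where
   [16 d0 = (128 e + 144) mu]; this is smaller than [225 e mu] as soon as [e >= 2] and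
   [mu >= 16]. *)
have h1 : x ^ (225 * (e * mu)) <= Qx ^ (15 * (m - c)).
  have -> : 225 * (e * mu) = e * (15 * (15 * mu)) by move: e mu; clear => *; ring.
  rewrite expnM; apply: leq_trans (leq_expl _ (leq_sg x e)) _.
  rewrite leq_exp2l // leq_mul2l /= /m /thue_m; move: cmu; move: mu; clear => *; lia.
have h2 : (2 ^ (240 * E) * x ^ (d0 + 16)) ^ 16 <= x ^ (4 * mu + (d0 + 16) * 16).
  rewrite expnMn -!expnM expnD leq_mul2r; apply/orP; right.
  apply: leq_trans (_ : 2 ^ (1000 * E * 4) <= _).
    rewrite leq_exp2l //; move: E; clear => *; lia.
  rewrite (mulnC 4) [X in _ <= X]expnM expnM; exact: leq_expl.
move/(leq_trans h1)/leq_trans => /(_ _ h2); rewrite leq_exp2l //; apply/negP; rewrite -ltnNge.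
rewrite /d0 /thue_d0; move: mu16 e2; move: mu e; clear => *; nia.
Qed.
End Pair.

(* Otherwise [P0(x) + y P1(x)], or a derivative of it of low order, is a nonzero integer divisible by more than its size
   allows: every prime [s] takes the same share of [sg x e] and of [sg y e], and [x = y] modulo high powers of [s]
   up to the factor [e + 1]. *)
Theorem thue_pair X e x y : 2 <= e -> ~~ odd e -> 2 ^ (1000 * e ^ 2) <= x -> x <= y ->
  x = y %[mod e.+1 * X`!] -> smooth X (sg x e) -> smooth X (sg y e) ->
  (forall s, s <= X -> kappa X (sg x e) s = kappa X (sg y e) s) ->
  sg y e < sg x e ^ 256.
Proof.
move=> e2 eo hx xy exy smx smy kap; rewrite ltnNge; apply/negP => far.
exact: (pair_false e2 eo hx xy exy smx smy kap far).
Qed.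

(** * The divisor sum and its prime factors *)

Local Open Scope nat_scope.

Lemma sg_recl x e : sg x e.+1 = 1 + x * sg x e.
Proof.
rewrite /sg big_ord_recl expn0 big_distrr /=; congr (1 + _).
by apply: eq_bigr => i _; rewrite -expnS.
Qed.

Lemma sum_add_divisors f divs :
  \sum_(d <- PrimeDecompAux.add_divisors f divs) d = sg f.1 f.2 * \sum_(d <- divs) d.
Proof.
case: f => p e; rewrite /PrimeDecompAux.add_divisors /=; elim: e => [|e IH] /=; first by rewrite sg0 mul1n.
rewrite (perm_big _ (permEl (perm_merge _ _ _))) /= big_cat /= big_map.
rewrite (eq_bigr (fun i => p * i)) => [|i _]; last by rewrite NatTrec.mulE.
by rewrite -big_distrr /= IH sg_recl; ring.
Qed.

Lemma sigma_prod n : sigma n = \prod_(p <- primes n) sg p (logn p n).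
Proof.
rewrite /sigma /divisors.
have -> : \prod_(p <- primes n) sg p (logn p n) = \prod_(f <- prime_decomp n) sg f.1 f.2.
  by rewrite prime_decompE big_map.
elim: (prime_decomp n) => [|f s IH] /=; first by rewrite big_nil big_seq1.
by rewrite sum_add_divisors IH big_cons.
Qed.

Lemma sg_dvd_sigma n p : p \in primes n -> sg p (logn p n) %| sigma n.
Proof. by move=> pn; rewrite sigma_prod (big_rem p) //= dvdn_mulr. Qed.

Lemma prod_primes n : 0 < n -> n = \prod_(p <- primes n) p ^ logn p n.
Proof. by move=> n0; rewrite [LHS]prod_prime_decomp // prime_decompE big_map. Qed.

Lemma sigma_gt0 n : 0 < sigma n.
Proof. by rewrite sigma_prod prodn_gt0 // => p; rewrite sg_gt0. Qed.

Lemma sg_mod q y e : y = 1 %[mod q] -> sg y e = e.+1 %[mod q].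
Proof.
move=> yq; have -> : e.+1 = \sum_(i < e.+1) 1 by rewrite sum_nat_const card_ord muln1.
rewrite /sg -[LHS]modn_summ -[RHS]modn_summ; congr (_ %% _); apply: eq_bigr => i _.
by rewrite -modnXm yq modnXm exp1n.
Qed.

(** Lifting the exponent. The congruence modulo [q^2] instead of [q] removes the exception [q = 2]:
    the sum [1 + y + ... + y^(q-1)] is then [q] modulo [q^2], so exactly one factor [q] is
    gained. *)
Lemma logn_expn_sub1 q y n : prime q -> 1 < y -> y = 1 %[mod q ^ 2] -> 0 < n ->
  logn q (y ^ n - 1) = logn q y.-1 + logn q n.
Proof.
move=> pq y1 yq; have [s] := ubnP n; elim: s => // s IH in y y1 yq n * => /ltnSE ns n0.
have y0 : 0 < y.-1 by rewrite -subn1 subn_gt0.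
have [qn|qn] := boolP (q %| n).
  have q1 := prime_gt1 pq.
  case/dvdnP: qn => r er; rewrite er.
  have r0 : 0 < r by move: n0; rewrite er; case: (r).
  have yqy : y ^ q = y.-1 * sg y q.-1 + 1.
    by rewrite sg_mul ?(ltnW y1) // prednK ?prime_gt0 // subnK // expn_gt0 ltnW.
  rewrite mulnC expnM IH //; last 2 first.
  - by rewrite -modnXm yq modnXm exp1n.
  - by apply: leq_trans ns; rewrite er -[X in X < _]muln1 ltn_pmul2l.
  - have -> : (y ^ q).-1 = y.-1 * sg y q.-1 by rewrite yqy addn1.
    rewrite (lognM _ y0 (sg_gt0 _ _)) (lognM _ (prime_gt0 pq) r0) (logn_prime q pq) eqxx addnA; congr (_ + _ + _).
    have sq := sg_mod q.-1 yq; rewrite prednK ?prime_gt0 // in sq.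
    have qs : q %| sg y q.-1.
      have d : q %| q ^ 2 by rewrite dvdn_exp.
      by rewrite /dvdn -(modn_dvdm _ d) sq modn_dvdm // modnn.
    have nqs : ~~ (q ^ 2 %| sg y q.-1).
      rewrite /dvdn sq -/(dvdn _ _); apply/negP => /dvdn_leq; rewrite prime_gt0 // => /(_ isT).
      by rewrite leqNgt -[X in X < _]expn1 ltn_exp2l.
    apply/eqP; rewrite eqn_leq; apply/andP; split.
      by rewrite leqNgt -pfactor_dvdn // sg_gt0.
    by rewrite -pfactor_dvdn ?sg_gt0.
  - by rewrite -[X in X < _](expn0 y) ltn_exp2l // prime_gt0.
rewrite -{1}(prednK n0) -sg_mul ?(ltnW y1) // lognM ?sg_gt0 //; congr (_ + _).
have d : q %| q ^ 2 by rewrite dvdn_exp.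
have yq1 : y = 1 %[mod q] by rewrite -(modn_dvdm y d) yq modn_dvdm.
have := sg_mod n.-1 yq1; rewrite prednK // => sn.
rewrite !logn_coprime // prime_coprime // /dvdn sn -/(dvdn _ _) //.
Qed.

Definition lte_bound X := 2 * X`! ^ 2 + 4.

(* [x ^ (X! ^ 2)] is 1 modulo the square of every prime up to [X], so the valuations of [x ^ (e+1) - 1] are at most
   those of [(x ^ (X! ^ 2) - 1) * (e + 1)]. *)
Lemma sg_smooth_exponent X x e : 1 < x -> smooth X (sg x e) -> e <= lte_bound X.
Proof.
move=> x1 sm; set O := X`! ^ 2.
have O0 : 0 < O by rewrite expn_gt0 fact_gt0.
have y1 : 1 < x ^ O by rewrite -[X in X < _](exp1n O) ltn_exp2r.
have x0 := ltnW x1.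
have y0 : 0 < (x ^ O).-1 by rewrite -subn1 subn_gt0.
have h : sg x e %| (x ^ O).-1 * e.+1.
  apply/dvdn_partP => [|q]; rewrite ?sg_gt0 // mem_primes sg_gt0 /= => /andP [pq dq].
  rewrite p_part pfactor_dvdn ?muln_gt0 ?y0 // lognM // -logn_expn_sub1 //; last first.
    have cq : coprime x (q ^ 2).
      rewrite coprime_sym coprimeXl // prime_coprime //; apply/negP => qx.
      have d1 : q %| x ^ e.+1 - 1 by rewrite -sg_mul // dvdn_mull.
      have d2 : q %| x ^ e.+1 by rewrite dvdn_exp.
      have := dvdn_sub d2 d1; rewrite subKn ?expn_gt0 ?x0 // dvdn1 => /eqP q1.
      by move: pq; rewrite q1.
    have : totient (q ^ 2) %| O.
      rewrite totient_pfactor // expn1 /O expnS expn1 dvdn_mul //.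
        by rewrite dvdn_fact // -subn1 subn_gt0 prime_gt1 //= (leq_trans (leq_subr _ _)) // sm.
      by rewrite dvdn_fact // prime_gt0 // sm.
    case/dvdnP => w ->; rewrite mulnC expnM -modnXm Euler_exp_totient // modnXm exp1n //.
  apply: dvdn_leq_log => //.
    rewrite subn_gt0 -[X in X < _](exp1n e.+1) ltn_exp2r //.
  rewrite -expnM mulnC expnM.
  have -> : (x ^ e.+1) ^ O - 1 = (x ^ e.+1 - 1) * sg (x ^ e.+1) O.-1.
    by rewrite (subn1 (x ^ e.+1)) sg_mul ?expn_gt0 ?x0 // prednK.
  by rewrite dvdn_mulr // -sg_mul // dvdn_mull.
have h1 : x ^ e <= x ^ O * e.+1.
  apply: leq_trans (leq_sg x e) (leq_trans (dvdn_leq _ h) _); first by rewrite muln_gt0 y0.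
  by rewrite leq_mul2r leq_pred orbT.
(* Dividing by [x^O] leaves [2^(e - O) <= e + 1], which fails once [e - O >= e / 2 + 2]. *)
rewrite /lte_bound -/O leqNgt; apply/negP => eO.
have h2 : x ^ (e - O) <= e.+1.
  rewrite -(leq_pmul2l (_ : 0 < x ^ O)) ?expn_gt0 ?x0 // -expnD subnKC //.
  by move: eO; clear; lia.
have h3 : 2 ^ (e - O) <= e.+1 by apply: leq_trans (leq_expl _ x1) h2.
have h4 : 2 ^ (e %/ 2 + 2) <= e.+1.
  apply: leq_trans h3; rewrite leq_exp2l //; move: eO; clear; lia.
have := ltn_expl (e %/ 2) (ltnSn 1).
move: h4; rewrite expnD; move: (2 ^ (e %/ 2)) => z; clear; lia.
Qed.

(** * Short integer relations *)

Local Open Scope nat_scope.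

Lemma absz_sum_le (F : nat -> int) (B m n : nat) :
  (forall i, m <= i < n -> `|F i| <= B) -> `|(\sum_(m <= i < n) F i)%R| <= (n - m) * B.
Proof.
elim: n => [|n IH] h; first by rewrite big_geq.
have [mn|nm] := leqP m n; last by rewrite big_geq.
rewrite big_nat_recr //= subSn // mulSn addnC; apply: leq_trans (absz_add_le _ _) _.
by apply: leq_add; [apply: IH => i /andP [mi ni]; rewrite h // mi leqW | rewrite h // mn ltnSn].
Qed.

(** One elimination step replaces entries at most [V] by minors at most [2 V^2]; pulling the
    relation back costs the factor in front. *)
Fixpoint relation_bound (K V : nat) : nat :=
  if K is K'.+1 then K'.+2 * V * relation_bound K' (2 * V ^ 2) else 1.

Lemma relation_bound_homo K V W : V <= W -> relation_bound K V <= relation_bound K W.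
Proof.
elim: K V W => // K IH V W VW /=; apply: leq_mul; first by rewrite leq_mul2l VW orbT.
by apply: IH; rewrite leq_mul2l leq_exp2r.
Qed.

Lemma relation_bound_step K V : 0 < V ->
  relation_bound K (2 * V ^ 2) * V <= relation_bound K.+1 V.
Proof. by move=> V0 /=; rewrite mulnC leq_mul2r leq_pmull ?orbT. Qed.

Lemma relation_bound_le K V : 0 < V -> relation_bound K V <= relation_bound K.+1 V.
Proof.
move=> V0; have h : V <= 2 * V ^ 2 by rewrite expnS expn1 mulnA leq_pmull // muln_gt0 V0.
apply: leq_trans (relation_bound_step K V0); apply: leq_trans (relation_bound_homo K h) _.
by rewrite leq_pmulr.
Qed.

(* The coefficients are bounded in terms of the last vector that occurs, not of the longest one: this is what
   elimination gives and the box principle does not. *)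
Lemma short_relation K (v : nat -> nat -> int) (V : nat -> nat) :
  {homo V : i j / i <= j} -> (forall i, 0 < V i) ->
  (forall i j, i <= K -> j < K -> `|v i j| <= V i) ->
  exists t c, [/\ t <= K, (c t != 0 :> int)%R, forall i, i <= t -> `|c i| <= relation_bound K (V t)
    & forall j, j < K -> (\sum_(0 <= i < t.+1) c i * v i j = 0)%R].
Proof.
elim: K v V => [|K IH] v V hV V0 hv; first by exists 0, (fun _ => 1%R).
have [/hasP [p0 p0K nz0]|/hasPn all0] := boolP (has (fun i => v i K != 0%R) (iota 0 K.+2)); last first.
  have [//|//|i j iK jK|t [c [tK ct hc hs]]] := IH v V.
    by apply: hv; apply: leqW.
  exists t, c; split=> //; first exact: leqW.
    by move=> i it; apply: leq_trans (hc i it) (relation_bound_le _ _).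
  move=> j; rewrite ltnS leq_eqVlt => /orP [/eqP ->|]; last exact: hs.
  rewrite big_nat big1 // => i /andP [_ it].
  have /all0 : i \in iota 0 K.+2 by rewrite mem_iota; move: it tK; clear; lia.
  by rewrite negbK => /eqP ->; rewrite mulr0.
have ex : exists p, (p <= K.+1) && (v p K != 0%R).
  by exists p0; rewrite nz0 andbT; move: p0K; rewrite mem_iota; clear; lia.
(* The first vector with nonzero last coordinate is the pivot: earlier vectors stay as they are and
   later ones are only combined with an earlier one, so the bounds keep following the index. *)
case: (ex_minnP ex) => p /andP [pK nz] pmin {p0 p0K nz0 ex}.
have v0 i : i < p -> v i K = 0%R.
  move=> ip; apply/eqP; move: ip; apply: contraTT => h; rewrite -leqNgt; case: (leqP i K.+1) => iK.
    by apply: pmin; rewrite iK h.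
  exact: leq_trans pK (ltnW iK).
have vp0 : 0 < `|v p K| by rewrite absz_gt0.
pose w (i j : nat) := (if (i < p)%N then v i j else v p K * v i.+1 j - v i.+1 K * v p j)%R.
pose W i := if i < p then V i else 2 * V i.+1 ^ 2.
have VW i : V i <= 2 * V i.+1 ^ 2.
  apply: leq_trans (hV _ _ (leqnSn i)) _.
  by rewrite expnS expn1 mulnA leq_pmull // muln_gt0 V0.
have [i j ij|i|i j iK jK|t [c [tK ct hc hs]]] := IH w W.
- rewrite /W; case: (ltnP j p) => jp; first by rewrite (leq_ltn_trans ij jp) hV.
  case: ltnP => ip; first by apply: leq_trans (hV _ _ ij) (VW j).
  by rewrite leq_mul2l leq_exp2r // hV.
- by rewrite /W; case: ifP => _; rewrite ?V0 // muln_gt0 expn_gt0 V0.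
- rewrite /w /W; case: ltnP => ip; first by apply: hv; rewrite ltnW.
  have b1 : `|v p K| <= V i.+1 by apply: leq_trans (hv p K pK (ltnSn K)) (hV _ _ (leqW ip)).
  have b2 : `|v p j| <= V i.+1.
    by apply: leq_trans (hv p j pK _) (hV _ _ (leqW ip)); apply: ltnW.
  have b3 : `|v i.+1 K| <= V i.+1 by apply: hv.
  have b4 : `|v i.+1 j| <= V i.+1 by apply: hv => //; apply: ltnW.
  rewrite mul2n -addnn; apply: leq_trans (_ : `|(v p K * v i.+1 j)%R| + `|(v i.+1 K * v p j)%R| <= _).
    move: (v p K * _)%R (v i.+1 K * _)%R; clear; lia.
  by rewrite !abszM expnS expn1 leq_add // leq_mul.
have rb1 V' : 0 < V' -> relation_bound K V' <= relation_bound K.+1 V' by apply: relation_bound_le.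
have [tp|pt] := ltnP t p.
  exists t, c; split=> //; first exact: leqW.
    by move=> i it; apply: leq_trans (hc i it) _; rewrite /W tp; apply: rb1.
  move=> j; rewrite ltnS leq_eqVlt => /orP [/eqP ->|jK].
    by rewrite big_nat big1 // => i /andP [_ it]; rewrite v0 ?mulr0 //; apply: leq_trans it tp.
  rewrite -[RHS](hs j jK); apply: eq_big_nat => i /andP [_ it].
  by rewrite /w (leq_trans it tp).
have WE : W t = 2 * V t.+1 ^ 2 by rewrite /W ltnNge pt.
(* The family [w] skips the index [p]; pulled back, the relation gives the pivot the coefficient
   that collects its share in all later vectors. *)
pose c' (i : nat) := (if (i < p)%N then c i else if i == p :> nat then - \sum_(p <= l < t.+1) c l * v l.+1 K else c i.-1 * v p K)%R.
exists t.+1, c'; split; first by [].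
- by rewrite /c' ltnNge (leq_trans pt (leqnSn t)) /= gtn_eqF ?ltnS // mulf_neq0.
- move=> i it; apply: leq_trans (_ : K.+2 * V t.+1 * relation_bound K (W t) <= _); last by rewrite WE.
  have big : relation_bound K (W t) <= K.+2 * V t.+1 * relation_bound K (W t).
    by rewrite leq_pmull // muln_gt0 V0.
  have big2 : relation_bound K (W t) * V t.+1 <= K.+2 * V t.+1 * relation_bound K (W t).
    by rewrite -mulnA (mulnC (V _)) leq_pmull.
  rewrite /c'; case: ltnP => ip; first by apply: leq_trans big; apply: hc; apply: ltnW; apply: leq_trans pt.
  case: eqP => [_|/eqP ne].
    rewrite abszN; apply: leq_trans (absz_sum_le (B := relation_bound K (W t) * V t.+1) _) _.
      move=> l /andP [pl lt]; rewrite abszM; apply: leq_mul; first exact: hc.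
      by apply: leq_trans (hv l.+1 K (leq_trans lt (tK : t < K.+1)) (ltnSn K)) (hV _ _ lt).
    rewrite -[K.+2 * _ * _]mulnA (mulnC (V _)) leq_mul2r; apply/orP; right.
    by move: tK; clear; lia.
  rewrite abszM; apply: leq_trans big2; apply: leq_mul.
    apply: hc; rewrite -ltnS prednK //; apply: leq_ltn_trans (leq0n p) _; rewrite ltn_neqAle ip eq_sym ne //.
  apply: leq_trans (hv p K pK (ltnSn K)) _; apply: hV; exact: leqW.
move=> j jK.
have split3 (F : nat -> int) : (\sum_(0 <= i < t.+2) F i = \sum_(0 <= i < p) F i + (F p + \sum_(p <= i < t.+1) F i.+1))%R.
  rewrite (@big_cat_nat _ _ _ p) //=; last by apply: leqW; apply: leqW.
  by congr (_ + _)%R; rewrite big_ltn ?ltnS ?(leqW pt) // big_add1.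
rewrite split3; have -> : c' p = (- \sum_(p <= l < t.+1) c l * v l.+1 K)%R by rewrite /c' ltnn eqxx.
have e1 : (\sum_(0 <= i < p) c' i * v i j = \sum_(0 <= i < p) c i * v i j)%R.
  by apply: eq_big_nat => i /andP [_ ip]; rewrite /c' ip.
have e2 : (\sum_(p <= i < t.+1) c' i.+1 * v i.+1 j = \sum_(p <= i < t.+1) c i * v p K * v i.+1 j)%R.
  by apply: eq_big_nat => i /andP [ip _]; rewrite /c' ltnNge (leqW ip) /= gtn_eqF ?ltnS.
rewrite e1 e2 mulNr mulr_suml -sumrN -big_split /=.
move: jK; rewrite ltnS leq_eqVlt => /orP [/eqP jE|jK].
  rewrite jE big_nat big1 => [|i /andP [_ ip]]; last by rewrite v0 ?mulr0.
  by rewrite add0r big1 // => i _; ring.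
rewrite -[RHS](hs j jK) (@big_cat_nat _ _ _ p 0 t.+1) //=; last exact: leqW.
congr (_ + _)%R.
  by apply: eq_big_nat => i /andP [_ ip]; rewrite /w ip.
apply: eq_big_nat => i /andP [ip _]; rewrite /w ltnNge ip /=; ring.
Qed.

(** * Prime powers with large exponent *)

Local Open Scope ring_scope.

Lemma leq_half_exp2 y : (6 <= y)%N -> (y.+1 <= 2 ^ (y %/ 2))%N.
Proof.
move=> y6; have e : y = ((y %/ 2 - 3) * 2 + 6 + y %% 2)%N by lia.
have r2 : (y %% 2 < 2)%N by rewrite ltn_mod.
have -> : (y %/ 2 = (y %/ 2 - 3) + 3)%N by lia.
move: e r2; move: (y %/ 2 - 3)%N (y %% 2)%N => z r -> r2 {y y6}.
by elim: z => [|z IH]; [move: r2; case: r => [|[]] | rewrite addSn expnS; lia].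
Qed.

(** The part of the exponent of [baker_threshold] that depends neither on [s] nor on [al]. *)
Definition sep_offset (m C : nat) : nat :=
  4 * m * (8 * baker_exponent m * C + 1 + m) + (m ^ 2 + 64 * m.+1) * m.
Definition baker_sep (m C : nat) : nat := 8 * baker_exponent m * (2 * (sep_offset m C + m) + 6).

(** With [y = s / (8 E)] the coefficient size [C * s] is linear in [y] and absorbed by [2^(y/2)];
    the other half of [2^y] takes the terms in [al] and the constants. *)
Lemma baker_threshold_sep m C s al : (0 < m)%N -> (baker_sep m C * al.+1 <= s)%N ->
  exists2 y, (baker_threshold m (2 ^ al) (C * s) y <= 2 ^ y)%N & (baker_exponent m * y <= s %/ 8)%N.
Proof.
move=> m0 hs; set E := baker_exponent m in hs *; set c := sep_offset m C.
have E0 : (0 < E)%N by rewrite /E /baker_exponent; lia.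
exists (s %/ (8 * E))%N; last first.
  by rewrite divnMA mulnC leq_trunc_div.
set y := (s %/ (8 * E))%N.
have sy : (s <= 8 * E * y.+1)%N by rewrite ltnW // mulnC /y ltn_ceil // muln_gt0 E0.
have y1 : (2 * (c + al * m) + 6 <= y)%N.
  rewrite /y leq_divRL; last by rewrite muln_gt0.
  apply: (leq_trans _ hs); rewrite /baker_sep -/E -/c [X in (X <= _)%N]mulnC -[X in (_ <= X)%N]mulnA.
  rewrite leq_mul2l; apply/orP; right; clear; nia.
have h1 : (y.+1 <= 2 ^ (y %/ 2))%N by apply: leq_half_exp2; move: y1; clear; lia.
have h2 : (2 * (2 * m * ((C * s).+1 + m * y)) <= 4 * m * (8 * E * C + 1 + m) * y.+1)%N.
  have : (C * s <= C * (8 * E * y.+1))%N by rewrite leq_mul2l sy orbT.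
  move: (C * s)%N => w; clear; nia.
have h3 : (4 * m * (8 * E * C + 1 + m) <= 2 ^ (4 * m * (8 * E * C + 1 + m)))%N by apply: ltnW; apply: ltn_expl.
have h4 : ((2 ^ m ^ 2 * (64 * m.+1 * 2 ^ al)) ^ m <= 2 ^ ((m ^ 2 + 64 * m.+1) * m) * 2 ^ (al * m))%N.
  rewrite -expnD -mulnDl expnM; apply: leq_expl.
  have h5 : (64 * m.+1 <= 2 ^ (64 * m.+1))%N by apply: ltnW; apply: ltn_expl.
  rewrite !expnD mulnA leq_mul2r leq_mul2l; apply/orP; right; apply/orP; right.
  by [].
rewrite /baker_threshold; apply: leq_trans (leq_mul h2 h4) _.
apply: leq_trans (leq_mul (leq_mul h3 h1) (leqnn _)) _.
rewrite -!expnD leq_exp2l //; move: y1; rewrite /c /sep_offset -/E; clear; lia.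
Qed.

Section LogForms.
Variable R : realType.

Lemma logform_perm n (alpha : 'I_n.+1 -> nat) (b : 'I_n.+1 -> int) (s : {perm 'I_n.+1}) :
  logform R (alpha \o s) (b \o s) = logform R alpha b.
Proof. by rewrite /logform [RHS](reindex_inj (@perm_inj _ s)). Qed.

(** The scale used below: [s] is about the logarithm of an exponent [e], so [2^(s/8)] is about
    [e^(1/8)], whereas the forms have size about [2^-(2^s)]. A transposition brings a nonzero
    coefficient to index 0. *)
Lemma baker_separated n (alpha : 'I_n.+1 -> nat) (b : 'I_n.+1 -> int) C s al :
  (forall i, 0 < alpha i)%N -> (forall i, alpha i <= 2 ^ (2 ^ al))%N ->
  (forall i, `|b i| <= 2 ^ (C * s))%N -> (baker_sep n.+1 C * al.+1 <= s)%N ->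
  logform R alpha b != 0 -> 1 <= `|logform R alpha b| * 2 ^+ (2 ^ (s %/ 8)).
Proof.
move=> a0 ha hb hs nz.
have [i bi] : exists i, b i != 0.
  apply/existsP; apply: contraNT nz; rewrite negb_exists => /forallP h.
  by rewrite /logform big1 // => i _; have := h i; rewrite negbK => /eqP ->; rewrite mul0r.
have [y hy1 hy2] := baker_threshold_sep (ltn0Sn n) hs.
pose p := tperm ord0 i.
rewrite -(logform_perm alpha b p) in nz *.
have := @baker R n (alpha \o p) (b \o p) (2 ^ al) (C * s) y _ _ _ _ _ hy1 nz.
move=> h; have {h} h : 1 <= `|logform R (alpha \o p) (b \o p)| * 2 ^+ (2 ^ (baker_exponent n.+1 * y)).
  apply: h => //=; first by move=> j; rewrite -abszE lez_nat.
  - by rewrite tpermL.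
  - by rewrite expn_gt0.
apply: (le_trans h); apply: ler_wpM2l => //.
by rewrite ler_weXn2l ?ler1n // leq_exp2l.
Qed.

Lemma prod_log_valuation (I : Type) (r : seq I) (F : I -> nat) (c : I -> nat) q :
  (forall i, 0 < F i)%N -> prime q ->
  [/\ (0 < \prod_(i <- r) F i ^ c i)%N,
      ln (\prod_(i <- r) F i ^ c i)%N%:R = \sum_(i <- r) (c i)%:R * ln (F i)%:R :> R
    & logn q (\prod_(i <- r) F i ^ c i)%N = (\sum_(i <- r) c i * logn q (F i))%N].
Proof.
move=> F0 pq; elim: r => [|i r [p0 e1 e2]]; first by rewrite !big_nil ln1 logn1.
have Fc : (0 < F i ^ c i)%N by rewrite expn_gt0 F0.
rewrite !big_cons muln_gt0 Fc p0; split=> //.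
  by rewrite natrM lnM ?posrE ?ltr0n // e1 natrX lnXn ?ltr0n // mulr_natl.
by rewrite lognM // e2 lognX.
Qed.

Lemma logform0_valuation n (alpha : 'I_n.+1 -> nat) (b : 'I_n.+1 -> int) q :
  (forall i, 0 < alpha i)%N -> prime q -> logform R alpha b = 0 ->
  \sum_i b i * (logn q (alpha i))%:Z = 0.
Proof.
(* Adding [B] to every exponent clears the negative ones and turns the vanishing form into an
   equality of two integers, whose valuations can be compared. *)
move=> a0 pq L0; pose B := (\sum_i `|b i|)%N.
pose c i := `|(b i + B%:Z)%R|%N.
have bB i : (`|b i| <= B)%N by rewrite /B (bigD1 i) //= leq_addr.
have aux (x : int) (y : nat) : (`|x| <= y)%N -> `|(x + y%:Z)%R|%N%:Z = x + y%:Z by clear; lia.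
have cE i : (c i)%:Z = b i + B%:Z by rewrite /c; apply: (aux _ _ (bB i)).
have [p0 e1 e2] := prod_log_valuation (index_enum 'I_n.+1) c a0 pq.
have [p0' e1' e2'] := prod_log_valuation (index_enum 'I_n.+1) (fun=> B) a0 pq.
have : (\prod_(i < n.+1) alpha i ^ c i = \prod_(i < n.+1) alpha i ^ B)%N.
  apply/eqP; rewrite -(eqr_nat R); apply/eqP; apply: ln_inj; rewrite ?posrE ?ltr0n //.
  have hsum : \sum_(i < n.+1) (c i)%:R * ln (alpha i)%:R =
      logform R alpha b + \sum_(i < n.+1) B%:R * ln (alpha i)%:R :> R.
    rewrite /logform -big_split /=; apply: eq_bigr => i _.
    by rewrite -mulrDl -[B%:R]/((B%:Z)%:~R) -[(c i)%:R]/((c i)%:Z%:~R) cE intrD.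
  by rewrite e1 e1' hsum L0 add0r.
move/(congr1 (logn q)); rewrite e2 e2' => /(congr1 Posz).
rewrite !(big_morph Posz PoszD (erefl 0%:Z)) => h.
have : \sum_i (b i + B%:Z) * (logn q (alpha i))%:Z = \sum_(i < n.+1) B%:Z * (logn q (alpha i))%:Z.
  rewrite -[RHS](eq_bigr _ (fun i _ => PoszM B (logn q (alpha i)))) -h.
  by apply: eq_bigr => i _; rewrite PoszM cE.
rewrite (eq_bigr _ (fun i _ => mulrDl _ _ _)) big_split /= => /eqP.
by rewrite -[X in _ == X]add0r => /eqP/addIr.
Qed.

Lemma unit_ln (Sl : seq nat) N : uniq Sl -> (forall p, p \in Sl -> prime p) -> (0 < N)%N ->
  (forall p, prime p -> (p %| N)%N -> p \in Sl) ->
  ln N%:R = \sum_(0 <= j < size Sl) (logn (nth 0%N Sl j) N)%:R * ln (nth 0%N Sl j)%:R :> R.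
Proof.
move=> uS pS N0 hN.
have e : N = (\prod_(p <- Sl) p ^ logn p N)%N.
  rewrite {1}(prod_prime_decomp N0) prime_decompE big_map /=.
  rewrite [RHS](bigID (fun p => p %| N)%N) /= [X in _ = (_ * X)%N]big1_seq ?muln1; last first.
    move=> p /andP [pN /pS pp]; rewrite logn_coprime ?expn0 // prime_coprime //.
  rewrite -[RHS]big_filter; apply: perm_big; apply: uniq_perm; rewrite ?primes_uniq ?filter_uniq // => p.
  rewrite mem_primes mem_filter N0 /=; apply/andP/andP => [[pp pN]|[pN /pS pp]]; split=> //.
  exact: hN.
rewrite -(big_nth 0%N xpredT (fun p => (logn p N)%:R * ln p%:R)) [in LHS]e.
have F0 p : (0 < maxn 1 p)%N by rewrite leq_max.
have [_ h _] := prod_log_valuation Sl (logn^~ N) F0 (isT : prime 2).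
have E : {in Sl, forall p, maxn 1 p = p} by move=> p /pS pp; apply/maxn_idPr; apply: prime_gt0.
rewrite (eq_big_seq (fun p => maxn 1 p ^ logn p N)%N) => [|p /E -> //].
by rewrite h; apply: eq_big_seq => p /E ->.
Qed.

Lemma ln1B_bounds (x : R) : 0 < x -> x <= 1 / 2 -> 0 < - ln (1 - x) <= 2 * x.
Proof.
move=> x0 x1; have h : 0 < 1 - x by lra.
apply/andP; split.
  have : ln (1 + (- x)) <= - x by apply: le_ln1Dx; lra.
  lra.
rewrite -lnV ?posrE //.
have e : (1 - x)^-1 = 1 + x / (1 - x) by field; lra.
have h2 : x / (1 - x) <= 2 * x by rewrite ler_pdivrMr //; nra.
have h3 : 0 <= x / (1 - x) by rewrite divr_ge0 // ltW.
by rewrite e; apply: (le_trans (le_ln1Dx _)) => //; lra.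
Qed.

Definition sg_defect (l e : nat) : R := - ln (1 - l%:R^-1 ^+ e.+1).

Lemma sg_defect_bounds l e : (1 < l)%N -> 0 < sg_defect l e <= 2 * (2^-1) ^+ e.+1.
Proof.
move=> l1; have l0 : 0 < l%:R :> R by rewrite ltr0n ltnW.
have i0 : 0 < l%:R^-1 :> R by rewrite invr_gt0.
have i2 : l%:R^-1 <= 2^-1 :> R by rewrite lef_pV2 ?posrE // ler_nat.
have x0 : 0 < l%:R^-1 ^+ e.+1 :> R by rewrite exprn_gt0.
have x1 : l%:R^-1 ^+ e.+1 <= (2^-1) ^+ e.+1 :> R by apply: lerXn2r; rewrite ?nnegrE ?(ltW i0) ?invr_ge0.
have x2 : (2^-1) ^+ e.+1 <= 1 / 2 :> R.
  rewrite exprS div1r -[leRHS]mulr1; apply: ler_wpM2l; first by rewrite invr_ge0.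
  by apply: exprn_ile1; rewrite ?invr_ge0 ?invf_le1 ?ler1n.
have /andP [h1 h2] := ln1B_bounds x0 (le_trans x1 x2).
by rewrite /sg_defect h1 /=; apply: (le_trans h2); apply: ler_wpM2l.
Qed.

Lemma ln_sg l e : (1 < l)%N ->
  ln (sg l e)%:R = e.+1%:R * ln l%:R - ln (l.-1)%:R - sg_defect l e :> R.
Proof.
move=> l1; have l0 : 0 < l%:R :> R by rewrite ltr0n ltnW.
have lp : (0 < l.-1)%N by rewrite -subn1 subn_gt0.
have x0 : 0 < 1 - l%:R^-1 ^+ e.+1 :> R.
  by rewrite subr_gt0 exprn_ilt1 // ?invr_ge0 ?ltW // invf_lt1 // ltr1n.
have h : (l.-1)%:R * (sg l e)%:R = l%:R ^+ e.+1 * (1 - l%:R^-1 ^+ e.+1) :> R.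
  rewrite -natrM sg_mul ?(ltnW l1) // natrB ?expn_gt0 ?(ltnW l1) // natrX.
  by rewrite exprVn mulrBr mulr1 divff // expf_neq0 // gt_eqF.
have := congr1 (@ln R) h; rewrite !lnM ?posrE ?ltr0n ?sg_gt0 ?exprn_gt0 // lnXn // => h'.
by rewrite /sg_defect opprK mulr_natl -addrA addrCA -h' addrA addNr add0r.
Qed.
End LogForms.

Lemma relation_bound_exp2 K x : (relation_bound K (2 ^ x) <= 2 ^ (4 ^ K * (x + K + 1)))%N.
Proof.
elim: K x => [|K IH] x; first by rewrite expn_gt0.
rewrite /= -expnM -expnS; apply: leq_trans (leq_mul (leq_mul (ltnW (ltn_expl K.+2 (ltnSn 1))) (leqnn _)) (IH _)) _.
rewrite -!expnD leq_exp2l // expnS.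
have : (0 < 4 ^ K)%N by rewrite expn_gt0.
move: (4 ^ K)%N; clear; nia.
Qed.

Lemma exp2_dominates C s : (2 * C + 16 <= s)%N -> (C * s + C + 4 + 2 ^ (s %/ 8) < 2 ^ s)%N.
Proof.
move=> h.
have h1 : (C < 2 ^ C)%N := ltn_expl C (ltnSn 1).
have h2 : (s.+1 <= 2 ^ (s %/ 2))%N by apply: leq_half_exp2; move: h; clear; lia.
have h3 : (C.+1 * s.+1 <= 2 ^ (s - 8))%N.
  apply: leq_trans (leq_mul h1 h2) _; rewrite -expnD leq_exp2l //; move: h; clear; lia.
have h4 : (2 ^ (s %/ 8) <= 2 ^ (s - 8))%N by rewrite leq_exp2l //; move: h; clear; lia.
have h5 : (2 ^ s = 2 ^ (s - 8) * 256)%N by rewrite -(expnD 2 _ 8) subnK //; move: h; clear; lia.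
rewrite h5; move: h3 h4 h; move: (2 ^ (s - 8))%N (2 ^ (s %/ 8))%N; clear; nia.
Qed.

Lemma leq_baker_sep m C : (0 < m)%N -> (2 * C + 16 <= baker_sep m C)%N.
Proof.
move=> m0; rewrite /baker_sep /sep_offset.
have : (15 <= baker_exponent m)%N by rewrite /baker_exponent; lia.
move: (baker_exponent m) => E hE.
have h : (C <= 4 * m * (8 * E * C + 1 + m))%N.
  by apply: (@leq_trans (8 * E * C + 1 + m)); [nia | rewrite leq_pmull // muln_gt0].
move: (4 * m * _)%N ((_ + _) * m)%N h => u v h; nia.
Qed.

Section Steps.
Variable R : realType.

Lemma tiny_form_absurd (x : R) C s N : (2 * C + 16 <= s)%N -> (2 ^ s <= N)%N ->
  `|x| <= 2 ^+ (C * s + C + 3) * (2^-1) ^+ N -> `|x| * 2 ^+ (2 ^ (s %/ 8)) < 1.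
Proof.
move=> hs hN hx; have h := exp2_dominates hs.
apply: (@le_lt_trans _ _ (2 ^+ (C * s + C + 3) * 2^-1 ^+ N * 2 ^+ (2 ^ (s %/ 8)))).
  by apply: ler_wpM2r => //; rewrite exprn_ge0.
rewrite mulrAC -exprD exprVn ltr_pdivrMr ?exprn_gt0 // mul1r ltr_eXn2l ?ltr1n //.
by apply: leq_trans hN; apply: ltn_trans h; rewrite ltn_add2r ltn_add2l.
Qed.

Lemma intr_norm_exp2 (c : int) B : (`|c| <= 2 ^ B)%N -> `|c%:~R : R| <= 2 ^+ B.
Proof. by move=> h; rewrite -intr_norm -abszE -natrX ler_nat. Qed.

Variables (Sl : seq nat) (K : nat).
Hypotheses (uS : uniq Sl) (pS : forall p, p \in Sl -> prime p) (sS : size Sl = K).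

Definition Sunit N := forall p, prime p -> (p %| N)%N -> p \in Sl.

Lemma logn_sg_lt p l e L : (1 < l)%N -> prime p -> (l <= 2 ^ L)%N -> (logn p (sg l e) <= e.+1 * L)%N.
Proof.
move=> l1 pp lL; rewrite -(leq_exp2l _ _ (ltnSn 1)); apply: (@leq_trans (sg l e)).
  apply: leq_trans (dvdn_leq (sg_gt0 l e) (pfactor_dvdnn p _)).
  by apply: leq_expl; apply: prime_gt1.
apply: (@leq_trans (l ^ e.+1)); last by rewrite mulnC expnM; apply: leq_expl.
apply: leq_trans (ltnW (sg_lt e l1)) _; by rewrite expnS leq_mul2r l1 orbT.
Qed.

Lemma relation_ln (l e : nat -> nat) (c : nat -> int) t : (forall i, i <= t -> 1 < l i)%N ->
  (forall i, (i <= t)%N -> Sunit (sg (l i) (e i))) ->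
  (forall j, (j < K)%N -> \sum_(0 <= i < t.+1) c i * (logn (nth 0%N Sl j) (sg (l i) (e i)))%:Z = 0) ->
  \sum_(0 <= i < t.+1) (c i)%:~R * ln (sg (l i) (e i))%:R = 0 :> R.
Proof.
move=> l1 hu hr.
rewrite (eq_big_nat _ _ (F2 := fun i => \sum_(0 <= j < K) (c i)%:~R * ((logn (nth 0%N Sl j) (sg (l i) (e i)))%:R * ln (nth 0%N Sl j)%:R))); last first.
  by move=> i /andP [_ it]; rewrite (unit_ln R uS pS (sg_gt0 _ _)) ?sS ?mulr_sumr //; exact: hu.
rewrite exchange_big_nat /= big_nat big1 // => j /andP [_ jK].
rewrite (eq_bigr (fun i => (c i * (logn (nth 0%N Sl j) (sg (l i) (e i)))%:Z)%:~R * ln (nth 0%N Sl j)%:R)); last first.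
  by move=> i _; rewrite intrM mulrA.
by rewrite -mulr_suml -(raddf_sum (intmul (1 : R))) /= hr // mul0r.
Qed.

Variables (L la : nat).
Hypothesis (Lla : (L <= 2 ^ la)%N).

Definition chain_const := (4 ^ K * (K + 4) + 2)%N.
Definition chain_sep := baker_sep K.+2 chain_const.

(* In a relation between the [ln (sg l e)], replace only the last one by [n ln l - ln (l - 1)]: the resulting form is
   nonzero, and too small if the last exponent is far beyond the previous ones. *)
Lemma chain_step (l e : nat -> nat) : (forall i, (i <= K)%N -> prime (l i)) ->
  (forall i, (i <= K)%N -> l i <= 2 ^ L)%N -> (forall i, (i <= K)%N -> Sunit (sg (l i) (e i))) ->
  {homo e : i j / (i <= j)%N} -> (0 < L)%N ->
  (chain_sep * la.+1 <= trunc_log 2 (e 0%N).+1)%N ->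
  (forall i, (i < K)%N -> chain_sep * (la + trunc_log 2 (e i).+1 + 2) <= trunc_log 2 (e i.+1).+1)%N -> False.
Proof.
move=> pl lL ul he L0 s0 ss.
have l1 i : (i <= K)%N -> (1 < l i)%N by move=> iK; apply: prime_gt1; apply: pl.
pose v (i j : nat) : int := (logn (nth 0%N Sl j) (sg (l i) (e i)))%:Z.
pose V i := ((e i).+1 * L)%N.
have [t [c [tK ct hc hr]]] : exists t c, [/\ (t <= K)%N, c t != 0 :> int,
    forall i, (i <= t)%N -> (`|c i| <= relation_bound K (V t))%N
    & forall j, (j < K)%N -> \sum_(0 <= i < t.+1) c i * v i j = 0].
  apply: short_relation.
  - by move=> i j ij; rewrite /V leq_mul2r ltnS he ?orbT.
  - by move=> i; rewrite /V muln_gt0.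
  - move=> i j iK jK; rewrite /v absz_nat; apply: logn_sg_lt; rewrite ?l1 ?lL //.
    by apply: pS; rewrite mem_nth // sS.
set s := trunc_log 2 (e t).+1.
have /andP [n1 n2] : (2 ^ s <= (e t).+1 < 2 ^ s.+1)%N by apply: trunc_log_bounds.
(* [2^(2^al)] has to bound the earlier [sg (l j) (e j)] as well, so [al] grows with the logarithm of
   the exponent before the last; the separation of the chain makes [s] large against it. *)
pose al := if t is t'.+1 then (la + trunc_log 2 (e t').+1 + 1)%N else la.
have hs : (chain_sep * al.+1 <= s)%N.
  rewrite /s /al; case: (t) tK => [|t'] tK; first exact: s0.
  by apply: leq_trans (ss t' tK); rewrite leq_mul2l; apply/orP; right; lia.
have sep0 : (2 * chain_const + 16 <= chain_sep)%N by apply: leq_baker_sep.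
have sC : (2 * chain_const + 16 <= s)%N.
  by apply: leq_trans sep0 (leq_trans _ hs); rewrite leq_pmulr.
have las : (la <= s)%N.
  apply: leq_trans hs; apply: (@leq_trans al.+1); last by rewrite leq_pmull // (leq_trans _ sep0) // addnS.
  by rewrite /al; case: (t) => [|t'] //; lia.
have lal : (la <= al)%N by rewrite /al; case: (t) => [|t'] //; lia.
have cb i : (i <= t)%N -> (`|c i| * (e t).+1 <= 2 ^ (chain_const * s))%N.
  move=> it; apply: (@leq_trans (2 ^ (4 ^ K * (2 * s + 1 + K + 1)) * 2 ^ s.+1)); last first.
    rewrite -expnD leq_exp2l // /chain_const; move: sC; have : (0 < 4 ^ K)%N by rewrite expn_gt0.
    move: (4 ^ K)%N; clear; nia.
  apply: leq_mul; last exact: ltnW.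
  apply: leq_trans (hc i it) _; apply: leq_trans (relation_bound_exp2 _ _); apply: relation_bound_homo.
  rewrite /V; apply: (@leq_trans (2 ^ s.+1 * 2 ^ la)); first by apply: leq_mul => //; apply: ltnW.
  rewrite -expnD leq_exp2l //; move: las; clear; lia.
have cb1 i : (i <= t)%N -> (`|c i| <= 2 ^ (chain_const * s))%N.
  by move=> it; apply: leq_trans (cb i it); rewrite leq_pmulr.
pose alphaN k := match k with 0 => l t | 1 => (l t).-1 | j.+2 => if (j < t)%N then sg (l j) (e j) else 1%N end.
pose bN k : int := match k with 0 => c t * (e t).+1%:Z | 1 => - c t | j.+2 => if (j < t)%N then c j else 0 end.
pose alpha (i : 'I_K.+2) := alphaN i.
pose b (i : 'I_K.+2) := bN i.
(* Only the defect of the one replaced logarithm remains. It is positive, so nonvanishing comes for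
   free; the entries 1 in [alphaN] are padding to a fixed length. *)
have lamE : logform R alpha b = (c t)%:~R * sg_defect R (l t) (e t).
  rewrite /logform big_ord_recl big_ord_recl /alpha /b /= /bump /=.
  have hl := relation_ln (fun i it => l1 i (leq_trans it tK)) (fun i it => ul i (leq_trans it tK)) hr.
  rewrite big_nat_recr //= in hl.
  have -> : \sum_(i < K) (bN (1 + (1 + i))%N)%:~R * ln (alphaN (1 + (1 + i))%N)%:R =
      \sum_(0 <= i < t) (c i)%:~R * ln (sg (l i) (e i))%:R :> R.
    rewrite big_mkord (big_ord_widen K (fun i => (c i)%:~R * ln (sg (l i) (e i))%:R)) // [RHS]big_mkcond /=.
    by apply: eq_bigr => i _ /=; case: ifP => // _; rewrite mul0r.
  have e0 : (1 < l t)%N by apply: l1.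
  move: hl; rewrite (ln_sg R (e t) e0) intrM intrN -[(e t).+1%:~R]/((e t).+1%:R).
  set A := \sum_(0 <= i < t) _; move: A (ln _) (ln _) (sg_defect _ _ _) ((c t)%:~R) ((e t).+1%:R) => A x y z w u h.
  by apply/eqP; rewrite -subr_eq0 -[X in _ == X]h; apply/eqP; ring.
have /andP [d0 d1] := sg_defect_bounds R (e t) (l1 t tK).
have lam0 : logform R alpha b != 0.
  by rewrite lamE mulf_neq0 ?intr_eq0 // gt_eqF.
have h1 : 1 <= `|logform R alpha b| * 2 ^+ (2 ^ (s %/ 8)).
  have lb : (l t <= 2 ^ 2 ^ al)%N.
    by apply: leq_trans (lL t tK) _; rewrite leq_exp2l // (leq_trans Lla) // leq_exp2l.
  apply: (@baker_separated R K.+1 alpha b chain_const s al) => //.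
  - case=> [[|[|j]] hj]; rewrite /alpha /=; first by apply: ltnW; apply: l1.
      by rewrite -subn1 subn_gt0 l1.
    by case: ifP => // _; rewrite sg_gt0.
  - case=> [[|[|j]] hj]; rewrite /alpha //=; first by apply: leq_trans lb; apply: leq_pred.
    case: ifP => jt; last by rewrite expn_gt0.
    have jK : (j <= K)%N by apply: leq_trans (ltnW jt) tK.
    apply: (@leq_trans (l j ^ (e j).+1)).
      by apply: leq_trans (ltnW (sg_lt _ (l1 j jK))) _; rewrite expnS leq_mul2r l1 ?orbT.
    apply: leq_trans (leq_expl _ (lL j jK)) _; rewrite -expnM leq_exp2l //.
    move: jt; rewrite /al; case: (t) => // t' jt.
    apply: (@leq_trans (2 ^ la * 2 ^ (trunc_log 2 (e t').+1).+1)); last by rewrite -expnD leq_exp2l // addn1 addnS.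
    apply: leq_mul => //; apply: (@leq_trans (e t').+1); first by rewrite ltnS he.
    by apply: ltnW; have /andP [] := @trunc_log_bounds 2 (e t').+1 isT isT.
  case=> [[|[|j]] hj]; rewrite /b /=.
  - by rewrite abszM cb.
  - by rewrite abszN cb1.
  by case: ifP => jt; rewrite ?expn_gt0 // cb1 // ltnW.
suff : `|logform R alpha b| * 2 ^+ (2 ^ (s %/ 8)) < 1 by rewrite ltNge h1.
apply: (tiny_form_absurd sC n1); rewrite lamE normrM (gtr0_norm d0).
apply: le_trans (ler_pM (normr_ge0 _) (ltW d0) (intr_norm_exp2 (cb1 t (leqnn t))) d1) _.
rewrite mulrA; apply: ler_wpM2r; first by rewrite exprn_ge0 // invr_ge0.
by rewrite -exprSr ler_weXn2l ?ler1n //; clear; lia.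
Qed.
End Steps.

Section Cluster.
Variable R : realType.
Variables (Sl : seq nat) (K : nat).
Hypotheses (uS : uniq Sl) (pS : forall p, p \in Sl -> prime p) (sS : size Sl = K).
Variables (L la : nat).
Hypothesis (Lla : (L <= 2 ^ la)%N).

Definition cluster_const cl := (cl + 4 ^ K * (cl + K + 2) + K.+1)%N.
Definition cluster_sep cl := baker_sep (K.+1 + K.+1) (cluster_const cl).

(* Here all the [ln (sg l e)] are replaced. The form does not vanish because the largest prime [l] of the relation
   divides none of the other [l] and none of the [l - 1]. *)
Lemma cluster_step (l e : nat -> nat) s cl : (forall i, (i <= K)%N -> prime (l i)) ->
  (forall i, (i <= K)%N -> l i <= 2 ^ L)%N -> (forall i, (i <= K)%N -> Sunit Sl (sg (l i) (e i))) ->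
  (forall i j, (i <= K)%N -> (j <= K)%N -> l i = l j -> i = j) -> (0 < L)%N ->
  (cluster_sep cl * la.+1 <= s)%N ->
  (forall i, (i <= K)%N -> 2 ^ s <= (e i).+1 <= 2 ^ (cl * s))%N -> False.
Proof.
move=> pl lL ul il L0 hs hn.
have l1 i : (i <= K)%N -> (1 < l i)%N by move=> iK; apply: prime_gt1; apply: pl.
pose C := cluster_const cl.
have sC : (2 * C + 16 <= s)%N.
  have sep0 : (2 * C + 16 <= cluster_sep cl)%N by apply: leq_baker_sep.
  by apply: leq_trans sep0 (leq_trans _ hs); rewrite leq_pmulr.
have las : (la <= s)%N.
  apply: leq_trans hs; apply: leq_trans (leqnSn _) _; rewrite leq_pmull // /cluster_sep.
  by apply: leq_trans (leq_baker_sep _ _) => //; rewrite addnS.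
pose v (i j : nat) : int := (logn (nth 0%N Sl j) (sg (l i) (e i)))%:Z.
pose V (i : nat) := (2 ^ (cl.+1 * s))%N.
have [t [c [tK ct hc hr]]] : exists t c, [/\ (t <= K)%N, c t != 0 :> int,
    forall i, (i <= t)%N -> (`|c i| <= relation_bound K (V t))%N
    & forall j, (j < K)%N -> \sum_(0 <= i < t.+1) c i * v i j = 0].
  apply: short_relation.
  - by [].
  - by move=> i; rewrite /V expn_gt0.
  - move=> i j iK jK; rewrite /v absz_nat; apply: (@leq_trans ((e i).+1 * L)).
      apply: logn_sg_lt; rewrite ?l1 ?lL //.
      by apply: pS; rewrite mem_nth // sS.
    rewrite /V (mulSn cl s) addnC expnD; have /andP [_ h] := hn i iK; apply: leq_mul => //.
    by apply: (leq_trans Lla); rewrite leq_exp2l.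
pose A := (4 ^ K * (cl.+1 * s + K + 1))%N.
have hc' i : (i <= t)%N -> (`|c i| <= 2 ^ A)%N.
  by move=> it; apply: leq_trans (hc i it) (relation_bound_exp2 _ _).
have AC : (cl * s + A <= C * s)%N.
  rewrite /A /C /cluster_const; move: sC; have : (0 < 4 ^ K)%N by rewrite expn_gt0.
  move: (4 ^ K)%N; clear; nia.
pose d (i : nat) := if (i <= t)%N then c i else 0.
have dA i : (`|d i| <= 2 ^ A)%N by rewrite /d; case: ifP => // it; apply: hc'.
pose alpha (i : 'I_(K.+1 + K.+1)) := match @fintype.split K.+1 K.+1 i with inl j => l j | inr j => (l j).-1 end.
pose b (i : 'I_(K.+1 + K.+1)) : int := match @fintype.split K.+1 K.+1 i with inl j => d j * (e j).+1%:Z | inr j => - d j end.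
have sl (j : 'I_K.+1) : @fintype.split K.+1 K.+1 (lshift K.+1 j) = inl j := unsplitK (inl j).
have sr (j : 'I_K.+1) : @fintype.split K.+1 K.+1 (rshift K.+1 j) = inr j := unsplitK (inr j).
have split2 (W : nmodType) (F : 'I_(K.+1 + K.+1) -> W) :
    \sum_(i < K.+1 + K.+1) F i = \sum_(i < K.+1) F (lshift K.+1 i) + \sum_(i < K.+1) F (rshift K.+1 i).
  by rewrite big_split_ord.
have ordK (j : 'I_K.+1) : (j <= K)%N by rewrite -ltnS.
have alpha0 i : (0 < alpha i)%N.
  rewrite /alpha; case: fintype.split => j; first by apply: ltnW; apply: l1.
  by rewrite -subn1 subn_gt0 l1.
have lamE : logform R (n := K + K.+1) alpha b = \sum_(j < K.+1) (d j)%:~R * sg_defect R (l j) (e j).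
  rewrite /logform (split2 _ (fun i : 'I_(K.+1 + K.+1) => (b i)%:~R * ln (alpha i)%:R)) /= -big_split /=.
  have hl := relation_ln R uS pS sS (fun i it => l1 i (leq_trans it tK)) (fun i it => ul i (leq_trans it tK)) hr.
  have {}hl : \sum_(j < K.+1) (d j)%:~R * ln (sg (l j) (e j))%:R = 0 :> R.
    rewrite -[RHS]hl big_mkord (big_ord_widen K.+1 (fun i => (c i)%:~R * ln (sg (l i) (e i))%:R)) // [RHS]big_mkcond /=.
    by apply: eq_bigr => i _ /=; rewrite /d ltnS; case: ifP => // _; rewrite mul0r.
  transitivity (\sum_(j < K.+1) (d j)%:~R * sg_defect R (l j) (e j) + \sum_(j < K.+1) (d j)%:~R * ln (sg (l j) (e j))%:R); last by rewrite hl addr0.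
  rewrite -big_split /=; apply: eq_bigr => j _.
  rewrite /alpha /b sl sr (ln_sg R (e j) (l1 j (ordK j))) intrM intrN -[(e j).+1%:~R]/((e j).+1%:R).
  move: (ln _) (ln _) (sg_defect _ _ _) ((d j)%:~R) ((e j).+1%:R) => x y z w u; ring.
have lam0 : logform R (n := K + K.+1) alpha b != 0.
  apply/eqP => L00.
  have dt : d (Ordinal (tK : (t < K.+1)%N)) != 0 by rewrite /d /= leqnn.
  (* At the valuation of this largest prime every term but its own drops out: the other [l] are
     different primes, and all the [l - 1] are smaller. *)
  have [i di imax] := @arg_maxnP _ (Ordinal (tK : (t < K.+1)%N)) (fun j : 'I_K.+1 => d j != 0) (fun j => l j) dt.
  have pq := pl i (ordK i).
  have := logform0_valuation alpha0 pq L00.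
  rewrite (split2 _ (fun j : 'I_(K.+1 + K.+1) => b j * (logn (l i) (alpha j))%:Z)) /=.
  rewrite (bigD1 i) //= [X in _ + X]big1 => [|j _]; last first.
    rewrite /b /alpha sr; have [->|dj] := eqVneq (d j) 0; first by rewrite oppr0 mul0r.
    rewrite (@ltn_log0 (l i)) ?mulr0 //; apply: leq_trans (imax j dj).
    by rewrite prednK // ltnW // l1.
  rewrite addr0 [X in _ + X]big1 => [|j ji]; last first.
    rewrite /b /alpha sl logn_prime ?pl // (_ : (l i == l j) = false) ?mulr0 //.
    by apply/negP => /eqP /(il i j (ordK i) (ordK j)) /val_inj ij; rewrite ij eqxx in ji.
  rewrite addr0 /b /alpha sl logn_prime // eqxx mulr1 => /eqP.
  by rewrite mulf_eq0 (negbTE di).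
have h1 : 1 <= `|logform R (n := K + K.+1) alpha b| * 2 ^+ (2 ^ (s %/ 8)).
  apply: (@baker_separated R (K + K.+1) alpha b C s la) => //.
    move=> i; have lb (j : 'I_K.+1) : (l j <= 2 ^ 2 ^ la)%N.
      by apply: leq_trans (lL j (ordK j)) _; rewrite leq_exp2l.
    by rewrite /alpha; case: fintype.split => j; [|apply: leq_trans (leq_pred _) _]; apply: lb.
  move=> i; rewrite /b; case: fintype.split => j.
    rewrite abszM; apply: leq_trans (leq_mul (dA j) (_ : _ <= 2 ^ (cl * s)))%N _.
      by have /andP [] := hn j (ordK j).
    by rewrite -expnD leq_exp2l // addnC.
  rewrite abszN; apply: leq_trans (dA j) _; rewrite leq_exp2l //; apply: leq_trans AC; exact: leq_addl.
suff : `|logform R (n := K + K.+1) alpha b| * 2 ^+ (2 ^ (s %/ 8)) < 1 by rewrite ltNge h1.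
apply: (tiny_form_absurd sC (leqnn _)); rewrite lamE.
apply: le_trans (ler_norm_sum _ _ _) _.
apply: (@le_trans _ _ (\sum_(j < K.+1) 2 ^+ A * (2 * 2^-1 ^+ (2 ^ s)))).
  apply: ler_sum => j _; rewrite normrM; apply: ler_pM => //; first exact: intr_norm_exp2.
  have /andP [d0 d1] := sg_defect_bounds R (e j) (l1 j (ordK j)); rewrite (gtr0_norm d0).
  apply: (le_trans d1); apply: ler_wpM2l => //.
  apply: ler_wiXn2l; rewrite ?invr_ge0 ?invf_le1 ?ler1n //.
  by have /andP [] := hn j (ordK j).
rewrite sumr_const card_ord -[_ *+ _]mulr_natl !mulrA; apply: ler_wpM2r; first by rewrite exprn_ge0 // invr_ge0.
apply: (@le_trans _ _ (2 ^+ K.+1 * 2 ^+ A * 2)).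
  do 2! (apply: ler_wpM2r; rewrite ?exprn_ge0 //).
  by rewrite -natrX ler_nat ltnW // ltn_expl.
rewrite -exprD -exprSr ler_weXn2l ?ler1n //.
have : (K.+1 <= C)%N by rewrite /C /cluster_const leq_addl.
move: AC; clear; lia.
Qed.
End Cluster.

Definition heavy_sep K := (chain_sep K + cluster_sep K (8 * chain_sep K))%N.

(* Sorted by exponent, more than [K ^ 2] primes contain a chain (the indices [0, K, 2K, ..., K ^ 2]) or a cluster (the
   indices [i K, ..., (i + 1) K] for some [i]). *)
Theorem heavy_bound (R : realType) (Sl : seq nat) K L la (T : seq nat) (e : nat -> nat) :
  uniq Sl -> (forall p, p \in Sl -> prime p) -> size Sl = K -> (0 < K)%N ->
  (0 < L)%N -> (L <= 2 ^ la)%N -> uniq T ->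
  (forall l, l \in T -> [/\ prime l, l <= 2 ^ L, Sunit Sl (sg l (e l)) & 2 ^ (heavy_sep K * la.+1) <= (e l).+1])%N ->
  (size T <= K ^ 2)%N.
Proof.
move=> uS pS sS K0 L0 Lla uT hT; rewrite leqNgt; apply/negP => sT.
pose T' := sort (fun x y => e x <= e y)%N T.
have sT' : (K ^ 2 < size T')%N by rewrite size_sort.
pose l i := nth 0%N T' i.
have lT i : (i <= K ^ 2)%N -> l i \in T.
  by move=> iK; rewrite -(mem_sort (fun x y => e x <= e y)%N) mem_nth // (leq_ltn_trans iK).
have le i j : (i <= j)%N -> (j <= K ^ 2)%N -> (e (l i) <= e (l j))%N.
  move=> ij jK; apply: (@sorted_leq_nth _ (fun x y => e x <= e y)%N) => //.
  - by move=> x y z; apply: leq_trans.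
  - by apply: sort_sorted => x y; apply: leq_total.
  - by rewrite inE (leq_ltn_trans ij) // (leq_ltn_trans jK).
  - by rewrite inE (leq_ltn_trans jK).
pose s i := trunc_log 2 (e (l i)).+1.
have sE i : (2 ^ s i <= (e (l i)).+1 < 2 ^ (s i).+1)%N by apply: trunc_log_bounds.
have s0 i : (i <= K ^ 2)%N -> (heavy_sep K * la.+1 <= s i)%N.
  by move=> /lT /hT [_ _ _ h]; apply: trunc_log_max.
have cs0 : (0 < chain_sep K)%N.
  by apply: leq_trans (leq_baker_sep _ _) => //; rewrite addnS.
have sla i : (i <= K ^ 2)%N -> (la < s i)%N.
  move/s0; apply: leq_trans; rewrite leq_pmull // /heavy_sep addn_gt0 cs0 //.
have iK2 i : (i <= K)%N -> (i * K <= K ^ 2)%N by move=> iK; rewrite expnS expn1 leq_mul2r iK orbT.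
have il i j : (i <= K ^ 2)%N -> (j <= K ^ 2)%N -> l i = l j -> i = j.
  move=> iK jK /eqP; rewrite nth_uniq ?sort_uniq ?(leq_ltn_trans _ sT') // => /eqP //.
have [/forallP sepd|] := boolP [forall i : 'I_K, chain_sep K * (la + s (i * K)%N + 2) <= s (i.+1 * K)%N]%N.
  (* Clamped at [K] because [chain_step] asks for monotone exponents at all indices. *)
  pose x i := l (minn i K * K)%N.
  have mK i : (minn i K <= K)%N by rewrite geq_minr.
  have hx i : x i \in T by apply: lT; apply: iK2.
  apply: (@chain_step R Sl K uS pS sS L la Lla x (e \o x)) => //.
  - by move=> i _; have [] := hT _ (hx i).
  - by move=> i _; have [] := hT _ (hx i).
  - by move=> i _; have [] := hT _ (hx i).
  - move=> i j ij /=; apply: le; last exact: iK2.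
    by rewrite leq_mul2r leq_min geq_minr geq_min ij orbT.
  - rewrite /= /x min0n mul0n; apply: leq_trans (s0 0%N (leq0n _)).
    by rewrite leq_mul2r leq_addr orbT.
  move=> i iK; have := sepd (Ordinal iK); rewrite /= /x (minn_idPl iK) (minn_idPl (ltnW iK)) //.
(* Where the chain breaks, the logarithm [s] grows over [K] steps by a bounded factor; [la < s]
   turns the additive terms into multiples of [s], whence [8 * chain_sep K]. *)
rewrite negb_forall => /existsP [i]; rewrite -ltnNge => hi.
have hiK : (i.+1 * K <= K ^ 2)%N by apply: iK2.
have bK j : (j <= K)%N -> (i * K + j <= i.+1 * K)%N by move=> jK; rewrite mulSn addnC leq_add2r.
have bK2 j : (j <= K)%N -> (i * K + j <= K ^ 2)%N by move=> jK; apply: leq_trans (bK j jK) hiK.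
pose x j := l (i * K + j)%N.
have hx j : (j <= K)%N -> x j \in T by move=> jK; apply: lT; apply: bK2.
apply: (@cluster_step R Sl K uS pS sS L la Lla x (e \o x) (s (i * K)%N) (8 * chain_sep K)) => //.
- by move=> j jK; have [] := hT _ (hx j jK).
- by move=> j jK; have [] := hT _ (hx j jK).
- by move=> j jK; have [] := hT _ (hx j jK).
- by move=> j j' jK jK' /il h; apply/eqP; rewrite -(eqn_add2l (i * K)) h // bK2.
- apply: leq_trans (s0 _ (iK2 i (ltnW (ltn_ord i)))); rewrite leq_mul2r leq_addl orbT //.
move=> j jK; apply/andP; split.
  have /andP [h _] := sE (i * K)%N; apply: leq_trans h _; rewrite ltnS /=; apply: le; rewrite ?leq_addr // bK2 //.
have /andP [_ h] := sE (i.+1 * K)%N.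
apply: leq_trans (_ : (e (l (i.+1 * K))).+1 <= _)%N; first by rewrite ltnS /= le // bK.
apply: leq_trans (ltnW h) _; rewrite leq_exp2l //.
have := sla _ (iK2 i (ltnW (ltn_ord i))); move: hi cs0; clear; nia.
Qed.

(** * The two sides of a superperfect number *)

Local Open Scope nat_scope.

(* [a] will be the side with few prime factors. *)
Record amicable (a b c d : nat) : Prop := Amicable {
  am_odd_l : odd a; am_odd_r : odd b;
  am_sigma_l : sigma a = c * b; am_sigma_r : sigma b = d * a;
  am_two : c * d = 2 }.

Lemma amicable_sym a b c d : amicable a b c d -> amicable b a d c.
Proof. by case=> *; split=> //; rewrite mulnC. Qed.

Lemma amicable_gt0 a b c d : amicable a b c d -> 0 < a.
Proof. by case=> oa *; apply: odd_gt0. Qed.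

Lemma amicable_factor a b c d : amicable a b c d -> (c %| 2) && (0 < c).
Proof. by case=> _ _ _ _ h; rewrite -h dvdn_mulr //=; case: c h. Qed.

Lemma amicable_prime a b c d p q : amicable a b c d -> p \in primes a -> prime q ->
  q %| sg p (logn p a) -> (q == 2) || (q \in primes b).
Proof.
move=> h pa pq dq; have /andP [c2 _] := amicable_factor h.
have := dvdn_trans dq (sg_dvd_sigma pa); rewrite (am_sigma_l h) Euclid_dvdM // => /orP [qc|qb].
  by rewrite -dvdn_prime2 // (dvdn_trans qc c2).
by rewrite mem_primes pq qb odd_gt0 ?orbT //; apply: (am_odd_r h).
Qed.

Lemma odd_sg l e : odd l -> odd (sg l e) = ~~ odd e.
Proof. by move=> ol; elim: e => [|e IH]; rewrite ?sg0 // sgS oddD IH oddX ol orbT addbT. Qed.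

Lemma odd_prime_of a p : odd a -> p \in primes a -> odd p.
Proof.
move=> oa; rewrite mem_primes => /and3P [_ _ pa].
by apply: contraLR oa => op; rewrite -dvdn2 (dvdn_trans _ pa) // dvdn2.
Qed.

(** Two odd exponents would make 4 divide [sigma b = d * a], with [d] dividing 2 and [a] odd. *)
Lemma odd_exponent_unique a b c d l l' : amicable a b c d -> l \in primes b -> l' \in primes b ->
  odd (logn l b) -> odd (logn l' b) -> l = l'.
Proof.
move=> h lb lb' ol ol'; apply/eqP; apply: contraTT (am_odd_l h) => ll'.
have [ob oa] := (am_odd_r h, am_odd_l h).
have even_sg x : x \in primes b -> odd (logn x b) -> 2 %| sg x (logn x b).
  by move=> xb ox; rewrite dvdn2 odd_sg ?ox // (odd_prime_of ob).
have : 2 * 2 %| sigma b.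
  rewrite sigma_prod (big_rem l) //= (big_rem l') /=; last first.
    by rewrite mem_rem_uniq ?primes_uniq // inE eq_sym ll'.
  by rewrite mulnA dvdn_mulr // dvdn_mul // even_sg.
rewrite (am_sigma_r h) => d4.
have /andP [d2 _] := amicable_factor (amicable_sym h).
have {}d4 : 2 * 2 %| 2 * a by apply: dvdn_trans d4 _; apply: dvdn_mul.
by rewrite -dvdn2; move: d4; rewrite dvdn_pmul2l.
Qed.

Lemma sigma_ge_two n m : 0 < n -> m %| n -> m < n -> n + m <= sigma n.
Proof.
move=> n0 mn ltmn; rewrite /sigma (bigD1_seq n) ?divisors_uniq -?dvdn_divisors //=.
rewrite leq_add2l big_mkcond (bigD1_seq m) ?divisors_uniq -?dvdn_divisors //=.
by rewrite ltn_eqF // leq_addr.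
Qed.

(* If [2 ^ v] exactly divides [M = sigma N] then [2 ^ (v+1) - 1] divides [N], and the two divisors [N] and
   [N / (2 ^ (v+1) - 1)] of [N] already make [sigma N] too large. *)
Lemma odd_sigma_superperfect N : odd N -> superperfect N -> odd (sigma N).
Proof.
move=> oN [N0 sN]; set M := sigma N in sN *.
have M0 : 0 < M by apply: sigma_gt0.
apply/negPn/negP => eM.
have v0 : 0 < logn 2 M by rewrite logn_gt0 mem_primes M0 dvdn2 eM.
set v := logn 2 M in v0.
have M2 : 2 \in primes M by rewrite -logn_gt0.
set d := sg 2 v.
have dE : d = 2 ^ v.+1 - 1 by rewrite -(sg_mul v (isT : 0 < 2)) mul1n.
set m := \prod_(p <- rem 2 (primes M)) p ^ logn p M.
set w := \prod_(p <- rem 2 (primes M)) sg p (logn p M).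
have ME : M = 2 ^ v * m by rewrite {1}(prod_primes M0) (big_rem 2).
have sME : sigma M = d * w by rewrite sigma_prod (big_rem 2).
have mw : m <= w by apply: leq_prod => p _; apply: leq_sg.
have om : odd m.
  rewrite /m big_seq; apply: (big_ind odd) => // [x y ox oy|p]; first by rewrite oddM ox.
  rewrite (rem_filter _ (primes_uniq M)) mem_filter => /andP [p2 pM].
  rewrite oddX; apply/orP; right; move: pM; rewrite mem_primes => /and3P [pp _ _].
  by case: (even_prime pp) => // e; move: p2; rewrite e.
have od : odd d by rewrite dE oddB ?expn_gt0 // oddX.
have dN : d %| N.
  have : d %| 2 * N by rewrite -sN sME dvdn_mulr.
  by rewrite Gauss_dvdr // coprime_sym coprime2n.
case/dvdnP: dN => n' eN.
have d3 : 3 <= d.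
  have : 2 ^ 2 <= 2 ^ v.+1 by rewrite leq_exp2l.
  rewrite dE; move: (2 ^ v.+1) => z; clear; lia.
have n0 : 0 < n' by move: N0; rewrite eN muln_gt0 => /andP [].
have w2 : w = 2 * n'.
  apply/eqP; rewrite -(eqn_pmul2l (_ : 0 < d)); last by apply: leq_trans d3.
  by rewrite -sME sN eN mulnA mulnC.
have le1 : N + n' <= M.
  apply: sigma_ge_two => //; first by rewrite eN dvdn_mulr.
  by rewrite eN -[X in X < _]muln1 ltn_pmul2l // (leq_trans _ d3).
have le2 : w <= m.
  rewrite w2 -(leq_pmul2l (_ : 0 < 2 ^ v)) ?expn_gt0 // -ME; apply: leq_trans le1.
  have : 0 < 2 ^ v by rewrite expn_gt0.
  rewrite eN dE expnS; move: (2 ^ v) => z; clear; nia.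
have e : m = w by apply/eqP; rewrite eqn_leq mw le2.
by move: om; rewrite e w2 oddM.
Qed.

Lemma superperfect_amicable N : odd N -> superperfect N -> amicable N (sigma N) 1 2.
Proof.
by move=> oN hN; have oM := odd_sigma_superperfect oN hN; case: hN => N0 sN; split; rewrite ?mul1n.
Qed.

(** * The density of the long side *)

Local Open Scope nat_scope.

Lemma sg_ltn x y e : x < y -> 0 < e -> sg x e < sg y e.
Proof.
move=> xy; case: e => // e _; elim: e => [|e IH].
  by rewrite !sgS !sg0 !expn1 ltn_add2l.
have h := leq_expl e.+2 (ltnW xy); rewrite (sgS x e.+1) (sgS y e.+1); exact: (leq_add IH h).
Qed.

Lemma Sunit_eq (Sl : seq nat) M N : 0 < M -> 0 < N -> Sunit Sl M -> Sunit Sl N ->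
  (forall p, p \in Sl -> logn p M = logn p N) -> M = N.
Proof.
move=> M0 N0 uM uN h; apply: eqn_from_log => // p.
have [pS|pS] := boolP (p \in Sl); first exact: h.
have z Q : Sunit Sl Q -> logn p Q = 0.
  move=> uQ; have [pp|np] := boolP (prime p); last by rewrite lognE (negbTE np).
  by apply/eqP; rewrite -leqn0 leqNgt logn_gt0 mem_primes pp /=; apply: contra pS => /andP [_ /(uQ p pp)].
by rewrite !z.
Qed.

Lemma size_inj_card (T : eqType) (F : finType) (s : seq T) (f : T -> F) : uniq s ->
  {in s &, injective f} -> size s <= #|F|.
Proof.
move=> us fi; rewrite -(size_map f); have /card_uniqP <- : uniq (map f s) by rewrite map_inj_in_uniq.
exact: max_card.
Qed.

Section Count.
Variable R : realType.
Variables (Sl : seq nat) (K L la : nat) (T : seq nat) (e : nat -> nat).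
Hypotheses (uS : uniq Sl) (pS : forall p, p \in Sl -> prime p) (sS : size Sl = K) (K0 : 0 < K).
Hypotheses (L0 : 0 < L) (Lla : L <= 2 ^ la) (uT : uniq T).
Hypothesis hT : forall l, l \in T -> [/\ prime l, l <= 2 ^ L, Sunit Sl (sg l (e l)) & 0 < e l].

(** Large exponents fall under [heavy_bound]. For the others, [e l] and the valuations of
    [sg l (e l)] at [Sl] determine [sg l (e l)], hence [l] by monotonicity, and they take few
    values. *)
Lemma count_bound rho : rho = heavy_sep K * la.+1 -> size T <= K ^ 2 + 2 ^ rho * (2 ^ (rho + la)) ^ K.
Proof.
move=> rE; rewrite -(count_predC (fun l => 2 ^ rho <= (e l).+1)); apply: leq_add; rewrite -size_filter.
  apply: (@heavy_bound R Sl K L la _ e) => //; rewrite ?filter_uniq // => l.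
  by rewrite mem_filter rE => /andP [h /hT []].
pose A := 2 ^ rho; pose B := 2 ^ (rho + la).
have A0 : 0 < A by rewrite expn_gt0.
have B0 : 0 < B by rewrite expn_gt0.
pose f (l : nat) : 'I_(A.-1.+1) * {ffun 'I_K -> 'I_(B.-1.+1)} :=
  (inord (e l), [ffun j : 'I_K => inord (logn (nth 0 Sl j) (sg l (e l)))]).
have cT : #|{: 'I_(A.-1.+1) * {ffun 'I_K -> 'I_(B.-1.+1)}}| = A * B ^ K.
  by rewrite card_prod card_ffun !card_ord !prednK.
rewrite -cT; apply: (size_inj_card (f := f)); first by rewrite filter_uniq.
have eA l : ~~ (A <= (e l).+1) -> e l < A.-1.+1 by rewrite prednK // -ltnNge; apply: ltnW.
have lB l j : l \in T -> ~~ (A <= (e l).+1) -> j < K -> logn (nth 0 Sl j) (sg l (e l)) < B.-1.+1.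
  move=> /hT [pl lL _ _]; rewrite -ltnNge => le jK; rewrite prednK // /B expnD.
  apply: leq_ltn_trans (logn_sg_lt (e l) (prime_gt1 pl) _ lL) _.
    by apply: pS; rewrite mem_nth // sS.
  apply: (@leq_ltn_trans ((e l).+1 * 2 ^ la)); first by rewrite leq_mul2l Lla orbT.
  by rewrite ltn_pmul2r // expn_gt0.
move=> l l'; rewrite !mem_filter /= => /andP [le lT] /andP [le' lT'] [/(congr1 val) /= h1 /ffunP h2].
rewrite !inordK ?eA // in h1.
have [pl lL ul el] := hT lT; have [pl' lL' ul' el'] := hT lT'.
have sgE : sg l (e l) = sg l' (e l').
  apply: (Sunit_eq (sg_gt0 _ _) (sg_gt0 _ _) ul ul') => p pSl.
  have jK : index p Sl < K by rewrite -sS index_mem.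
  have := congr1 val (h2 (Ordinal jK)); rewrite !ffunE /= !inordK ?lB //.
  by rewrite nth_index.
rewrite -h1 in sgE; case: (ltngtP l l') => // ll'.
  by have := sg_ltn ll' el; rewrite sgE ltnn.
by have := sg_ltn ll' el; rewrite sgE ltnn.
Qed.
End Count.

Ltac homo := repeat (match goal with
  | |- is_true (_ + _ <= _ + _) => apply: leq_add
  | |- is_true (_ * _ <= _ * _) => apply: leq_mul
  | |- is_true (_ ^ _ <= _ ^ _) => apply: leq_expl
  end); rewrite ?ltnS //.

Lemma baker_exponent_homo m m' : m <= m' -> baker_exponent m <= baker_exponent m'.
Proof. by move=> h; rewrite /baker_exponent; homo. Qed.

Lemma baker_sep_homo m m' C C' : m <= m' -> C <= C' -> baker_sep m C <= baker_sep m' C'.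
Proof.
move=> h h'; have hE := baker_exponent_homo h; rewrite /baker_sep /sep_offset; homo.
Qed.

Lemma heavy_sep_homo K K' : K <= K' -> heavy_sep K <= heavy_sep K'.
Proof.
move=> h; have h4 : 4 ^ K <= 4 ^ K' by rewrite leq_exp2l.
have hc : chain_sep K <= chain_sep K' by apply: baker_sep_homo; rewrite ?ltnS // /chain_const; apply: leq_add => //; apply: leq_mul => //; homo.
rewrite /heavy_sep; apply: leq_add => //; apply: baker_sep_homo; first by homo.
by rewrite /cluster_const; apply: leq_add; rewrite ?ltnS //; apply: leq_add; [homo | apply: leq_mul => //; homo].
Qed.

Definition tail_rate k := (heavy_sep k.+1 + 3) * k.+2.
Definition tail_start k := 2 ^ (2 * tail_rate k + 16).

Lemma tail_numeric k K i la : K <= k.+1 -> tail_start k <= i -> 2 ^ la <= 2 * (4 * i) ->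
  4 * i < 2 ^ la ->
  K ^ 2 + 2 ^ (heavy_sep K * la.+1) * (2 ^ (heavy_sep K * la.+1 + la)) ^ K <= 2 ^ i.
Proof.
move=> Kk hi l1 l2; set Q := tail_rate k in hi.
have hl : 2 * Q + 18 < la.
  rewrite -(ltn_exp2l _ _ (ltnSn 1)); apply: leq_ltn_trans l2.
  by rewrite (_ : 18 = 2 + 16) // addnCA expnD leq_mul2l hi.
have i3 : 2 ^ (la - 3) <= i.
  have : 2 ^ la = 2 ^ (la - 3) * 8 by rewrite -(expnD 2 _ 3) subnK //; move: hl; clear; lia.
  move: l1; move: (2 ^ (la - 3)) => z; clear; lia.
have Qi : Q * la.+1 <= i.
  apply: leq_trans i3.
  have h1 : la.+1 <= 2 ^ (la %/ 2) by apply: leq_half_exp2; move: hl; clear; lia.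
  apply: leq_trans (leq_mul (ltnW (ltn_expl Q (ltnSn 1))) h1) _.
  by rewrite -expnD leq_exp2l //; move: hl; clear; lia.
have hH : heavy_sep K <= heavy_sep k.+1 by apply: heavy_sep_homo.
set H := heavy_sep K in hH *.
have e1 : K ^ 2 <= 2 ^ (2 * K) by rewrite mulnC expnM; apply: leq_expl; apply: ltnW; apply: ltn_expl.
rewrite -expnM -expnD.
have e2 : (2 * K).+1 + (H * la.+1 + (H * la.+1 + la) * K) <= i.
  apply: leq_trans Qi; rewrite /Q /tail_rate.
  apply: (@leq_trans ((H + 3) * K.+1 * la.+1)); first by move: hl; clear; nia.
  by homo; rewrite ?leq_add2r.
have e3 : 2 ^ (H * la.+1 + (H * la.+1 + la) * K) <= 2 ^ i.-1 by rewrite leq_exp2l //; move: e2; clear; lia.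
have e4 : K ^ 2 <= 2 ^ i.-1 by apply: leq_trans e1 _; rewrite leq_exp2l //; move: e2; clear; lia.
have e5 : 2 ^ i = 2 ^ i.-1 + 2 ^ i.-1 by rewrite addnn -mul2n -expnS prednK //; move: e2; clear; lia.
by rewrite e5 leq_add.
Qed.

(** With [P = 16^i], at most [P^(1/4)] primes. [count_bound] is polynomial in [log P], so any fixed
    power of [P] would do from some point on; below [tail_sum] only needs an exponent less than
    1. *)
Lemma long_side_count (R : realType) a b c d k i : amicable a b c d -> omega a <= k -> tail_start k <= i ->
  count (fun l => l <= 16 ^ i) (primes b) <= 2 ^ i.
Proof.
move=> h oa hi; rewrite -size_filter.
have i0 : 0 < i by apply: leq_trans hi; rewrite expn_gt0.
pose Sl := 2 :: primes a; pose L := 4 * i; pose la := (trunc_log 2 L).+1.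
have L0 : 0 < L by rewrite muln_gt0.
have /andP [l1 l2] := trunc_log_bounds (ltnSn 1) L0.
have a2 : 2 \notin primes a by rewrite mem_primes dvdn2 (am_odd_l h) andbF.
have hc := @count_bound R Sl (omega a).+1 L la [seq l <- primes b | l <= 16 ^ i] (fun l => logn l b)
  _ _ (erefl _) isT L0 (ltnW l2) _ _ _ (erefl _).
apply: leq_trans (hc _ _ _ _) _.
- by rewrite /= a2 primes_uniq.
- by move=> p; rewrite inE mem_primes => /orP [/eqP -> //|/and3P []].
- by rewrite filter_uniq ?primes_uniq.
- move=> l; rewrite mem_filter => /andP [li lb]; split.
  + by move: lb; rewrite mem_primes => /and3P [].
  + by rewrite expnM.
  + by move=> p pp hp; rewrite inE; exact: (amicable_prime (amicable_sym h) lb pp hp).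
  + by rewrite logn_gt0.
by apply: (tail_numeric (k := k)) => //; rewrite ?ltnS // expnS leq_mul2l.
Qed.

Local Open Scope ring_scope.

Lemma pow_inv_ge0 (q n : nat) : 0 <= q%:R^-1 ^+ n :> rat.
Proof. by rewrite exprn_ge0 // invr_ge0. Qed.

Lemma tail_sum (T : seq nat) i0 : (0 < i0)%N ->
  (forall i, (i0 <= i)%N -> (count (fun l => l <= 16 ^ i) T <= 2 ^ i)%N) ->
  \sum_(l <- T | (16 ^ i0 < l)%N) (l.-1%:R)^-1 <= 2^-1 ^+ i0 :> rat.
Proof.
move=> i00 hc.
(* The shell from [16^m] to [16^(m+1)] contributes at most [2^(m+1) / 16^m = 2 / 8^m], less than the
   increment [(7/2) / 8^m] of the telescoping bound. *)
have step n : \sum_(l <- T | (16 ^ i0 < l <= 16 ^ (i0 + n))%N) (l.-1%:R)^-1 <= 4 * (8^-1 ^+ i0 - 8^-1 ^+ (i0 + n)) :> rat.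
  elim: n => [|n IH].
    rewrite addn0 subrr mulr0 big1 // => l /andP [h1 h2]; by rewrite ltnNge h2 in h1.
  set m := (i0 + n)%N; have -> : (i0 + n.+1 = m.+1)%N by rewrite addnS.
  rewrite (bigID (fun l => (l <= 16 ^ m)%N)) /=.
  have -> : \sum_(l <- T | (16 ^ i0 < l <= 16 ^ m.+1)%N && (l <= 16 ^ m)%N) (l.-1%:R)^-1 =
            \sum_(l <- T | (16 ^ i0 < l <= 16 ^ m)%N) (l.-1%:R)^-1 :> rat.
    apply: eq_bigl => l; rewrite -andbA; congr (_ && _); case: (leqP l (16 ^ m)) => h2; rewrite ?andbF ?andbT //.
    by rewrite (leq_trans h2) // leq_exp2l.
  have h : \sum_(l <- T | (16 ^ i0 < l <= 16 ^ m.+1)%N && ~~ (l <= 16 ^ m)%N) (l.-1%:R)^-1 <= 2 * 8^-1 ^+ m :> rat.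
    apply: (@le_trans _ _ (\sum_(l <- T | (l <= 16 ^ m.+1)%N) 16^-1 ^+ m)).
      rewrite big_mkcond [leRHS]big_mkcond /=; apply: ler_sum => l _.
      case: (leqP l (16 ^ m.+1)) => h1; last by rewrite andbF.
      rewrite andbT; case: ifP => [/andP [_]|_]; last exact: pow_inv_ge0.
      rewrite -ltnNge => h3; rewrite exprVn lef_pV2 ?posrE ?exprn_gt0 ?ltr0n //.
        by rewrite -natrX ler_nat -ltnS prednK // (leq_ltn_trans _ h3).
      by rewrite -subn1 subn_gt0; apply: leq_ltn_trans h3; rewrite expn_gt0.
    rewrite big_const_seq iter_addr_0 -[_ *+ _]mulr_natr.
    apply: (@le_trans _ _ (16^-1 ^+ m * 2 ^+ m.+1)).
      apply: ler_wpM2l; first exact: pow_inv_ge0.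
      by rewrite -natrX ler_nat hc // ltnW // ltnS /m leq_addr.
    by rewrite exprS mulrCA -exprMn (_ : 16^-1 * 2 = 8^-1 :> rat).
  apply: (le_trans (lerD IH h)); rewrite exprS -/m.
  have := pow_inv_ge0 8 m.
  move: (8^-1 ^+ m) (8^-1 ^+ i0) => x y; clear; lra.
have [n hn] : exists n, forall l, l \in T -> (l <= 16 ^ (i0 + n))%N.
  exists (\max_(l <- T) l)%N => l lT; apply: (@leq_trans (16 ^ (\max_(l <- T) l))).
    by apply: leq_trans (ltnW (ltn_expl _ _)); rewrite ?(leq_bigmax_seq _ lT).
  by rewrite leq_exp2l // leq_addl.
rewrite big_seq_cond (eq_bigl (fun l => (l \in T) && (16 ^ i0 < l <= 16 ^ (i0 + n))%N)); last first.
  by move=> l; case lT: (l \in T) => //=; rewrite hn // andbT.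
rewrite -big_seq_cond; apply: (le_trans (step n)).
have h0 := pow_inv_ge0 8 (i0 + n).
apply: (@le_trans _ _ (4 * 8^-1 ^+ i0)); first by move: h0; clear; lra.
have aux (x y z : rat) n' : x = y * z -> x ^+ n' = y ^+ n' * z ^+ n' by move=> ->; rewrite exprMn.
rewrite (aux 8^-1 4^-1 2^-1) //.
have w0 := pow_inv_ge0 2 i0.
have z1 : 4^-1 ^+ i0 <= 4^-1 :> rat.
  rewrite -{1}(prednK i00) exprS -[leRHS]mulr1; apply: ler_wpM2l; first by rewrite invr_ge0.
  by apply: exprn_ile1; rewrite ?invr_ge0 // invf_le1 // ler1n.
move: z1 w0; move: (4^-1 ^+ i0) (2^-1 ^+ i0) => z w; clear; nra.
Qed.

(** * The gap principle *)

Local Open Scope ring_scope.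

Lemma prod_ge1 (I : Type) (r : seq I) (P : pred I) (F : I -> rat) :
  (forall i, P i -> 1 <= F i) -> 1 <= \prod_(i <- r | P i) F i.
Proof. by move=> h; apply: (big_ind (fun x => 1 <= x)) => // x y hx hy; apply: mulr_ege1. Qed.

Lemma prod_add1_le (I : Type) (r : seq I) (P : pred I) (F : I -> rat) : (forall i, P i -> 0 <= F i) ->
  (\prod_(i <- r | P i) (1 + F i)) * (1 - \sum_(i <- r | P i) F i) <= 1.
Proof.
move=> h; elim: r => [|i r IH]; first by rewrite !big_nil subr0 mulr1.
rewrite !big_cons; case: ifP => // Pi.
have p0 : 0 <= \prod_(i <- r | P i) (1 + F i) by apply: prodr_ge0 => j /h; lra.
have s0 : 0 <= \sum_(i <- r | P i) F i by apply: sumr_ge0.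
have Fi := h i Pi; move: IH p0 s0 Fi; move: (\prod_(_ <- _ | _) _) (\sum_(_ <- _ | _) _) (F i) => p s x; clear => IH p0 s0 Fi.
have := mulr_ge0 (mulr_ge0 p0 Fi) (addr_ge0 s0 Fi); lra.
Qed.

Lemma prod_sub1_ge (I : Type) (r : seq I) (P : pred I) (F : I -> rat) : (forall i, P i -> 0 <= F i <= 1) ->
  0 <= \prod_(i <- r | P i) (1 - F i) <= 1 /\ 1 - \sum_(i <- r | P i) F i <= \prod_(i <- r | P i) (1 - F i).
Proof.
move=> h; elim: r => [|i r IH]; first by rewrite !big_nil subr0 ler01 lexx.
rewrite !big_cons; case: ifP => // Pi; have /andP [x0 x1] := h i Pi.
have s0 : 0 <= \sum_(i <- r | P i) F i by apply: sumr_ge0 => j /h /andP [].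
move: IH s0 x0 x1; move: (\prod_(_ <- _ | _) _) (\sum_(_ <- _ | _) _) (F i) => p s x; clear.
by move=> [/andP [p0 p1] ps] s0 x0 x1; split; [apply/andP; split; nra|nra].
Qed.

(** The product is convex in [t], and the right side is its chord between [t = 0] and [t = 1]. *)
Lemma prod_scaled_le (I : Type) (r : seq I) (P : pred I) (y : I -> rat) (t : rat) :
  0 <= t <= 1 -> (forall i, P i -> 0 <= y i) ->
  1 <= \prod_(i <- r | P i) (1 + y i) /\
  \prod_(i <- r | P i) (1 + y i * t) <= 1 + t * (\prod_(i <- r | P i) (1 + y i) - 1).
Proof.
move=> /andP [t0 t1] h; elim: r => [|i r [IH1 IH2]]; first by rewrite !big_nil; split; lra.
rewrite !big_cons; case: ifP => // Pi; have y0 := h i Pi.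
move: IH1 IH2 y0; set p := \prod_(_ <- _ | _) _; set q := \prod_(_ <- _ | _) _ => IH1 IH2 y0.
split; first by nra.
apply: (@le_trans _ _ ((1 + y i * t) * (1 + t * (p - 1)))); first by apply: ler_wpM2l => //; nra.
have : 0 <= t * (1 - t) * y i * (p - 1) by rewrite !mulr_ge0 ?subr_ge0.
lra.
Qed.

Definition ratio (f : nat * nat) : rat := (sg f.1 f.2)%:R / f.1%:R ^+ f.2.
Definition full_ratio (f : nat * nat) : rat := f.1%:R / f.1.-1%:R.

Lemma full_ratioE f : (1 < f.1)%N -> full_ratio f = 1 + (f.1.-1%:R)^-1.
Proof.
move=> f1; rewrite /full_ratio -{1}(prednK (ltnW f1)) -natr1 mulrDl mul1r divff //.
by rewrite pnatr_eq0 -lt0n -subn1 subn_gt0.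
Qed.

Lemma ratioE f : (1 < f.1)%N -> ratio f = full_ratio f * (1 - f.1%:R^-1 ^+ f.2.+1).
Proof.
case: f => p e /= p1; rewrite /ratio /full_ratio /=.
have p0 : p%:R != 0 :> rat by rewrite pnatr_eq0 -lt0n ltnW.
have q0 : p.-1%:R != 0 :> rat by rewrite pnatr_eq0 -lt0n -subn1 subn_gt0.
have h : p.-1%:R * (sg p e)%:R = p%:R ^+ e.+1 - 1 :> rat.
  by rewrite -natrM sg_mul ?(ltnW p1) // natrB ?expn_gt0 ?(ltnW p1) // natrX.
have -> : (sg p e)%:R = (p%:R ^+ e.+1 - 1) / p.-1%:R :> rat by rewrite -h mulrC mulKf.
have E0 : p%:R ^+ e != 0 :> rat by rewrite expf_neq0.
rewrite exprVn exprS; move: (p%:R ^+ e) E0 (p.-1%:R) q0 (p%:R) p0 => E E0 q q0 p' p0'; field.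
by rewrite q0 p0' expf_neq0.
Qed.

Lemma ratio_ge f : (0 < f.1)%N -> (0 < f.2)%N -> 1 + f.1%:R^-1 <= ratio f.
Proof.
case: f => p [//|e] /= p0 _; rewrite /ratio /=.
have pp : 0 < p%:R :> rat by rewrite ltr0n.
rewrite ler_pdivlMr ?exprn_gt0 // mulrDl mul1r exprS mulKf ?gt_eqF // sgS natrD natrX exprS addrC.
by rewrite lerD2r -natrX ler_nat leq_sg.
Qed.

Lemma ratio_gt1 f : (0 < f.1)%N -> (0 < f.2)%N -> 1 < ratio f.
Proof.
move=> f1 f2; apply: lt_le_trans (ratio_ge f1 f2).
by rewrite ltrDl invr_gt0 ltr0n.
Qed.

Lemma ratio_le f : (1 < f.1)%N -> ratio f <= full_ratio f.
Proof.
move=> f1; rewrite ratioE // -[leRHS]mulr1; apply: ler_wpM2l; first by rewrite divr_ge0.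
by rewrite lerBlDr lerDl exprn_ge0 // invr_ge0.
Qed.

(* The primes of [B] fall short of their full Euler factor by the [p ^ - (e+1)]; one prime [q] in [C] not exceeding
   their divisor sums outweighs all of them, as the full Euler factors have product less than 2 by parity. *)
Lemma half_balance (B C : seq (nat * nat)) :
  (forall f, f \in B -> odd f.1 /\ (1 < f.1)%N) -> (forall f, f \in C -> (0 < f.1)%N /\ (0 < f.2)%N) ->
  \prod_(f <- B) full_ratio f <= 2 ->
  (B != [::] -> exists2 f, f \in C & forall g, g \in B -> (f.1 <= sg g.1 g.2)%N) ->
  1 <= \prod_(f <- B) (1 - f.1%:R^-1 ^+ f.2.+1) * \prod_(f <- C) ratio f ?= iff (B ++ C == [::]).
Proof.
move=> hB hC B2 hBC.
have [B0|Bn] := eqVneq B [::].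
  rewrite B0 big_nil mul1r /=; apply/leifP; case: eqVneq => [->|Cn]; first by rewrite big_nil.
  case: C hC {hBC} Cn => // f C hC _; rewrite big_cons.
  have [f1 f2] := hC f (mem_head _ _).
  have h1 := ratio_gt1 f1 f2.
  have h2 : 1 <= \prod_(f <- C) ratio f.
    rewrite big_seq; apply: prod_ge1 => g gC.
    have [g1 g2] := hC g (mem_behead (s := f :: C) gC); exact: ltW (ratio_gt1 g1 g2).
  by apply: lt_le_trans (h1) _; rewrite ler_peMr //; apply: ltW; apply: lt_trans ltr01 h1.
have [q qC hq] := hBC Bn; have [q1 q2] := hC q qC.
have -> : (B ++ C == [::]) = false by case: (B) Bn.
apply/leifP.
have t0 : 0 < q.1%:R^-1 :> rat by rewrite invr_gt0 ltr0n.
have t1 : q.1%:R^-1 <= 1 :> rat by rewrite invf_le1 ?ltr0n // ler1n.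
set t := q.1%:R^-1 in t0 t1.
have strict : \prod_(f <- B) full_ratio f < 2.
  rewrite lt_neqAle B2 andbT; apply/negP => /eqP E.
  have E1 : \prod_(f <- B) (f.1%:R : rat) = 2 * \prod_(f <- B) f.1.-1%:R.
    rewrite -E big_seq [in RHS]big_seq [X in _ = _ * X]big_seq -big_split; apply: eq_bigr => f /hB [_ f1] /=.
    by rewrite /full_ratio divfK // pnatr_eq0 -lt0n -subn1 subn_gt0.
  move: E1; rewrite -!natr_prod -natrM => /eqP; rewrite eqr_nat => /eqP E1.
  have : odd (\prod_(f <- B) f.1) by rewrite big_seq; apply: (big_ind odd) => [//|x y|f /hB []//]; rewrite oddM => ->.
  by rewrite E1 oddM.
have hy : \prod_(f <- B) (1 + f.1.-1%:R^-1 * t) < 1 + t.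
  have t01 : 0 <= t <= 1 by rewrite (ltW t0).
  have y0 (f : nat * nat) : true -> 0 <= f.1.-1%:R^-1 :> rat by rewrite invr_ge0.
  have [_ h] := @prod_scaled_le _ B xpredT _ t t01 y0.
  have e : \prod_(f <- B) (1 + f.1.-1%:R^-1) = \prod_(f <- B) full_ratio f :> rat.
    by apply: eq_big_seq => f /hB [_ f1]; rewrite full_ratioE.
  apply: (le_lt_trans h); rewrite e ltrD2l -[ltRHS]mulr1 ltr_pM2l // ltrBlDr.
  exact: strict.
(* With [N = p^(e+1)], [w = p - 1] and [S = sg p e], the factor is [(w S + S t) / N] with
   [N = w S + 1], and [S t >= 1] because [q] does not exceed [S]. *)
have hg : 1 <= \prod_(f <- B) (1 - f.1%:R^-1 ^+ f.2.+1) * \prod_(f <- B) (1 + f.1.-1%:R^-1 * t).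
  rewrite -big_split big_seq; apply: prod_ge1 => -[p e] fB /=; have [_ /= p1] := hB _ fB.
  have St : 1 <= (sg p e)%:R * t by rewrite ler_pdivlMr ?ltr0n // mul1r ler_nat (hq _ fB).
  have w0 : 0 < p.-1%:R :> rat by rewrite ltr0n -subn1 subn_gt0.
  have N0 : 0 < p%:R ^+ e.+1 :> rat by rewrite exprn_gt0 // ltr0n ltnW.
  have hN : p%:R ^+ e.+1 = p.-1%:R * (sg p e)%:R + 1 :> rat.
    by rewrite -natrM sg_mul ?(ltnW p1) // natrB ?expn_gt0 ?(ltnW p1) // natrX subrK.
  rewrite exprVn; move: (p%:R ^+ e.+1) (p.-1%:R) ((sg p e)%:R) hN N0 w0 St => N w S hN N0 w0 St.
  have -> : (1 - N^-1) * (1 + w^-1 * t) = (w * S + S * t) / N.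
    by rewrite hN; field; rewrite -hN !gt_eqF.
  by rewrite ler_pdivlMr // mul1r hN lerD2l.
have hc : 1 + t <= \prod_(f <- C) ratio f.
  rewrite (big_rem q) //=; apply: le_trans (ratio_ge q1 q2) _.
  have r0 : 0 <= ratio q by rewrite divr_ge0 // exprn_ge0.
  rewrite ler_peMr // big_seq; apply: prod_ge1 => g /mem_rem /hC [g1 g2].
  exact: ltW (ratio_gt1 g1 g2).
have X0 : 0 < \prod_(f <- B) (1 - f.1%:R^-1 ^+ f.2.+1) :> rat.
  rewrite big_seq; apply: prodr_gt0 => f /hB [_ f1].
  by rewrite subr_gt0 exprn_ilt1 // ?invr_ge0 // invf_lt1 ?ltr1n // ltr0n ltnW.
apply: (le_lt_trans hg); rewrite ltr_pM2l //; exact: lt_le_trans hy hc.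
Qed.

Definition elements (n : nat) : seq (nat * nat) := [seq (p, logn p n) | p <- primes n].

Lemma mem_elements n f : f \in elements n ->
  [/\ f.1 \in primes n, f.2 = logn f.1 n, (1 < f.1)%N & (0 < f.2)%N].
Proof.
case/mapP => p pn -> /=; rewrite logn_gt0 pn; split=> //.
by move: pn; rewrite mem_primes => /and3P [/prime_gt1].
Qed.

Lemma prod_ratio n : (0 < n)%N -> \prod_(f <- elements n) ratio f = (sigma n)%:R / n%:R.
Proof.
move=> n0; rewrite big_map /ratio /= big_split /= -natr_prod -sigma_prod; congr (_ * _).
rewrite prodfV; congr (_^-1); rewrite [in RHS](prod_primes n0) natr_prod.
by apply: eq_bigr => p _; rewrite natrX.
Qed.

Lemma size_elements_le n X : (size [seq f <- elements n | f.1 <= X] <= X)%N.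
Proof.
rewrite -(size_map fst) -[leqRHS](size_iota 1 X); apply: uniq_leq_size.
  rewrite filter_map -map_comp map_inj_uniq ?filter_uniq ?primes_uniq //.
move=> p /mapP [f]; rewrite mem_filter => /andP [fX /mem_elements [_ _ f1 _]] ->.
by rewrite mem_iota add1n ltnS fX (ltnW f1).
Qed.

Lemma exists_min_fst (s : seq (nat * nat)) : s != [::] ->
  exists2 f, f \in s & forall g, g \in s -> (f.1 <= g.1)%N.
Proof.
elim: s => // f s IH _; have [->|sn] := eqVneq s [::].
  by exists f; rewrite ?mem_head // => g; rewrite inE => /eqP ->.
have [g gs hg] := IH sn; have [fg|gf] := leqP f.1 g.1.
  exists f; rewrite ?mem_head // => g'; rewrite inE => /orP [/eqP -> //|/hg]; exact: leq_trans.
exists g; rewrite ?inE ?gs ?orbT // => g'; rewrite inE => /orP [/eqP ->|/hg //]; exact: ltnW.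
Qed.

(** [n - 2 d] is an integer, so a fraction with denominator at most [Q] that differs from 2 differs
    by at least [1 / Q]; [G] and [H] are too close to 1 for that. *)
Lemma near_two (n d Q : nat) (G H u v : rat) : (0 < d)%N -> (d <= Q)%N ->
  n%:R / d%:R * (G * H) = 2 -> G <= 1 -> 1 - u <= G -> 1 <= H -> H * (1 - v) <= 1 ->
  0 <= u -> 0 <= v -> 8 * Q%:R * u <= 1 -> 8 * Q%:R * v <= 1 -> n%:R / d%:R = 2 :> rat.
Proof.
move=> d0 dQ E G1 Gu H1 Hv u0 v0 hu hv.
have d0' : 0 < d%:R :> rat by rewrite ltr0n.
have dQ' : d%:R <= Q%:R :> rat by rewrite ler_nat.
have d1' : 1 <= d%:R :> rat by rewrite ler1n.
have E' : n%:R * G * H = 2 * d%:R.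
  by rewrite -E; field; rewrite gt_eqF.
have n0 : 0 <= n%:R :> rat by [].
have du : d%:R * u <= Q%:R * u by apply: ler_wpM2r.
have dv : d%:R * v <= Q%:R * v by apply: ler_wpM2r.
case: (ltngtP n (2 * d)%N) => [h|h|->]; last by rewrite natrM mulfK // gt_eqF.
  have {}h : n%:R + 1 <= 2 * d%:R :> rat by rewrite natr1 -natrM ler_nat.
  have H0 : 0 <= H by lra.
  have v1 : v <= 1 by nra.
  have h1 : n%:R * G * H <= n%:R * H by apply: ler_wpM2r => //; rewrite ler_piMr.
  have h2 : n%:R * H * (1 - v) <= n%:R * 1 by rewrite -mulrA; apply: ler_wpM2l.
  have h3 : 2 * d%:R * (1 - v) <= n%:R * H * (1 - v) by apply: ler_wpM2r; rewrite ?subr_ge0 // -E'.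
  nra.
have {}h : 2 * d%:R + 1 <= n%:R :> rat by rewrite -natrM natr1 ler_nat.
have u1 : u <= 1 by nra.
have G0 : 0 <= G by lra.
have h1 : n%:R * G <= n%:R * G * H by rewrite ler_peMr // mulr_ge0.
have h2 : (2 * d%:R + 1) * (1 - u) <= n%:R * G by apply: ler_pM => //; lra.
nra.
Qed.

Definition gapped (X Y n : nat) := forall p, p \in primes n ->
  (p <= X)%N /\ ((logn p n <= X)%N \/ (Y < logn p n)%N) \/ (Y < p)%N.
Definition tail (Y n : nat) : rat := \sum_(p <- primes n | (Y < p)%N) p.-1%:R^-1.
(** Each side has at most [X] primes up to [X], and each of them contributes at most [X^X] to the
    denominator. *)
Definition gap_height (X : nat) : nat := ((X ^ X) ^ (X + X))%N.

Lemma le1_of_scaled (q w : rat) : 1 <= q -> 0 <= w -> 8 * q * w <= 1 -> w <= 1.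
Proof. nra. Qed.

Lemma mul_le2 (x y : rat) : 1 <= x -> 1 <= y -> x * y <= 2 -> x <= 2 /\ y <= 2.
Proof. by move=> x1 y1 h; split; nra. Qed.

Lemma mul_eq1 (x y : rat) : 1 <= x -> 1 <= y -> x * y = 1 -> (1 == x) && (1 == y).
Proof. by move=> x1 y1 h; rewrite !eq_le x1 y1 /=; apply/andP; split; nra. Qed.

Section Gap.
Variables (X Y : nat).
Hypotheses (X2 : (2 <= X)%N) (XY : (lte_bound X <= Y)%N) (X_lt_Y : (X <= Y)%N).
Let PA (f : nat * nat) := (f.1 <= X)%N && (f.2 <= X)%N.
Let PB (f : nat * nat) := (f.1 <= X)%N && (X < f.2)%N.
Let PC (f : nat * nat) := (X < f.1)%N.

(** An exponent above [lte_bound X] prevents [sg p e] from being smooth, so it has a prime factor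
    above [X], which divides [b]. The least prime of [b] above [X] then serves for all elements at
    once. *)
Lemma gap_witness a b c d : amicable a b c d -> gapped X Y a -> gapped X Y b ->
  seq.filter PB (elements a) != [::] ->
  exists2 f, f \in seq.filter PC (elements b) & forall g, g \in seq.filter PB (elements a) -> (f.1 <= sg g.1 g.2)%N.
Proof.
move=> h ga gb Bn.
have wit g : g \in seq.filter PB (elements a) -> exists2 f, f \in seq.filter PC (elements b) & (f.1 <= sg g.1 g.2)%N.
  rewrite mem_filter => /andP [/andP [gX Xg] /mem_elements [g1 g2 g3 g4]].
  have Yg : (Y < g.2)%N.
    case: (ga _ g1) => [[_ []]|]; rewrite -?g2 //; first by rewrite leqNgt Xg.
    by move=> /(leq_ltn_trans X_lt_Y); rewrite ltnNge gX.
  have /existsP [q] : [exists q : 'I_(sg g.1 g.2).+1, [&& prime q, (q %| sg g.1 g.2)%N & (X < q)%N]].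
    apply: contraTT Yg; rewrite negb_exists => /forallP hq; rewrite -leqNgt; apply: leq_trans XY.
    apply: (@sg_smooth_exponent X g.1) => // q pq dq; rewrite leqNgt; apply/negP => Xq.
    have qs : (q < (sg g.1 g.2).+1)%N by rewrite ltnS dvdn_leq // sg_gt0.
    by have := hq (Ordinal qs); rewrite /= pq dq Xq.
  case/and3P => pq dq Xq; exists (val q, logn q b); last by rewrite -ltnS ltn_ord.
  rewrite mem_filter /PC /= Xq; apply: map_f.
  have dq' : (q %| sg g.1 (logn g.1 a))%N by rewrite -g2.
  have /orP [/eqP q2|//] := amicable_prime h g1 pq dq'.
  by move: Xq; rewrite q2 ltnNge X2.
have Cn : seq.filter PC (elements b) != [::].
  case: (seq.filter PB (elements a)) Bn wit => // g s _ /(_ g (mem_head _ _)) [f fC _].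
  by apply: contraTneq fC => ->.
have [f fC fmin] := exists_min_fst Cn; exists f => // g /wit [f' /fmin h1 h2]; exact: leq_trans h1 h2.
Qed.

(* The small prime powers together with the full Euler factors of the small primes with large exponent have a rational
   product with denominator at most [gap_height X] and very close to 2, hence equal to 2. Then the deficit of
   [PB] and the surplus of [PC] balance, which [half_balance] excludes unless both are absent. *)
Theorem gap a b c d : amicable a b c d -> gapped X Y a -> gapped X Y b ->
  (16 * X * gap_height X <= 2 ^ Y)%N -> 8 * (gap_height X)%:R * (tail Y a + tail Y b) <= 1 ->
  forall n, (n == a) || (n == b) -> forall p, p \in primes n -> (p <= X)%N /\ (logn p n <= X)%N.
Proof.
move=> h ga gb hY htail.
have h' := amicable_sym h; have a0 := amicable_gt0 h; have b0 := amicable_gt0 h'.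
pose U := elements a ++ elements b.
have hU f : f \in U -> [/\ odd f.1, (1 < f.1)%N, (0 < f.2)%N, PB f -> (Y < f.2)%N & PC f -> (Y < f.1)%N].
  have side n : odd n -> gapped X Y n -> f \in elements n ->
      [/\ odd f.1, (1 < f.1)%N, (0 < f.2)%N, PB f -> (Y < f.2)%N & PC f -> (Y < f.1)%N].
    move=> on gn /mem_elements [f1 f2 f3 f4]; split=> //; first exact: odd_prime_of f1.
      case/andP => fX Xf; case: (gn _ f1) => [[_ []]|]; rewrite -?f2 //; first by rewrite leqNgt Xf.
      by move=> /(leq_ltn_trans X_lt_Y); rewrite ltnNge fX.
    by rewrite /PC => Xf; case: (gn _ f1) => [[]|//]; rewrite leqNgt Xf.
  rewrite mem_cat => /orP []; apply: side => //; [exact: (am_odd_l h)|exact: (am_odd_r h)].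
have total : \prod_(f <- U) ratio f = 2.
  rewrite big_cat /= !prod_ratio // (am_sigma_l h) (am_sigma_r h) !natrM.
  have <- : c%:R * d%:R = 2 :> rat by rewrite -natrM (am_two h).
  by field; rewrite !pnatr_eq0 -!lt0n a0 b0.
have split3 F : \prod_(f <- U) F f = \prod_(f <- U | PA f) F f * \prod_(f <- U | PB f) F f * \prod_(f <- U | PC f) F f :> rat.
  rewrite (bigID (fun f : nat * nat => f.1 <= X)%N) /= (bigID (fun f : nat * nat => f.2 <= X)%N) /=.
  by congr (_ * _ * _); apply: eq_bigl => f; rewrite /PB /PC -ltnNge.
pose G := \prod_(f <- U | PB f) (1 - f.1%:R^-1 ^+ f.2.+1) : rat.
pose H := \prod_(f <- U | PC f) ratio f.
pose n := (\prod_(f <- U | PA f) sg f.1 f.2 * \prod_(f <- U | PB f) f.1)%N.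
pose m := (\prod_(f <- U | PA f) f.1 ^ f.2 * \prod_(f <- U | PB f) f.1.-1)%N.
have fullB : \prod_(f <- U | PB f) ratio f = \prod_(f <- U | PB f) full_ratio f * G.
  rewrite -big_split big_seq_cond [RHS]big_seq_cond; apply: eq_bigr => f /andP [/hU [_ f1 _ _ _] _].
  by rewrite ratioE.
have nmE : n%:R / m%:R = \prod_(f <- U | PA f) ratio f * \prod_(f <- U | PB f) full_ratio f.
  rewrite /n /m !natrM !natr_prod invfM mulrACA -!prodfV -!big_split /=; congr (_ * _).
  by apply: eq_bigr => f _; rewrite /ratio natrX.
have eq2 : n%:R / m%:R * (G * H) = 2 by rewrite nmE -total split3 fullB !mulrA.
have m0 : (0 < m)%N.
  rewrite /m muln_gt0; apply/andP; split; rewrite big_seq_cond; apply: prodn_cond_gt0 => f /andP [/hU [_ f1 _ _ _] _].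
    by rewrite expn_gt0 ltnW.
  by rewrite -subn1 subn_gt0.
have sU : (size [seq f <- U | f.1 <= X] <= X + X)%N.
  by rewrite filter_cat size_cat leq_add // size_elements_le.
have mQ : (m <= gap_height X)%N.
  have X1 : (1 <= X ^ X)%N by rewrite expn_gt0 (ltnW X2).
  apply: (@leq_trans (\prod_(f <- U | (f.1 <= X)%N) X ^ X)).
    rewrite /m [X in (_ <= X)%N](bigID (fun f : nat * nat => f.2 <= X)%N) /=.
    apply: leq_mul.
      apply: leq_prod => f /andP [f1 f2]; apply: leq_trans (leq_expl _ f1) _.
      by rewrite leq_pexp2l // ltnW.
    rewrite [X in (_ <= X)%N](eq_bigl PB) => [|f]; last by rewrite /PB -ltnNge.
    apply: leq_prod => f /andP [f1 _]; apply: leq_trans (leq_pred _) (leq_trans f1 _).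
    by rewrite -[X in (X <= _)%N]expn1 leq_pexp2l // ltnW.
  rewrite -big_filter big_const_seq count_predT iter_muln_1 /gap_height leq_pexp2l //.
have hG : forall f, f \in U -> PB f -> 0 <= (f.1%:R^-1 ^+ f.2.+1 : rat) <= 2^-1 ^+ Y.
  move=> f /hU [_ f1 _ fB _] /fB Yf; rewrite exprn_ge0 ?invr_ge0 //=.
  apply: (@le_trans _ _ (2^-1 ^+ f.2.+1)).
    by apply: lerXn2r; rewrite ?nnegrE ?invr_ge0 // lef_pV2 ?posrE ?ltr0n ?ler_nat // ltnW.
  by apply: ler_wiXn2l; rewrite ?invr_ge0 ?invf_le1 ?ler1n // ltnW // leqW.
have inU (V : nmodType) (P : pred (nat * nat)) (F : nat * nat -> V) :
    \sum_(f <- U | P f) F f = \sum_(f <- U | (f \in U) && P f) F f by rewrite big_seq_cond.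
have inUp (P : pred (nat * nat)) (F : nat * nat -> rat) :
    \prod_(f <- U | P f) F f = \prod_(f <- U | (f \in U) && P f) F f by rewrite big_seq_cond.
have y1 : 2^-1 ^+ Y <= 1 :> rat by apply: exprn_ile1; rewrite ?invr_ge0 ?invf_le1 ?ler1n.
pose u := \sum_(f <- U | (f \in U) && PB f) f.1%:R^-1 ^+ f.2.+1 : rat.
have [/andP [_ G1] Gu] : 0 <= G <= 1 /\ 1 - u <= G.
  rewrite /G inUp; apply: prod_sub1_ge => f /andP [fU fB].
  by have /andP [-> hf] := hG f fU fB; apply: (le_trans hf).
have u0 : 0 <= u by apply: sumr_ge0 => f /andP [fU fB]; have /andP [] := hG f fU fB.
have uY : u <= (X + X)%:R * 2^-1 ^+ Y.
  apply: (@le_trans _ _ (\sum_(f <- U | (f.1 <= X)%N) 2^-1 ^+ Y)).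
    rewrite /u big_mkcond [leRHS]big_mkcond /=; apply: ler_sum => f _.
    have y0 : 0 <= 2^-1 ^+ Y :> rat by rewrite exprn_ge0 // invr_ge0.
    case: ifP => [/andP [fU fB]|_]; last by case: ifP.
    by have /andP [-> _] := fB; have /andP [] := hG f fU fB.
  rewrite -big_filter big_const_seq count_predT iter_addr_0 -[_ *+ _]mulr_natl.
  by apply: ler_wpM2r; rewrite ?exprn_ge0 ?invr_ge0 // ler_nat.
have hu : 8 * (gap_height X)%:R * u <= 1.
  apply: (@le_trans _ _ (8 * (gap_height X)%:R * ((X + X)%:R * 2^-1 ^+ Y))); first by apply: ler_wpM2l => //; apply: mulr_ge0.
  rewrite !mulrA -!natrM exprVn ler_pdivrMr ?exprn_gt0 // mul1r -natrX ler_nat; apply: leq_trans hY.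
  by clear; nia.
pose v := \sum_(f <- U | (f \in U) && PC f) f.1.-1%:R^-1 : rat.
have v0 : 0 <= v by apply: sumr_ge0 => f _; rewrite invr_ge0.
have vE : v = tail Y a + tail Y b.
  rewrite /v (eq_bigl (fun f => (f \in U) && (Y < f.1)%N)); last first.
    move=> f; case fU: (f \in U) => //=; apply/idP/idP; first by have [_ _ _ _ h2] := hU f fU.
    exact: leq_ltn_trans.
  by rewrite -(inU _ (fun f => Y < f.1)%N) /U big_cat /=; congr (_ + _); rewrite big_map.
have hv : 8 * (gap_height X)%:R * v <= 1 by rewrite vE.
have H1 : 1 <= H.
  rewrite /H inUp; apply: prod_ge1 => f /andP [/hU [_ f1 f2 _ _] _].
  by apply: ltW; apply: ratio_gt1 => //; apply: ltnW.
have Hv : H * (1 - v) <= 1.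
  have v1 : v <= 1.
    have : 1 <= (gap_height X)%:R :> rat by rewrite ler1n !expn_gt0 (ltnW X2).
    by move=> q1; apply: le1_of_scaled q1 v0 hv.
  apply: le_trans (prod_add1_le U (P := fun f => (f \in U) && PC f) (F := fun f => f.1.-1%:R^-1) _); last by move=> f _; rewrite invr_ge0.
  apply: ler_wpM2r; first by rewrite subr_ge0.
  rewrite /H inUp; apply: ler_prod => f /andP [/hU [_ f1 _ _ _] _].
  rewrite divr_ge0 ?exprn_ge0 //= -full_ratioE //; exact: ratio_le.
have two := near_two m0 mQ eq2 G1 Gu H1 Hv u0 v0 hu hv.
have GH : G * H = 1.
  by move: eq2; rewrite two => /(congr1 (fun z => 2^-1 * z)); rewrite mulrA mulVf // mul1r.
(* Deficits of one side are paired with surpluses of the other, since the large prime factors of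
   [sg p e] appear on the opposite side. Both products are at least 1, and together they give
   [G * H = 1]. *)
pose Ba := seq.filter PB (elements a); pose Bb := seq.filter PB (elements b).
pose Ca := seq.filter PC (elements a); pose Cb := seq.filter PC (elements b).
have full2 (B : seq (nat * nat)) : {subset B <= U} -> 1 <= \prod_(f <- B) full_ratio f.
  move=> BU; rewrite big_seq; apply: prod_ge1 => f /BU /hU [_ f1 _ _ _].
  by rewrite full_ratioE // lerDl invr_ge0.
have sBa : {subset Ba <= U} by move=> f; rewrite mem_filter mem_cat => /andP [_ ->].
have sBb : {subset Bb <= U} by move=> f; rewrite mem_filter mem_cat orbC => /andP [_ ->].
have sCa : {subset Ca <= U} by move=> f; rewrite mem_filter mem_cat => /andP [_ ->].
have sCb : {subset Cb <= U} by move=> f; rewrite mem_filter mem_cat orbC => /andP [_ ->].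
have fab : \prod_(f <- Ba) full_ratio f * \prod_(f <- Bb) full_ratio f <= 2.
  rewrite -two nmE -big_cat -filter_cat big_filter /= ler_peMl //.
    by rewrite -big_filter; apply: le_trans (full2 _ _) => // f; rewrite mem_filter => /andP [].
  by rewrite inUp; apply: prod_ge1 => f /andP [/hU [_ f1 f2 _ _] _]; apply: ltW; apply: ratio_gt1 => //; apply: ltnW.
have fa := full2 Ba sBa; have fb := full2 Bb sBb.
have hB (B : seq (nat * nat)) : {subset B <= U} -> forall f, f \in B -> odd f.1 /\ (1 < f.1)%N.
  by move=> BU f /BU /hU [].
have hC (C : seq (nat * nat)) : {subset C <= U} -> forall f, f \in C -> (0 < f.1)%N /\ (0 < f.2)%N.
  by move=> CU f /CU /hU [_ /ltnW].
have [fa2 fb2] := mul_le2 fa fb fab.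
have [l1 e1] := half_balance (hB Ba sBa) (hC Cb sCb) fa2 (gap_witness h ga gb).
have [l2 e2] := half_balance (hB Bb sBb) (hC Ca sCa) fb2 (gap_witness h' gb ga).
have prod1 : (\prod_(f <- Ba) (1 - f.1%:R^-1 ^+ f.2.+1) * \prod_(f <- Cb) ratio f) *
             (\prod_(f <- Bb) (1 - f.1%:R^-1 ^+ f.2.+1) * \prod_(f <- Ca) ratio f) = 1 :> rat.
  transitivity (G * H); last exact: GH.
  rewrite mulrACA [X in _ * X = _]mulrC /G /H /U; congr (_ * _).
    by rewrite -big_cat -filter_cat big_filter.
  by rewrite -big_cat -filter_cat big_filter.
have /andP [E1 E2] := mul_eq1 l1 l2 prod1.
move: e1 e2; rewrite E1 E2 => /esym /eqP e1 /esym /eqP e2.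
have none n' p : p \in primes n' -> seq.filter PB (elements n') = [::] -> seq.filter PC (elements n') = [::] ->
    (p <= X)%N /\ (logn p n' <= X)%N.
  move=> pn B0 C0; have fE : (p, logn p n') \in elements n' by apply: map_f.
  have nC : ~~ PC (p, logn p n').
    apply/negP => hp; have : (p, logn p n') \in seq.filter PC (elements n') by rewrite mem_filter hp.
    by rewrite C0.
  have pX : (p <= X)%N by move: nC; rewrite /PC /= -leqNgt.
  split=> //; rewrite leqNgt; apply/negP => hp.
  have : (p, logn p n') \in seq.filter PB (elements n') by rewrite mem_filter /PB /= pX hp.
  by rewrite B0.
have nilcat (s t : seq (nat * nat)) : s ++ t = [::] -> s = [::] /\ t = [::] by case: s.
have [Ba0 Cb0] := nilcat _ _ e1; have [Bb0 Ca0] := nilcat _ _ e2.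
by move=> n' /orP [] /eqP -> p pn; apply: none.
Qed.
End Gap.

(** * Levels hit by primes and exponents *)

Local Open Scope nat_scope.

(** One summand per requirement: start of the density bound, exponents of smooth primes, lower bound
    in [thue_pair], the ratio 256 there, the two smallness conditions of [gap], and
    [next_level_heavy]. The base 16 of [next_level] matches the shells of [tail_sum]. *)
Definition level_exponent (k X : nat) : nat :=
  tail_start k + lte_bound X + 1000 * lte_bound X ^ 2 + 512 * X
  + 16 * X * gap_height X + 8 * k.+1 * gap_height X + X * 2 ^ (heavy_sep k.+1 * X.+1).
Definition next_level (k X : nat) : nat := 16 ^ level_exponent k X.
Definition patterns (X : nat) : nat :=
  (lte_bound X).+1 * ((lte_bound X).+1 * X`!) * (16 * X.+1).+1 ^ X.+1.
(** In order: exponents of [a]; primes and exponents with a rough [sg]; the odd exponent; patterns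
    for each parity of the level; one level to spare and one at either end. *)
Definition level_count (k X : nat) : nat := k + 2 * k.+1 ^ 2 + 1 + 2 * patterns X + 3.

Lemma leq_next_level k X n : n <= level_exponent k X -> 2 ^ n <= next_level k X.
Proof.
move=> h; apply: (@leq_trans (2 ^ level_exponent k X)); first by rewrite leq_exp2l.
exact: leq_expl.
Qed.

Lemma next_level_props k X : [/\ X <= next_level k X, lte_bound X <= next_level k X,
    2 ^ (1000 * lte_bound X ^ 2) <= next_level k X, (2 * X) ^ 256 <= next_level k X
  & 16 * X * gap_height X <= 2 ^ next_level k X].
Proof.
have h n : n <= level_exponent k X -> n <= next_level k X.
  by move=> hn; apply: leq_trans (ltnW (ltn_expl n (ltnSn 1))) (leq_next_level hn).
have ex : 512 * X <= level_exponent k X by rewrite /level_exponent; clear; lia.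
have e1 : X <= level_exponent k X by apply: leq_trans ex; rewrite leq_pmull.
split.
- exact: h.
- by apply: h; rewrite /level_exponent; clear; lia.
- by apply: leq_next_level; rewrite /level_exponent; clear; lia.
- apply: leq_trans (leq_next_level ex); rewrite (_ : 512 = 2 * 256) // -mulnA (mulnC 256) mulnA [X in _ <= X]expnM.
  by apply: leq_expl; apply: ltnW; apply: ltn_expl.
apply: leq_trans (ltnW (ltn_expl _ (ltnSn 1))).
by apply: h; rewrite /level_exponent; clear; lia.
Qed.

Lemma next_level_heavy k X l e : l <= X -> 0 < X -> next_level k X < sg l e -> 1 < l ->
  2 ^ (heavy_sep k.+1 * X.+1) <= e.+1.
Proof.
move=> lX X0 hY l1.
have h1 : sg l e <= 2 ^ (X * e.+1).
  apply: leq_trans (ltnW (sg_lt e l1)) _; apply: (@leq_trans (l ^ e.+1)); first by rewrite expnS leq_mul2r l1 orbT.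
  by rewrite expnM; apply: leq_expl; apply: leq_trans lX _; apply: ltnW; apply: ltn_expl.
have h2 : X * 2 ^ (heavy_sep k.+1 * X.+1) <= level_exponent k X by rewrite /level_exponent; clear; lia.
have := leq_ltn_trans (leq_next_level h2) (leq_trans hY h1).
by rewrite ltn_exp2l // ltn_pmul2l // => /ltnW.
Qed.

Lemma tail_short k Y a : 0 < Y -> omega a <= k -> (tail Y a <= k%:R / Y%:R)%R.
Proof.
move=> Y0 oa; rewrite /tail.
apply: (@le_trans _ _ (\sum_(p <- primes a) Y%:R^-1)%R).
  rewrite big_mkcond /=; apply: ler_sum => p _; case: ifP => [Yp|_]; last by rewrite invr_ge0.
  rewrite lef_pV2 ?posrE ?ltr0n // ?ler_nat; last by rewrite -subn1 subn_gt0 (leq_trans _ Yp).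
  by rewrite -ltnS prednK // (leq_trans _ Yp).
rewrite big_const_seq count_predT iter_addr_0 -[X in (X <= _)%R]mulr_natl; apply: ler_wpM2r; first by rewrite invr_ge0.
by rewrite ler_nat.
Qed.

Lemma tails_small (R : realType) k X a b c d : amicable a b c d -> omega a <= k ->
  (8 * (gap_height X)%:R * (tail (next_level k X) a + tail (next_level k X) b) <= 1)%R.
Proof.
move=> h oa; set i := level_exponent k X.
have hi : tail_start k <= i by rewrite /i /level_exponent; clear; lia.
have i0 : 0 < i by apply: leq_trans hi; rewrite expn_gt0.
have hb : (tail (next_level k X) b <= 2^-1 ^+ i)%R.
  by apply: tail_sum => // j ij; apply: (long_side_count R h oa); apply: leq_trans hi ij.
have ha : (tail (next_level k X) a <= k%:R * 2^-1 ^+ i)%R.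
  apply: le_trans (tail_short _ oa) _; first by rewrite expn_gt0.
  apply: ler_wpM2l => //; rewrite /next_level natrX -exprVn; apply: lerXn2r; rewrite ?nnegrE ?invr_ge0 //.
have h8 : (8 * (gap_height X)%:R * (k.+1)%:R <= 2 ^+ i :> rat)%R.
  rewrite -!natrM -natrX ler_nat; apply: leq_trans (ltnW (ltn_expl i (ltnSn 1))).
  by rewrite /i /level_exponent; clear; lia.
apply: (@le_trans _ _ (8 * (gap_height X)%:R * (k.+1%:R * 2^-1 ^+ i))%R).
  by apply: ler_wpM2l; rewrite ?mulr_ge0 // -natr1 mulrDl mul1r lerD.
by rewrite mulrA exprVn ler_pdivrMr ?exprn_gt0 // mul1r.
Qed.

Section Counting.
Variable X : nat -> nat.
Hypothesis X_le : forall i, X i <= X i.+1.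
Definition hit (vs : seq nat) (i : nat) := has (fun v => X i < v <= X i.+1) vs.

Lemma level_homo i j : i <= j -> X i <= X j.
Proof. exact: (homo_leq leqnn leq_trans X_le). Qed.

Lemma level_unique i j v : X i < v <= X i.+1 -> X j < v <= X j.+1 -> i = j.
Proof.
move=> /andP [h1 h2] /andP [h3 h4]; case: (ltngtP i j) => // ij.
  by have := leq_trans h3 (leq_trans h2 (level_homo ij)); rewrite ltnn.
by have := leq_trans h1 (leq_trans h4 (level_homo ij)); rewrite ltnn.
Qed.

Lemma count_inj_card (F : finType) (P : pred nat) (f : nat -> F) s : uniq s ->
  {in [pred i | P i] &, injective f} -> count P s <= #|F|.
Proof.
move=> us fi; rewrite -size_filter; apply: (size_inj_card (f := f)); first exact: filter_uniq.
by move=> i j; rewrite !mem_filter => /andP [Pi _] /andP [Pj _]; apply: fi.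
Qed.

Lemma count_hit vs s : uniq s -> count (hit vs) s <= size vs.
Proof.
move=> us; case: vs => [|v0 vs]; first by rewrite (eq_count (a2 := pred0)) ?count_pred0.
set w := v0 :: vs; pose f i := find (fun v => X i < v <= X i.+1) w.
rewrite -[leqRHS](card_ord (size w)).
apply: (count_inj_card (f := fun i => inord (f i) : 'I_(size vs).+1)) us _ => i j; rewrite !inE => hi hj.
move/(congr1 val); rewrite /= !inordK; try by rewrite -/(size w) -has_find.
move=> fij; apply: (@level_unique _ _ (nth 0 w (f i))); first exact: (nth_find 0 hi).
by rewrite fij; exact: (nth_find 0 hj).
Qed.
End Counting.

Lemma kappa_le X Q s : 1 < Q -> kappa X Q s <= 16 * X.+1.
Proof.
move=> Q1; rewrite /kappa; set K := 16 * X.+1.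
have v0 : 0 < s ^ (K * logn s Q).
  by rewrite expn_gt0; case: s => //; rewrite lognE /= muln0.
have /andP [h _] := trunc_log_bounds Q1 v0.
rewrite -(leq_exp2l _ _ Q1); apply: leq_trans h _.
rewrite mulnC expnM; apply: leq_expl; apply: dvdn_leq; first exact: ltnW.
have [ps|ns] := boolP (prime s); first by rewrite pfactor_dvdnn.
by rewrite lognE (negbTE ns).
Qed.

Lemma sg_mono_lt_pow x e Z y : 0 < e -> 1 < x -> (2 * x) ^ 256 <= Z -> Z < y -> sg x e ^ 256 <= sg y e.
Proof.
move=> e0 x1 hZ Zy; apply: leq_trans (leq_sg y e).
apply: leq_trans (leq_expl 256 (ltnW (sg_lt e x1))) _.
apply: (@leq_trans (((2 * x) ^ 256) ^ e)); last by apply: leq_expl; apply: leq_trans hZ (ltnW Zy).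
have -> : ((2 * x) ^ 256) ^ e = (2 ^ e * x ^ e) ^ 256 by rewrite -expnMn -!expnM (mulnC 256).
apply: leq_expl; rewrite leq_mul2r; apply/orP; right.
by rewrite -[X in X <= _]expn1 leq_pexp2l.
Qed.

Lemma sg_gt1 x e : 1 < x -> 0 < e -> 1 < sg x e.
Proof.
move=> x1 e0; apply: leq_trans (leq_sg x e); apply: leq_trans (x1) _.
by rewrite -[X in X <= _]expn1 leq_pexp2l // ltnW.
Qed.

Section Unhit.
Variables (R : realType) (k a b c d : nat) (X : nat -> nat) (n : nat).
Hypotheses (h : amicable a b c d) (oa : omega a <= k).
Hypotheses (X02 : 2 <= X 0) (XS : forall i, X i.+1 = next_level k (X i)).
Hypothesis hn : n = level_count k (X 0).
Hypothesis no_prime : forall p, p \in primes a -> p <= X 0 \/ X n < p.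

Let X_le i : X i <= X i.+1.
Proof. by rewrite XS; have [] := next_level_props k (X i). Qed.

Let X_homo i j : i <= j -> X i <= X j := level_homo X_le (i := i) (j := j).

Let m := n.-2.
Let nE : n = m.+2.
Proof. by rewrite /m hn /level_count !addnS. Qed.

Let smoothb l := [forall q : 'I_(sg l (logn l b)).+1, (prime q && (q %| sg l (logn l b))) ==> (q <= X 0)].

Let smoothbP l : reflect (smooth (X 0) (sg l (logn l b))) (smoothb l).
Proof.
apply: (iffP forallP) => [hs q pq dq|hs q]; last first.
  by apply/implyP => /andP [pq dq]; apply: hs.
have qs : q < (sg l (logn l b)).+1 by rewrite ltnS dvdn_leq // sg_gt0.
by have := hs (Ordinal qs); rewrite /= pq dq.
Qed.

Let rough := [seq l <- primes b | (l <= X n.-1) && ~~ smoothb l].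

(** A prime factor of [sg l e] above [X 0] is a prime of [a], hence above [X n]; since [l] is at
    most [X n.-1], one level lower, the exponent is large enough for [heavy_bound]. *)
Lemma size_rough : size rough <= k.+1 ^ 2.
Proof.
have Xn0 : 0 < X n.-1 by apply: leq_trans (ltnW X02) (X_homo (leq0n _)).
pose Sl := 2 :: primes a.
have a2 : 2 \notin primes a by rewrite mem_primes dvdn2 (am_odd_l h) andbF.
apply: (@leq_trans ((omega a).+1 ^ 2)); last by apply: leq_expl.
apply: (@heavy_bound R Sl (omega a).+1 (X n.-1) (X n.-1) rough (fun l => logn l b)) => //.
- by rewrite /= a2 primes_uniq.
- by move=> p; rewrite inE mem_primes => /orP [/eqP -> //|/and3P []].
- by apply: ltnW; apply: ltn_expl.
- by rewrite filter_uniq // primes_uniq.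
move=> l; rewrite mem_filter => /andP [/andP [lX ns] lb].
have pl : prime l by move: lb; rewrite mem_primes => /and3P [].
have hS : Sunit Sl (sg l (logn l b)).
  by move=> p pp hp; rewrite inE; exact: (amicable_prime (amicable_sym h) lb pp hp).
split=> //; first by apply: leq_trans lX _; apply: ltnW; apply: ltn_expl.
have big : X n < sg l (logn l b).
  move: ns; rewrite negb_forall => /existsP [q]; rewrite negb_imply -ltnNge => /andP [/andP [pq dq] qX].
  apply: leq_trans (_ : q <= _); last by rewrite -ltnS.
  have := hS q pq dq; rewrite inE => /orP [/eqP q2|/no_prime [|//]]; last by rewrite leqNgt qX.
  by move: qX; rewrite q2 ltnNge X02.
apply: leq_trans (next_level_heavy (k := k) lX Xn0 _ (prime_gt1 pl)); last first.
  by rewrite -XS prednK //; rewrite nE.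
by rewrite leq_exp2l // leq_mul2r heavy_sep_homo ?orbT.
Qed.

Let F := lte_bound (X 0).
Let evenT l := [&& l \in primes b, smoothb l & ~~ odd (logn l b)].
Let tame i := has (fun l => evenT l && (X i < l <= X i.+1)) (primes b).
Let pick i := nth 0 (primes b) (find (fun l => evenT l && (X i < l <= X i.+1)) (primes b)).

(* Two tame levels of the same parity are so far apart that [thue_pair] forbids equal patterns. *)
Lemma count_tame : count tame (iota 1 m) <= 2 * patterns (X 0).
Proof.
pose Y := X 0.
pose code i : bool * ('I_F.+1 * 'I_(F.+1 * Y`!).-1.+1 * {ffun 'I_Y.+1 -> 'I_(16 * Y.+1).+1}) :=
  (odd i, (inord (logn (pick i) b), inord (pick i %% ((logn (pick i) b).+1 * Y`!)),
    [ffun s : 'I_Y.+1 => inord (kappa Y (sg (pick i) (logn (pick i) b)) s)])).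
have cardE : #|{: bool * ('I_F.+1 * 'I_(F.+1 * Y`!).-1.+1 * {ffun 'I_Y.+1 -> 'I_(16 * Y.+1).+1})}| = 2 * patterns Y.
  by rewrite !card_prod card_bool card_ffun !card_ord prednK // muln_gt0 fact_gt0.
rewrite -cardE -size_filter; apply: (size_inj_card (f := code)); first by rewrite filter_uniq // iota_uniq.
have pickP i : i \in seq.filter tame (iota 1 m) ->
    [/\ 0 < i, pick i \in primes b, smooth Y (sg (pick i) (logn (pick i) b)), ~~ odd (logn (pick i) b) &
        X i < pick i <= X i.+1].
  rewrite mem_filter mem_iota => /andP [ti /andP [i0 _]].
  have /andP [/and3P [p1 /smoothbP p2 p3] p4] := nth_find 0 ti.
  by split.
have facts i : i \in seq.filter tame (iota 1 m) ->
    [/\ 1 < pick i, 2 <= logn (pick i) b, logn (pick i) b <= F & pick i %% ((logn (pick i) b).+1 * Y`!) < F.+1 * Y`!].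
  move=> /pickP [_ pb sm ev _].
  have p1 : 1 < pick i by move: pb; rewrite mem_primes => /and3P [/prime_gt1].
  have e0 : 0 < logn (pick i) b by rewrite logn_gt0.
  have eF : logn (pick i) b <= F by apply: sg_smooth_exponent p1 sm.
  split=> //; first by case: (logn _ _) e0 ev => [|[|]].
  apply: (@leq_trans ((logn (pick i) b).+1 * Y`!)); first by rewrite ltn_mod muln_gt0 fact_gt0.
  by rewrite leq_mul2r ltnS eF orbT.
suff main i j : i \in seq.filter tame (iota 1 m) -> j \in seq.filter tame (iota 1 m) -> i < j -> code i = code j -> False.
  by move=> i j hi hj; case: (ltngtP i j) => // ij /esym ? //; [case: (main i j hi hj ij) | case: (main j i hj hi ij)].
move=> hi hj ij [oij e1 e2 /ffunP e3].
have [i0 ib smi evi /andP [Xi1 Xi2]] := pickP i hi; have [j0 jb smj evj /andP [Xj1 Xj2]] := pickP j hj.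
have [pi1 ei2 eiF ri] := facts i hi; have [pj1 ej2 ejF rj] := facts j hj.
have P0 : 0 < F.+1 * Y`! by rewrite muln_gt0 fact_gt0.
have {}e1 : logn (pick i) b = logn (pick j) b by move/(congr1 val): e1; rewrite /= !inordK.
have {}e2 : pick i = pick j %[mod (logn (pick i) b).+1 * Y`!].
  by move/(congr1 val): e2; rewrite /= !inordK ?prednK // -e1.
(* Equal parity leaves a whole interval between the two levels; adjacent levels could contain primes
   close to each other. *)
have i2j : i.+2 <= j.
  by rewrite ltn_neqAle ij andbT; apply/eqP => E; move: oij; rewrite -E /=; case: (odd i).
have [_ _ l1 _ _] := next_level_props k (X 0).
have [_ _ _ l2 _] := next_level_props k (X i.+1).
have Xij : X i.+2 <= X j by apply: X_homo.
have x_big : 2 ^ (1000 * logn (pick i) b ^ 2) <= pick i.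
  apply: leq_trans (_ : X 1 <= _); last by apply: leq_trans (X_homo i0) (ltnW Xi1).
  by rewrite XS; apply: leq_trans l1; rewrite leq_exp2l // leq_mul2l; apply: leq_expl.
have ltp : pick i <= pick j.
  by apply: leq_trans Xi2 (leq_trans (X_homo (leqnSn _)) (leq_trans Xij (ltnW Xj1))).
rewrite -e1 in smj.
have tp := @thue_pair Y (logn (pick i) b) (pick i) (pick j) ei2 evi x_big ltp e2 smi smj.
suff : sg (pick i) (logn (pick i) b) ^ 256 <= sg (pick j) (logn (pick i) b).
  rewrite leqNgt tp // => s sY.
  have := congr1 val (e3 (Ordinal (sY : s < Y.+1))); rewrite !ffunE /= -e1 !inordK ?ltnS //.
    by apply: kappa_le; apply: sg_gt1 => //; apply: ltnW.
  by apply: kappa_le; apply: sg_gt1 => //; apply: ltnW.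
apply: (@sg_mono_lt_pow _ _ (X i.+2)) => //; first exact: ltnW.
  by rewrite XS; apply: leq_trans l2; apply: leq_expl; rewrite leq_mul2l Xi2.
exact: leq_ltn_trans Xij Xj1.
Qed.

Let exps := [seq logn p a | p <- primes a].
Let rough_exps := [seq logn l b | l <- rough].
Let odds := [seq l <- primes b | odd (logn l b)].

Lemma size_odds : size odds <= 1.
Proof.
case E : odds => [|l [|l' s]] //; have lE x : x \in odds -> (x \in primes b) && odd (logn x b).
  by rewrite mem_filter andbC.
have /lE /andP [lb ol] : l \in odds by rewrite E mem_head.
have /lE /andP [lb' ol'] : l' \in odds by rewrite E !inE eqxx orbT.
have ll' := odd_exponent_unique h lb lb' ol ol'.
have : uniq odds by rewrite filter_uniq // primes_uniq.
by rewrite E ll' /= inE eqxx.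
Qed.

(** Levels are counted from 1: [X 1] already bounds the exponents of primes with smooth [sg] and
    exceeds the size required by [thue_pair]. *)
Lemma exists_unhit : exists2 i, i < n & gapped (X i) (X i.+1) a /\ gapped (X i) (X i.+1) b.
Proof.
pose covered i := [|| hit X exps i, hit X rough i, hit X rough_exps i, hit X odds i | tame i].
have small : count covered (iota 1 m) < m.
  have cU (p q : pred nat) s : count (fun i => p i || q i) s <= count p s + count q s.
    by rewrite -count_predUI leq_addr.
  have ui := iota_uniq 1 m.
  rewrite /covered; apply: leq_ltn_trans (cU _ _ _) _.
  apply: leq_ltn_trans (leq_add (count_hit X_le exps ui) (cU _ _ _)) _.
  apply: leq_ltn_trans (leq_add (leqnn _) (leq_add (count_hit X_le rough ui) (cU _ _ _))) _.
  apply: leq_ltn_trans (leq_add (leqnn _) (leq_add (leqnn _) (leq_add (count_hit X_le rough_exps ui) (cU _ _ _)))) _.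
  have h1 := leq_trans (count_hit X_le odds ui) size_odds.
  have h2 := count_tame; have h3 := size_rough.
  have h4 : size exps <= k by rewrite size_map.
  have h5 : size rough_exps <= k.+1 ^ 2 by rewrite size_map.
  have mE : m = k + 2 * k.+1 ^ 2 + 1 + 2 * patterns (X 0) + 1 by rewrite /m hn /level_count !addnS.
  move: h1 h2; move: (count (hit X odds) _) (count tame _) => x y h1 h2; rewrite mE.
  by move: h1 h2 h3 h4 h5; move: (size _) (size _) (size _) (patterns _) (k.+1 ^ 2); clear; lia.
have /allPn [i] : ~~ all covered (iota 1 m).
  by rewrite all_count size_iota neq_ltn small.
rewrite mem_iota => /andP [i0 im]; rewrite !negb_or => /and5P [n1 n2 n3 n4 n5].
have iN : i.+1 <= n.-1 by rewrite nE.
exists i; first by rewrite nE; move: im; clear; lia.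
have Xi0 : X 0 <= X i by apply: X_homo.
have outside vs v : ~~ hit X vs i -> v \in vs -> v <= X i \/ X i.+1 < v.
  move=> nh vvs; case: (leqP v (X i)) => v1; first by left.
  right; rewrite ltnNge; apply: contra nh => v2; apply/hasP; exists v => //; by rewrite v1.
split=> p pn.
  have := outside exps _ n1 (map_f _ pn).
  case: (no_prime pn) => [p0|pX] he; first by left; split=> //; exact: leq_trans p0 Xi0.
  by right; apply: leq_ltn_trans pX; apply: X_homo; rewrite nE; move: im; clear; lia.
case: (leqP p (X i.+1)) => p1; last by right.
have pX : p <= X n.-1 by apply: leq_trans p1 (X_homo iN).
left; have [sm|nsm] := boolP (smoothb p); last first.
  have pr : p \in rough by rewrite mem_filter pX nsm.
  case: (outside rough p n2 pr) => [pXi|]; last by rewrite ltnNge p1.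
  by split=> //; exact: (outside rough_exps _ n3 (map_f _ pr)).
have pp : 1 < p by move: pn; rewrite mem_primes => /and3P [/prime_gt1].
have eF : logn p b <= X i.
  apply: leq_trans (sg_smooth_exponent pp (smoothbP p sm)) (leq_trans _ (X_homo i0)).
  by rewrite XS; have [] := next_level_props k (X 0).
split; last by left.
have [op|ep] := boolP (odd (logn p b)).
  by case: (outside odds p n4 _) => //; rewrite ?mem_filter ?op ?pn // ltnNge p1.
rewrite leqNgt; apply: contra n5 => Xp; apply/hasP; exists p => //.
by rewrite /evenT pn sm ep Xp p1.
Qed.
End Unhit.

Lemma bounded_size n X : 0 < n -> 0 < X -> (forall p, p \in primes n -> p <= X /\ logn p n <= X) -> n <= (X ^ X) ^ X.
Proof.
move=> n0 X0 hX; rewrite {1}(prod_primes n0).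
apply: (@leq_trans (\prod_(p <- primes n) X ^ X)).
  rewrite big_seq [X in _ <= X]big_seq; apply: leq_prod => p pn; have [h1 h2] := hX p pn.
  by apply: leq_trans (leq_expl _ h1) _; rewrite leq_pexp2l.
rewrite big_const_seq count_predT iter_muln_1 leq_pexp2l ?expn_gt0 ?X0 //.
rewrite -[leqRHS](size_iota 1 X); apply: uniq_leq_size; first exact: primes_uniq.
move=> p pn; have [h1 _] := hX p pn; rewrite mem_iota add1n ltnS h1 andbT.
by move: pn; rewrite mem_primes => /and3P [/prime_gt0].
Qed.

Definition block (k Z : nat) : nat := iter (level_count k Z) (next_level k) Z.
(** Among [k + 1] consecutive blocks, one contains none of the at most [k] primes of [a]. *)
Definition height (k : nat) : nat := iter k.+1 (block k) 2.
Definition size_bound (k : nat) : nat := (height k ^ height k) ^ height k.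

Lemma leq_iter_next k n Z : Z <= iter n (next_level k) Z.
Proof. by elim: n => //= n IH; apply: leq_trans IH _; have [] := next_level_props k (iter n (next_level k) Z). Qed.

Theorem amicable_bound (R : realType) k a b c d : amicable a b c d -> omega a <= k ->
  a <= size_bound k /\ b <= size_bound k.
Proof.
move=> h oa; pose Z j := iter j (block k) 2.
have Z_le j : Z j <= Z j.+1 by rewrite /Z iterS; apply: leq_iter_next.
have /allPn [j] : ~~ all (hit Z (primes a)) (iota 0 k.+1).
  rewrite all_count size_iota neq_ltn (leq_ltn_trans (count_hit Z_le (primes a) (iota_uniq 0 k.+1))) //.
rewrite mem_iota add0n => /andP [_ jk] nh.
pose X i := iter i (next_level k) (Z j).
have ZX : Z j.+1 = X (level_count k (Z j)) by [].
have no p : p \in primes a -> p <= X 0 \/ X (level_count k (X 0)) < p.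
  move=> pa; case: (leqP p (X 0)) => p1; first by left.
  right; rewrite ltnNge; apply: contra nh => p2; apply/hasP; exists p => //; by rewrite p1.
have Z2 i : 2 <= Z i by elim: i => // i IH; apply: leq_trans IH (Z_le i).
have [i iN [ga gb]] := @exists_unhit R k a b c d X _ h oa (Z2 j) (fun i => erefl _) (erefl _) no.
have X_le i' : X i' <= X i'.+1 by rewrite /X iterS; have [] := next_level_props k (iter i' (next_level k) (Z j)).
have Xi2 : 2 <= X i by apply: leq_trans (Z2 j) (level_homo X_le (leq0n i)).
have [p1 p2 _ _ p5] := next_level_props k (X i).
have bd := gap Xi2 p2 p1 h ga gb p5 (tails_small R (X i) h oa).
have XH : X i <= height k.
  apply: leq_trans (level_homo X_le (ltnW iN)) _; rewrite -ZX; exact: (level_homo Z_le jk).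
have final n : 0 < n -> (n == a) || (n == b) -> n <= size_bound k.
  move=> n0 nab; apply: leq_trans (bounded_size n0 (ltnW Xi2) (bd n nab)) _.
  have H0 : 0 < height k by apply: leq_trans (ltnW Xi2) XH.
  apply: leq_trans (leq_expl _ _) _; first by apply: leq_trans (leq_expl _ XH) (_ : _ <= height k ^ height k); rewrite leq_pexp2l.
  by rewrite leq_pexp2l // expn_gt0 H0.
split; apply: final; rewrite ?eqxx ?orbT //; first exact: amicable_gt0 h.
exact: amicable_gt0 (amicable_sym h).
Qed.

(** * Computability *)

Local Open Scope nat_scope.

Definition cpt n (f : n.-tuple nat -> nat) : Prop := exists c : rec_code n, forall v, rec_eval c v (f v).

Lemma cpt_ext n (f g : n.-tuple nat -> nat) : f =1 g -> cpt f -> cpt g.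
Proof. by move=> fg [c hc]; exists c => v; rewrite -fg. Qed.

Lemma cpt_proj n (i : 'I_n) : cpt (fun v => tnth v i).
Proof. by exists (RProj i). Qed.

Lemma cpt_comp m n (f : m.-tuple nat -> nat) (g : 'I_m -> n.-tuple nat -> nat) :
  cpt f -> (forall i, cpt (g i)) -> cpt (fun v => f [tuple g i v | i < m]).
Proof.
move=> [cf hf] /fin_all_exists [cg hg]; exists (RComp cf cg) => v /=.
by exists [tuple g i v | i < m]; split=> [i|//]; rewrite tnth_mktuple.
Qed.

Lemma cpt_behead n (f : n.-tuple nat -> nat) : cpt f -> cpt (fun w : n.+1.-tuple nat => f [tuple of behead w]).
Proof.
move=> cf; have := cpt_comp cf (fun i => cpt_proj (lift ord0 i)).
apply: cpt_ext => w; congr f; apply: eq_from_tnth => i; rewrite tnth_mktuple.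
by rewrite {1}(tuple_eta w) tnthS.
Qed.

Lemma cpt_thead n : cpt (fun w : n.+1.-tuple nat => thead w).
Proof. exact: cpt_proj. Qed.

Lemma cpt_succ n (f : n.-tuple nat -> nat) : cpt f -> cpt (fun v => (f v).+1).
Proof.
move=> cf; have cs : cpt (fun w : 1.-tuple nat => (thead w).+1) by exists RSucc.
apply: cpt_ext (cpt_comp cs (fun _ : 'I_1 => cf)) => v.
by rewrite /thead tnth_mktuple.
Qed.

Lemma cpt_const n m : cpt (fun _ : n.-tuple nat => m).
Proof. by elim: m => [|m IH]; [exists (RZero n) | apply: cpt_succ]. Qed.

(** Primitive recursion with parameters, with the recursion length [m v] itself a computable
    function of them; the stages required by [rec_eval] are the values [F i] themselves. *)
Lemma cpt_rec n (m z : n.-tuple nat -> nat) (G : nat -> nat -> n.-tuple nat -> nat) (F : nat -> n.-tuple nat -> nat) :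
  (forall v, F 0 v = z v) -> (forall i v, F i.+1 v = G i (F i v) v) ->
  cpt m -> cpt z ->
  cpt (fun w : n.+2.-tuple nat => G (thead w) (thead [tuple of behead w]) [tuple of behead [tuple of behead w]]) ->
  cpt (fun v => F (m v) v).
Proof.
move=> F0 FS cm [cz hz] [cG hG].
have cF : cpt (fun w : n.+1.-tuple nat => F (thead w) [tuple of behead w]).
  exists (RPrim cz cG) => w /=; set x := [tuple of behead w].
  exists (fun i => F i x); split=> // [|i _]; first by rewrite F0.
  rewrite FS; have := hG [tuple of i :: F i x :: x].
  rewrite (_ : thead _ = i) // (_ : thead _ = F i x) //; congr (rec_eval _ _ (G _ _ _)).
  exact: val_inj.
have cg (i : 'I_n.+1) : cpt (fun v : n.-tuple nat => tnth [tuple of m v :: v] i).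
  case: (unliftP ord0 i) => [j ->|->].
    by apply: cpt_ext (cpt_proj j) => v; rewrite tnthS.
  by apply: cpt_ext cm => v; rewrite tnth0.
apply: cpt_ext (cpt_comp cF cg) => v.
have -> : [tuple tnth [tuple of m v :: v] i | i < n.+1] = [tuple of m v :: v].
  by apply: eq_from_tnth => i; rewrite tnth_mktuple.
by rewrite theadE; congr F; apply: val_inj.
Qed.

Lemma cpt_iter n (m z : n.-tuple nat -> nat) (G : nat -> n.-tuple nat -> nat) :
  cpt m -> cpt z -> cpt (fun w : n.+1.-tuple nat => G (thead w) [tuple of behead w]) ->
  cpt (fun v => iter (m v) (G^~ v) (z v)).
Proof.
move=> cm cz cG; apply: (@cpt_rec n m z (fun _ y v => G y v) (fun i v => iter i (G^~ v) (z v))) => //.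
exact: (cpt_behead cG).
Qed.

Lemma cpt_add n (f g : n.-tuple nat -> nat) : cpt f -> cpt g -> cpt (fun v => f v + g v).
Proof.
move=> cf cg; apply: cpt_ext (cpt_iter (G := fun y _ => y.+1) cf cg _) => [v|]; last exact: cpt_succ (cpt_thead _).
by elim: (f v) => //= i ->.
Qed.

Lemma cpt_mul n (f g : n.-tuple nat -> nat) : cpt f -> cpt g -> cpt (fun v => f v * g v).
Proof.
move=> cf cg; apply: cpt_ext (cpt_iter (G := fun y v => g v + y) cf (cpt_const n 0) _) => [v|].
  by elim: (f v) => //= i ->.
by apply: cpt_add (cpt_behead cg) (cpt_thead _).
Qed.

Lemma cpt_exp n (f g : n.-tuple nat -> nat) : cpt f -> cpt g -> cpt (fun v => f v ^ g v).
Proof.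
move=> cf cg; apply: cpt_ext (cpt_iter (G := fun y v => f v * y) cg (cpt_const n 1) _) => [v|].
  by elim: (g v) => //= i ->; rewrite expnS.
by apply: cpt_mul (cpt_behead cf) (cpt_thead _).
Qed.

Lemma cpt_fact n (f : n.-tuple nat -> nat) : cpt f -> cpt (fun v => (f v)`!).
Proof.
move=> cf; apply: (@cpt_rec n f (fun _ => 1) (fun i y _ => i.+1 * y) (fun i _ => i`!)) => //.
  exact: cpt_const.
apply: cpt_mul; first exact: cpt_succ (cpt_thead _).
exact: cpt_behead (cpt_thead _).
Qed.

Ltac cpt := match goal with
  | H : cpt ?f |- cpt ?f => exact: H
  | |- cpt (fun v => ?c) => exact: cpt_const
  | |- cpt (fun v => thead v) => exact: cpt_thead
  | |- cpt (fun v => (@?f v).+1) => apply: (@cpt_succ _ f); cpt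
  | |- cpt (fun v => @?f v + @?g v) => apply: (@cpt_add _ f g); cpt
  | |- cpt (fun v => @?f v * @?g v) => apply: (@cpt_mul _ f g); cpt
  | |- cpt (fun v => @?f v ^ @?g v) => apply: (@cpt_exp _ f g); cpt
  | |- cpt (fun v => (@?f v)`!) => apply: (@cpt_fact _ f); cpt
  end.

Section Bound.
Variable n : nat.
Implicit Types f g : n.-tuple nat -> nat.

Lemma cpt_baker_sep f g : cpt f -> cpt g -> cpt (fun v => baker_sep (f v) (g v)).
Proof. by move=> cf cg; rewrite /baker_sep /sep_offset /baker_exponent; cpt. Qed.

Lemma cpt_heavy_sep f : cpt f -> cpt (fun v => heavy_sep (f v)).
Proof.
move=> cf; have cc : cpt (fun v => chain_sep (f v)).
  by rewrite /chain_sep /chain_const; apply: cpt_baker_sep; cpt.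
rewrite /heavy_sep; apply: cpt_add => //; rewrite /cluster_sep /cluster_const.
by apply: cpt_baker_sep; cpt.
Qed.

Lemma cpt_next_level f g : cpt f -> cpt g -> cpt (fun v => next_level (f v) (g v)).
Proof.
move=> cf cg; have ch := cpt_heavy_sep (cpt_succ cf).
by rewrite /next_level /level_exponent /tail_start /tail_rate /lte_bound /gap_height; cpt.
Qed.

Lemma cpt_level_count f g : cpt f -> cpt g -> cpt (fun v => level_count (f v) (g v)).
Proof. by move=> cf cg; rewrite /level_count /patterns /lte_bound; cpt. Qed.
End Bound.

Lemma cpt_block n (f g : n.-tuple nat -> nat) : cpt f -> cpt g -> cpt (fun v => block (f v) (g v)).
Proof.
move=> cf cg; apply: (@cpt_iter n _ g (fun y v => next_level (f v) y)) => //; first exact: cpt_level_count.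
by apply: cpt_next_level; [exact: cpt_behead cf | exact: cpt_thead].
Qed.

Lemma cpt_height n (f : n.-tuple nat -> nat) : cpt f -> cpt (fun v => height (f v)).
Proof.
move=> cf; apply: (@cpt_iter n _ (fun _ => 2) (fun y v => block (f v) y)); first exact: cpt_succ.
  exact: cpt_const.
by apply: cpt_block; [exact: cpt_behead cf | exact: cpt_thead].
Qed.

Lemma computable_size_bound : computable size_bound.
Proof.
have ch := cpt_height (cpt_proj (ord0 : 'I_1)).
have [c hc] : cpt (fun v : 1.-tuple nat => size_bound (tnth v ord0)) by rewrite /size_bound; cpt.
by exists c => k; have := hc [tuple k].
Qed.

From mathcomp Require Import Rstruct.

Theorem corollary1p5 :
  exists B : nat -> nat,
    computable B /\
    forall k : nat, 0 < k ->
    forall N : nat, odd N -> superperfect N ->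
      omega N <= k \/ omega (sigma N) <= k ->
      N <= B k.
Proof.
exists size_bound; split; first exact: computable_size_bound.
move=> k _ N oN sN hk; have h := superperfect_amicable oN sN.
(* The relation is symmetric up to exchanging the factors 1 and 2, so either side may play the short
   one. The reals occur only in auxiliary estimates, hence any model of them will do. *)
case: hk => hk; first by have [] := amicable_bound Rdefinitions.R h hk.
by have [] := amicable_bound Rdefinitions.R (amicable_sym h) hk.
Qed.
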